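(* Let $A=\mathbf{k}[z;\lambda,\eta,\varphi(z)]$. If $\varphi(z)$ has no multiple roots, then the Hochschild cohomological dimension of $A$ is $2$, and hence $A$ is homologically smooth. Moreover, in this case $A$ is $\nu$-twisted Calabi-Yau, where $\nu\in\operatorname{Aut}(A)$ is given by $\nu(x)=\lambda x$, $\nu(y)=\lambda^{-1}y$ and $\nu(z)=z$.
   Context: $\mathbf{k}$ is a field, $\otimes$ is over $\mathbf{k}$. Let $\lambda\in\mathbf{k}^\times$, $\eta\in\mathbf{k}$, $0\neq\varphi(z)\in\mathbf{k}[z]$, and let $\sigma$ be the automorphism of $\mathbf{k}[z]$ with $\sigma(z)=\lambda z+\eta$. The generalized Weyl algebra $\mathbf{k}[z;\lambda,\eta,\varphi(z)]$ is the $\mathbf{k}$-algebra generated by $x,y,z$ subject to $xz=\sigma(z)x$, $yz=\sigma^{-1}(z)y$ (where $\sigma^{-1}(z)=\lambda^{-1}(z-\eta)$), $yx=\varphi(z)$, $xy=\sigma(\varphi(z))$. ''No multiple roots'' means no multiple roots in an algebraic closure of $\mathbf{k}$, i.e. $\gcd(\varphi,\varphi')=1$. For an algebra $A$, $A^e=A\otimes A^{\mathrm{op}}$, and $A$-bimodules are identified with left $A^e$-modules. The Hochschild cohomological dimension of $A$ is the projective dimension of $A$ as an $A^e$-module. $A$ is homologically smooth if $A$ has a finitely generated projective resolution of finite length as an $A^e$-module. For $\nu\in\operatorname{Aut}(A)$, $A^\nu$ denotes the bimodule $A$ with actions $a_1\cdot m\cdot a_2=a_1m\nu(a_2)$. $A$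 is $\nu$-twisted Calabi-Yau (of dimension $d$, for some $d\in\mathbb{N}$) if $A$ is homologically smooth and, as $A^e$-modules, $\operatorname{Ext}^i_{A^e}(A,A^e)=0$ for $i\neq d$ and $\operatorname{Ext}^d_{A^e}(A,A^e)\cong A^\nu$ (the left $A^e$-module structure of $A^e$ is used to compute Ext, the right one induces the $A^e$-module structure on Ext); the integer $d$ equals the Hochschild cohomological dimension of $A$. *)

(* Defs.v *)
From HB Require Import structures.
From mathcomp Require Import all_boot all_algebra separable boolp.

Set Implicit Arguments.
Unset Strict Implicit.
Unset Printing Implicit Defensive.

Import GRing.Theory.
Local Open Scope ring_scope.
Local Open Scope quotient_scope.

Section GWA.
Variables (k : fieldType) (lam eta : k) (phi : {poly k}).

Definition gwa_sigma (p : {poly k}) : {poly k} :=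
  p \Po (lam *: 'X + eta%:P).

Definition gwa_rel (B : algType k) (x y z : B) : Prop :=
  [/\ x * z = (lam *: z + eta%:A) * x,
      y * z = (lam^-1 *: (z - eta%:A)) * y,
      y * x = horner_alg z phi
    & x * y = horner_alg z (gwa_sigma phi)].

(* The universal property of the presentation by [x, y, z] and [gwa_rel]. An
   [algType] is nontrivial; nothing is lost, as the presented algebra is nonzero
   and every algebra maps uniquely to the zero algebra. *)
Definition is_gwa (A : algType k) (x y z : A) : Prop :=
  gwa_rel x y z /\
  forall (B : algType k) (x' y' z' : B), gwa_rel x' y' z' ->
    exists f : {lrmorphism A -> B},
      [/\ f x = x', f y = y' & f z = z'] /\
      forall g : {lrmorphism A -> B},
        [/\ g x = x', g y = y' & g z = z'] -> g =1 f.

End GWA.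

Section Env.
Variables (k : fieldType) (A : algType k).

Definition bilin (V : lmodType k) (f : A -> A -> V) : Prop :=
  (forall b, linear (f^~ b)) /\ (forall a, linear (f a)).

Definition fsum (V : lmodType k) (f : A -> A -> V) (s : seq (A * A)) : V :=
  \sum_(p <- s) f p.1 p.2.

(* [s] stands for the formal sum of the a (x) b, (a, b) in s. Two formal sums
   are equal in the tensor product iff no bilinear map separates them. *)
Definition env_rel (s t : seq (A * A)) : bool :=
  `[< forall (V : lmodType k) (f : A -> A -> V),
        bilin f -> fsum f s = fsum f t >].

Lemma env_relP s t : reflect (forall (V : lmodType k) (f : A -> A -> V),
  bilin f -> fsum f s = fsum f t) (env_rel s t).
Proof. exact: asboolP. Qed.

Lemma env_rel_refl : reflexive env_rel.
Proof. by move=> s; apply/env_relP. Qed.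
Lemma env_rel_sym : symmetric env_rel.
Proof.
by move=> s t; apply/env_relP/env_relP => H V f bf; rewrite (H V f bf).
Qed.
Lemma env_rel_trans : transitive env_rel.
Proof.
move=> t s u /env_relP H1 /env_relP H2; apply/env_relP => V f bf.
by rewrite (H1 V f bf) (H2 V f bf).
Qed.

Canonical env_equiv :=
  EquivRel env_rel env_rel_refl env_rel_sym env_rel_trans.

Definition env := {eq_quot env_equiv}.
HB.instance Definition _ := Choice.on env.
HB.instance Definition _ := EqQuotient.on env.

Lemma env_eqP (s t : seq (A * A)) :
  (forall (V : lmodType k) (f : A -> A -> V), bilin f -> fsum f s = fsum f t)
  <-> \pi_env s = \pi_env t.
Proof.
split=> [H | /eqmodP/env_relP //].
by apply/eqmodP/env_relP.
Qed.

Lemma fsum_repr (V : lmodType k) (f : A -> A -> V) s :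
  bilin f -> fsum f (repr (\pi_env s)) = fsum f s.
Proof. by move=> bf; apply: (proj2 (env_eqP _ _)) => //; rewrite reprK. Qed.

Definition env_add (e e' : env) : env := \pi_env (repr e ++ repr e').
Definition env_opp (e : env) : env :=
  \pi_env [seq (- p.1, p.2) | p <- repr e].
Definition env_scale (c : k) (e : env) : env :=
  \pi_env [seq (c *: p.1, p.2) | p <- repr e].
Definition mulseq (s t : seq (A * A)) : seq (A * A) :=
  [seq (p.1 * q.1, q.2 * p.2) | p <- s, q <- t].
Definition env_mul (e e' : env) : env := \pi_env (mulseq (repr e) (repr e')).

Section Bilin.
Variables (V : lmodType k) (f : A -> A -> V).
Hypothesis bf : bilin f.

Lemma bilinDl a a' b : f (a + a') b = f a b + f a' b.
Proof. by have := bf.1 b 1 a a'; rewrite !scale1r. Qed.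
Lemma bilinDr a b b' : f a (b + b') = f a b + f a b'.
Proof. by have := bf.2 a 1 b b'; rewrite !scale1r. Qed.
Lemma bilin0l b : f 0 b = 0.
Proof. by apply: (addrI (f 0 b)); rewrite -bilinDl !addr0. Qed.
Lemma bilin0r a : f a 0 = 0.
Proof. by apply: (addrI (f a 0)); rewrite -bilinDr !addr0. Qed.
Lemma bilinZl c a b : f (c *: a) b = c *: f a b.
Proof. by have := bf.1 b c a 0; rewrite bilin0l !addr0. Qed.
Lemma bilinZr c a b : f a (c *: b) = c *: f a b.
Proof. by have := bf.2 a c b 0; rewrite bilin0r !addr0. Qed.
Lemma bilinNl a b : f (- a) b = - f a b.
Proof. by rewrite -(scaleN1r a) bilinZl scaleN1r. Qed.

Lemma fsum_nil : fsum f [::] = 0.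
Proof. exact: big_nil. Qed.
Lemma fsum_seq1 p : fsum f [:: p] = f p.1 p.2.
Proof. exact: big_seq1. Qed.
Lemma fsum_cat s t : fsum f (s ++ t) = fsum f s + fsum f t.
Proof. exact: big_cat. Qed.
Lemma fsum_opp s : fsum f [seq (- p.1, p.2) | p <- s] = - fsum f s.
Proof.
by rewrite /fsum big_map -sumrN; apply: eq_bigr => p _ /=; rewrite bilinNl.
Qed.
Lemma fsum_scale c s : fsum f [seq (c *: p.1, p.2) | p <- s] = c *: fsum f s.
Proof.
by rewrite /fsum big_map scaler_sumr; apply: eq_bigr => p _ /=;
  rewrite bilinZl.
Qed.
Lemma fsum_mul s t : fsum f (mulseq s t) =
  \sum_(p <- s) \sum_(q <- t) f (p.1 * q.1) (q.2 * p.2).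
Proof. by rewrite /fsum /mulseq big_allpairs_dep. Qed.

Lemma bilin_mull a b : bilin (fun a' b' => f (a * a') (b' * b)).
Proof.
split=> c d u v; first by rewrite mulrDr -scalerAr bilinDl bilinZl.
by rewrite mulrDl -scalerAl bilinDr bilinZr.
Qed.
Lemma bilin_mulr a b : bilin (fun a' b' => f (a' * a) (b * b')).
Proof.
split=> c d u v; first by rewrite mulrDl -scalerAl bilinDl bilinZl.
by rewrite mulrDr -scalerAr bilinDr bilinZr.
Qed.
End Bilin.

Lemma pi_add s t : env_add (\pi_env s) (\pi_env t) = \pi_env (s ++ t).
Proof.
by apply/env_eqP => V f bf; rewrite !fsum_cat !fsum_repr.
Qed.
Lemma pi_opp s : env_opp (\pi_env s) = \pi_env [seq (- p.1, p.2) | p <- s].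
Proof. by apply/env_eqP => V f bf; rewrite !fsum_opp ?fsum_repr. Qed.
Lemma pi_scale c s :
  env_scale c (\pi_env s) = \pi_env [seq (c *: p.1, p.2) | p <- s].
Proof. by apply/env_eqP => V f bf; rewrite !fsum_scale ?fsum_repr. Qed.
Lemma pi_mul s t : env_mul (\pi_env s) (\pi_env t) = \pi_env (mulseq s t).
Proof.
apply/env_eqP => V f bf; rewrite !fsum_mul.
transitivity (\sum_(p <- repr (\pi_env s)) \sum_(q <- t)
    f (p.1 * q.1) (q.2 * p.2)).
  apply: eq_bigr => p _.
  exact: (fsum_repr t (bilin_mull bf p.1 p.2)).
rewrite exchange_big [RHS]exchange_big /=; apply: eq_bigr => q _.
exact: (fsum_repr s (bilin_mulr bf q.1 q.2)).
Qed.

Lemma env_ind (P : env -> Prop) : (forall s, P (\pi_env s)) -> forall e, P e.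
Proof. by move=> H e; rewrite -[e]reprK. Qed.

Definition env0 : env := \pi_env [::].
Definition env1 : env := \pi_env [:: (1, 1)].

Lemma env_addA : associative env_add.
Proof.
by elim/env_ind=> s; elim/env_ind=> t; elim/env_ind=> u;
  rewrite !pi_add catA.
Qed.
Lemma env_addC : commutative env_add.
Proof.
elim/env_ind=> s; elim/env_ind=> t; rewrite !pi_add; apply/env_eqP => V f bf.
by rewrite !fsum_cat addrC.
Qed.
Lemma env_add0 : left_id env0 env_add.
Proof. by elim/env_ind=> s; rewrite pi_add. Qed.
Lemma env_addN : left_inverse env0 env_opp env_add.
Proof.
elim/env_ind=> s; rewrite pi_opp pi_add; apply/env_eqP => V f bf.
by rewrite fsum_cat fsum_opp // addNr fsum_nil.
Qed.
HB.instance Definition _ :=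
  GRing.isZmodule.Build env env_addA env_addC env_add0 env_addN.

Lemma env_mulA : associative env_mul.
Proof.
elim/env_ind=> s; elim/env_ind=> t; elim/env_ind=> u; rewrite !pi_mul.
apply/env_eqP => V f bf; rewrite !fsum_mul {2}/mulseq big_allpairs_dep /=.
apply: eq_bigr => p _; rewrite {1}/mulseq big_allpairs_dep /=.
by apply: eq_bigr => q _; apply: eq_bigr => r _; rewrite !mulrA.
Qed.
Lemma env_mul1l : left_id env1 env_mul.
Proof.
elim/env_ind=> s; rewrite pi_mul; apply/env_eqP => V f bf.
by rewrite fsum_mul big_seq1 /=; apply: eq_bigr => p _; rewrite mul1r mulr1.
Qed.
Lemma env_mul1r : right_id env1 env_mul.
Proof.
elim/env_ind=> s; rewrite pi_mul; apply/env_eqP => V f bf.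
by rewrite fsum_mul; apply: eq_bigr => p _; rewrite big_seq1 mul1r mulr1.
Qed.
Lemma env_mulDl : left_distributive env_mul env_add.
Proof.
elim/env_ind=> s; elim/env_ind=> t; elim/env_ind=> u.
rewrite pi_add !pi_mul pi_add; apply/env_eqP => V f bf.
by rewrite fsum_cat !fsum_mul big_cat.
Qed.
Lemma env_mulDr : right_distributive env_mul env_add.
Proof.
elim/env_ind=> s; elim/env_ind=> t; elim/env_ind=> u.
rewrite pi_add !pi_mul pi_add; apply/env_eqP => V f bf.
rewrite fsum_cat !fsum_mul -big_split /=; apply: eq_bigr => p _.
by rewrite big_cat.
Qed.
Lemma env_1neq0 : env1 != env0.
Proof.
have mul_bilin : bilin (fun a b : A => a * b : A).
  split=> [b c u v | a c u v] /=; first by rewrite mulrDl -scalerAl.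
  by rewrite mulrDr -scalerAr.
apply/eqP => /env_eqP/(_ _ _ mul_bilin).
by rewrite fsum_seq1 fsum_nil mulr1 => /eqP; rewrite oner_eq0.
Qed.
HB.instance Definition _ := GRing.Zmodule_isNzRing.Build env
  env_mulA env_mul1l env_mul1r env_mulDl env_mulDr env_1neq0.

Lemma env_scaleA c d e : env_scale c (env_scale d e) = env_scale (c * d) e.
Proof.
elim/env_ind: e => s; rewrite !pi_scale; apply/env_eqP => V f bf.
by rewrite !fsum_scale // scalerA.
Qed.
Lemma env_scale1 : left_id 1 env_scale.
Proof.
elim/env_ind=> s; rewrite pi_scale; apply/env_eqP => V f bf.
by rewrite fsum_scale // scale1r.
Qed.
Lemma env_scaleDr : right_distributive env_scale +%R.
Proof.
move=> c; elim/env_ind=> s; elim/env_ind=> t.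
rewrite [_ + _]pi_add !pi_scale [RHS]pi_add; apply/env_eqP => V f bf.
by rewrite !(fsum_scale, fsum_cat) // scalerDr.
Qed.
Lemma env_scaleDl e : {morph env_scale^~ e : c d / c + d}.
Proof.
move=> c d; elim/env_ind: e => s.
rewrite !pi_scale [RHS]pi_add; apply/env_eqP => V f bf.
by rewrite !(fsum_scale, fsum_cat) // scalerDl.
Qed.
HB.instance Definition _ := GRing.Zmodule_isLmodule.Build k env
  env_scaleA env_scale1 env_scaleDr env_scaleDl.

Lemma env_scaleAl (c : k) (e e' : env) : c *: (e * e') = (c *: e) * e'.
Proof.
rewrite -[LHS]/(env_scale c (env_mul e e')) -[RHS]/(env_mul (env_scale c e) e').
elim/env_ind: e => s; elim/env_ind: e' => t; rewrite !(pi_mul, pi_scale).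
apply/env_eqP => V f bf; rewrite fsum_scale // !fsum_mul big_map scaler_sumr.
apply: eq_bigr => p _; rewrite scaler_sumr; apply: eq_bigr => q _ /=.
by rewrite -scalerAl bilinZl.
Qed.
HB.instance Definition _ := GRing.Lmodule_isLalgebra.Build k env env_scaleAl.
Lemma env_scaleAr (c : k) (e e' : env) : c *: (e * e') = e * (c *: e').
Proof.
rewrite -[LHS]/(env_scale c (env_mul e e')) -[RHS]/(env_mul e (env_scale c e')).
elim/env_ind: e => s; elim/env_ind: e' => t; rewrite !(pi_mul, pi_scale).
apply/env_eqP => V f bf; rewrite fsum_scale // !fsum_mul scaler_sumr.
apply: eq_bigr => p _; rewrite big_map scaler_sumr; apply: eq_bigr => q _ /=.
by rewrite -scalerAr bilinZl.
Qed.
HB.instance Definition _ := GRing.Lalgebra_isAlgebra.Build k env env_scaleAr.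

Definition tens (a b : A) : env := \pi_env [:: (a, b)].

Lemma tens_bilin : bilin tens.
Proof.
split=> [b c u v | a c u v].
  rewrite -[RHS]/(env_add (env_scale c (tens u b)) (tens v b)).
  rewrite /tens pi_scale pi_add; apply/env_eqP => V f bf.
  by rewrite fsum_cat !fsum_seq1 /= bilinDl // bilinZl.
rewrite -[RHS]/(env_add (env_scale c (tens a u)) (tens a v)).
rewrite /tens pi_scale pi_add; apply/env_eqP => V f bf.
by rewrite fsum_cat !fsum_seq1 /= bilinDr // bilinZl // bilinZr.
Qed.

Lemma tensM a b a' b' : tens a b * tens a' b' = tens (a * a') (b' * b).
Proof. by rewrite [LHS]pi_mul. Qed.

Lemma tens11 : tens 1 1 = 1.
Proof. by []. Qed.

Lemma env_sum (e : env) : e = \sum_(p <- repr e) tens p.1 p.2.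
Proof.
rewrite -{1}[e]reprK; elim: (repr e) => [|[a b] s IHs]; first by rewrite big_nil.
by rewrite big_cons -IHs [RHS]pi_add.
Qed.

(* [env_lift f] is the linear map induced by [f] when [f] is bilinear. *)
Definition env_lift (V : lmodType k) (f : A -> A -> V) (e : env) : V :=
  fsum f (repr e).

Lemma env_lift_tens (V : lmodType k) (f : A -> A -> V) a b :
  bilin f -> env_lift f (tens a b) = f a b.
Proof. by move=> bf; rewrite /env_lift fsum_repr // fsum_seq1. Qed.

Lemma env_lift_linear (V : lmodType k) (f : A -> A -> V) :
  bilin f -> linear (env_lift f).
Proof.
move=> bf c; elim/env_ind=> s; elim/env_ind=> t.
rewrite [c *: _]pi_scale [_ + _]pi_add /env_lift !fsum_repr //.
by rewrite fsum_cat fsum_scale.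
Qed.

Lemma env_liftD (V : lmodType k) (f : A -> A -> V) e e' :
  bilin f -> env_lift f (e + e') = env_lift f e + env_lift f e'.
Proof.
by move=> bf; have := env_lift_linear bf 1 e e'; rewrite !scale1r.
Qed.

Lemma env_lift_unique (V : lmodType k) (g h : {linear env -> V}) :
  (forall a b, g (tens a b) = h (tens a b)) -> g =1 h.
Proof.
by move=> H e; rewrite [e]env_sum !linear_sum; apply: eq_bigr.
Qed.

Lemma env_liftM (V : lmodType k) (f : A -> A -> V) e e' : bilin f ->
  env_lift f (e * e') =
  env_lift (fun a b => env_lift (fun a' b' => f (a * a') (b' * b)) e') e.
Proof.
elim/env_ind: e => s; elim/env_ind: e' => t bf.
rewrite [_ * _]pi_mul /env_lift fsum_repr // fsum_mul fsum_repr.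
  apply: eq_bigr => p _; rewrite fsum_repr //; exact: bilin_mull.
split=> [b c u v | a c u v]; rewrite !fsum_repr; try exact: bilin_mull;
  rewrite /fsum scaler_sumr -big_split; apply: eq_bigr => p _ /=.
  by rewrite mulrDl -scalerAl bilinDl // bilinZl.
by rewrite mulrDr -scalerAr bilinDr // bilinZr.
Qed.

End Env.

(* The anti-automorphism a (x) b |-> b (x) a, through which right modules over
   the enveloping algebra are identified with left ones: the right module [N]
   is the bimodule with b n a = n (a (x) b). *)
Definition env_swap (k : fieldType) (A : algType k) (e : env A) : (env A)^c :=
  env_lift (fun a b => tens b a : env A) e.

Section EnvSwap.
Variables (k : fieldType) (A : algType k).

Lemma swap_bilin : bilin (fun a b : A => tens b a).
Proof.
by split=> [b | a]; [exact: (tens_bilin A).2 | exact: (tens_bilin A).1].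
Qed.

Lemma env_swap_tens (a b : A) : env_swap (tens a b) = tens b a.
Proof. exact: env_lift_tens swap_bilin. Qed.

Lemma env_swap_additive : additive (@env_swap k A).
Proof.
move=> e e'; have := env_lift_linear swap_bilin (-1) e' e.
by rewrite !scaleN1r [_ + e]addrC [RHS]addrC.
Qed.
HB.instance Definition _ := GRing.isZmodMorphism.Build (env A) (env A)^c
  (@env_swap k A) env_swap_additive.

Lemma env_swap_monoid : GRing.monoid_morphism (@env_swap k A).
Proof.
split=> [|e e']; first exact: env_swap_tens.
rewrite [e]env_sum [e']env_sum mulr_suml !raddf_sum mulr_suml.
apply: eq_bigr => p _; rewrite mulr_sumr !raddf_sum mulr_sumr.
apply: eq_bigr => q _; rewrite tensM /= !env_swap_tens.
exact: esym (tensM q.2 q.1 p.2 p.1).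
Qed.
HB.instance Definition _ := GRing.isMonoidMorphism.Build (env A) (env A)^c
  (@env_swap k A) env_swap_monoid.
End EnvSwap.

Definition twist (k : fieldType) (A : algType k) (nu : {lrmorphism A -> A}) :
  Type := A.

Section Twist.
Variables (k : fieldType) (A : algType k) (nu : {lrmorphism A -> A}).
Local Notation twist := (twist nu).

HB.instance Definition _ := GRing.Zmodule.copy twist A.

(* a . m . b = a m nu(b) *)
Definition twist_scale (e : env A) (m : twist) : twist :=
  env_lift (fun a b : A => a * m * nu b : A) e.

Lemma twist_bilin (m : A) : bilin (fun a b : A => a * m * nu b : A).
Proof.
split=> [b c u v | a c u v]; first by rewrite !mulrDl -!scalerAl.
by rewrite linearP mulrDr -scalerAr.
Qed.

Lemma twist_scale_tens a b (m : twist) :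
  twist_scale (tens a b) m = (a * m * nu b : A).
Proof. exact: env_lift_tens (twist_bilin m). Qed.

Lemma twist_scaleDl m : {morph twist_scale^~ m : e e' / e + e'}.
Proof. by move=> e e'; apply: env_liftD; apply: twist_bilin. Qed.
Lemma twist_scaleDr : right_distributive twist_scale +%R.
Proof.
move=> e m n; rewrite /twist_scale /env_lift /fsum -big_split /=.
by apply: eq_bigr => p _; rewrite mulrDr mulrDl.
Qed.
Lemma twist_scale1 : left_id 1 twist_scale.
Proof. by move=> m; rewrite -tens11 twist_scale_tens rmorph1 mul1r mulr1. Qed.
Lemma twist_scaleA e e' m :
  twist_scale e (twist_scale e' m) = twist_scale (e * e') m.
Proof.
rewrite /twist_scale env_liftM; last exact: twist_bilin.
apply: eq_bigr => p _; rewrite /env_lift /fsum mulr_sumr mulr_suml.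
by apply: eq_bigr => q _; rewrite rmorphM !mulrA.
Qed.
HB.instance Definition _ := GRing.Zmodule_isLmodule.Build (env A) twist
  twist_scaleA twist_scale1 twist_scaleDr twist_scaleDl.

End Twist.

Definition regbim (k : fieldType) (A : algType k) : lmodType (env A) :=
  twist (idfun : {lrmorphism A -> A}).

Section Projective.
Variable R : pzRingType.

Definition projective (P : lmodType R) : Prop :=
  forall (M N : lmodType R) (g : {linear M -> N}) (f : {linear P -> N}),
    (forall v, exists u, g u = v) ->
    exists h : {linear P -> M}, forall p, g (h p) = f p.

Definition fin_gen (P : lmodType R) : Prop :=
  exists (n : nat) (v : 'I_n -> P),
    forall p, exists c : 'I_n -> R, p = \sum_(i < n) c i *: v i.

Record resolution (M : lmodType R) := Resolution {
  res_obj :> nat -> lmodType R;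
  res_d : forall i, {linear res_obj i.+1 -> res_obj i};
  res_aug : {linear res_obj 0%N -> M};
  res_proj : forall i, projective (res_obj i);
  res_aug_surj : forall m, exists u, res_aug u = m;
  res_exact0 : forall u, res_aug u = 0 <-> exists v, res_d 0 v = u;
  res_exact : forall i u, res_d i u = 0 <-> exists v, res_d i.+1 v = u
}.

Definition res_length_le (M : lmodType R) (P : resolution M) (n : nat) : Prop :=
  forall i, (n < i)%N -> forall u : P i, u = 0.

Definition proj_dim_le (M : lmodType R) (n : nat) : Prop :=
  exists P : resolution M, res_length_le P n.

Definition proj_dim_eq (M : lmodType R) (n : nat) : Prop :=
  proj_dim_le M n /\ forall m, proj_dim_le M m -> (n <= m)%N.

End Projective.

Section Homology.
Variables (R : pzRingType) (V0 V1 V2 : lmodType R).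
Variables (f : {linear V0 -> V1}) (g : {linear V1 -> V2}).

Definition cycle_pred : {pred V1} := [pred v | g v == 0].
Lemma cycle_closed : submod_closed cycle_pred.
Proof.
split=> [|a u v]; rewrite !inE ?linear0 // linearP.
by move=> /eqP-> /eqP->; rewrite scaler0 addr0.
Qed.
HB.instance Definition _ := GRing.isSubmodClosed.Build R V1 cycle_pred
  cycle_closed.

Definition cycles : Type := {v : V1 | v \in cycle_pred}.
HB.instance Definition _ := SubChoice.on cycles.
HB.instance Definition _ := [SubChoice_isSubLmodule of cycles by <:].

Definition homologous (u v : cycles) : bool :=
  `[< exists w, f w = val u - val v >].
Lemma homologous_refl : reflexive homologous.
Proof. by move=> u; apply/asboolP; exists 0; rewrite linear0 subrr. Qed.
Lemma homologous_sym : symmetric homologous.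
Proof.
by move=> u v; apply/asboolP/asboolP => -[w Hw]; exists (- w);
  rewrite linearN Hw opprB.
Qed.
Lemma homologous_trans : transitive homologous.
Proof.
move=> v u w /asboolP[p Hp] /asboolP[q Hq]; apply/asboolP; exists (p + q).
by rewrite linearD Hp Hq addrA subrK.
Qed.
Canonical homologous_equiv :=
  EquivRel homologous homologous_refl homologous_sym homologous_trans.

Definition homology := {eq_quot homologous_equiv}.
HB.instance Definition _ := Choice.on homology.
HB.instance Definition _ := EqQuotient.on homology.

Lemma homologyP (u v : cycles) :
  (exists w, f w = val u - val v) <-> \pi_homology u = \pi_homology v.
Proof.
by split=> [H|/eqmodP/asboolP//]; apply/eqmodP/asboolP.
Qed.

Lemma repr_homology u :
  exists w, f w = val (repr (\pi_homology u)) - val u.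
Proof. by apply/homologyP; rewrite reprK. Qed.

Definition homology_add (a b : homology) : homology :=
  \pi_homology (repr a + repr b).
Definition homology_opp (a : homology) : homology := \pi_homology (- repr a).
Definition homology_scale (r : R) (a : homology) : homology :=
  \pi_homology (r *: repr a).

Lemma homology_pi_add u v :
  homology_add (\pi_homology u) (\pi_homology v) = \pi_homology (u + v).
Proof.
apply/homologyP; have [p Hp] := repr_homology u.
have [q Hq] := repr_homology v; exists (p + q).
by rewrite linearD Hp Hq !raddfD /= addrACA.
Qed.
Lemma homology_pi_opp u : homology_opp (\pi_homology u) = \pi_homology (- u).
Proof.
apply/homologyP; have [p Hp] := repr_homology u; exists (- p).
by rewrite linearN Hp !raddfN /= opprB opprK addrC.
Qed.
Lemma homology_pi_scale r u :
  homology_scale r (\pi_homology u) = \pi_homology (r *: u).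
Proof.
apply/homologyP; have [p Hp] := repr_homology u; exists (r *: p).
by rewrite linearZ Hp /= scalerBr.
Qed.

Lemma homology_ind (P : homology -> Prop) :
  (forall u, P (\pi_homology u)) -> forall a, P a.
Proof. by move=> H a; rewrite -[a]reprK. Qed.

Definition homology0 : homology := \pi_homology 0.
Lemma homology_addA : associative homology_add.
Proof.
by elim/homology_ind=> u; elim/homology_ind=> v; elim/homology_ind=> w;
  rewrite !homology_pi_add addrA.
Qed.
Lemma homology_addC : commutative homology_add.
Proof.
by elim/homology_ind=> u; elim/homology_ind=> v;
  rewrite !homology_pi_add addrC.
Qed.
Lemma homology_add0 : left_id homology0 homology_add.
Proof. by elim/homology_ind=> u; rewrite homology_pi_add add0r. Qed.
Lemma homology_addN : left_inverse homology0 homology_opp homology_add.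
Proof.
by elim/homology_ind=> u; rewrite homology_pi_opp homology_pi_add addNr.
Qed.
HB.instance Definition _ := GRing.isZmodule.Build homology
  homology_addA homology_addC homology_add0 homology_addN.

Lemma homology_scaleA r s a :
  homology_scale r (homology_scale s a) = homology_scale (r * s) a.
Proof. by elim/homology_ind: a => u; rewrite !homology_pi_scale scalerA. Qed.
Lemma homology_scale1 : left_id 1 homology_scale.
Proof. by elim/homology_ind=> u; rewrite homology_pi_scale scale1r. Qed.
Lemma homology_scaleDr : right_distributive homology_scale +%R.
Proof.
move=> r; elim/homology_ind=> u; elim/homology_ind=> v.
by rewrite [_ + _]homology_pi_add !homology_pi_scale [RHS]homology_pi_add
  scalerDr.
Qed.
Lemma homology_scaleDl a : {morph homology_scale^~ a : r s / r + s}.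
Proof.
move=> r s; elim/homology_ind: a => u.
by rewrite !homology_pi_scale [RHS]homology_pi_add scalerDl.
Qed.
HB.instance Definition _ := GRing.Zmodule_isLmodule.Build R homology
  homology_scaleA homology_scale1 homology_scaleDr homology_scaleDl.

End Homology.

(* Hom_R(P, R) is a right R-module under (h r)(p) = h(p) r; a ring morphism
   [tau : R -> R^c] turns it into a left R-module. *)
Definition dual (R : pzRingType) (tau : {rmorphism R -> R^c})
  (P : lmodType R) : Type := {linear P -> R^o}.

Section Dual.
Variables (R : pzRingType) (tau : {rmorphism R -> R^c}).

Section DualModule.
Variable P : lmodType R.
Local Notation dual := (dual tau P).

HB.instance Definition _ := gen_eqMixin dual.
HB.instance Definition _ := gen_choiceMixin dual.

Definition dual_fun (h : dual) : {linear P -> R^o} := h.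

Lemma dualP (h h' : dual) : dual_fun h =1 dual_fun h' -> h = h'.
Proof.
case: h h' => h [[a] [b]] [h' [[a'] [b']]] /= /funext eqh.
have {}eqh : h = h' by [].
case: _ / eqh in a' b' *.
by rewrite (Prop_irrelevance a a') (Prop_irrelevance b b').
Qed.

Definition dual_mk (h : P -> R^o) (hl : linear h) : dual :=
  GRing.Linear.clone _ _ _ _ h
    (HB.pack h (GRing.isLinear.Build R P R^o *:%R h hl)).

Lemma dual_mkE h hl p : dual_fun (@dual_mk h hl) p = h p.
Proof. by []. Qed.

Lemma dual_add_linear (h h' : dual) :
  linear (fun p => dual_fun h p + dual_fun h' p).
Proof. by move=> r p q; rewrite !linearP scalerDr addrACA. Qed.
Lemma dual_opp_linear (h : dual) : linear (fun p => - dual_fun h p).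
Proof. by move=> r p q; rewrite linearP opprD scalerN. Qed.
Lemma dual_zero_linear : linear (fun _ : P => 0 : R^o).
Proof. by move=> r p q; rewrite scaler0 addr0. Qed.
Lemma dual_scale_linear (r : R) (h : dual) :
  linear (fun p => dual_fun h p * (tau r : R) : R^o).
Proof.
move=> s p q; rewrite linearP mulrDl; congr (_ + _).
exact: esym (mulrA s (dual_fun h p) (tau r)).
Qed.

Definition dual_add h h' : dual := dual_mk (dual_add_linear h h').
Definition dual_opp h : dual := dual_mk (dual_opp_linear h).
Definition dual_zero : dual := dual_mk dual_zero_linear.
Definition dual_scale r h : dual := dual_mk (dual_scale_linear r h).

Lemma dual_addA : associative dual_add.
Proof. by move=> f g h; apply: dualP => p /=; rewrite addrA. Qed.
Lemma dual_addC : commutative dual_add.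
Proof. by move=> f g; apply: dualP => p /=; rewrite addrC. Qed.
Lemma dual_add0 : left_id dual_zero dual_add.
Proof. by move=> f; apply: dualP => p /=; rewrite add0r. Qed.
Lemma dual_addN : left_inverse dual_zero dual_opp dual_add.
Proof. by move=> f; apply: dualP => p /=; rewrite addNr. Qed.
HB.instance Definition _ :=
  GRing.isZmodule.Build dual dual_addA dual_addC dual_add0 dual_addN.

Lemma dual_scaleA r s h :
  dual_scale r (dual_scale s h) = dual_scale (r * s) h.
Proof. by apply: dualP => p /=; rewrite rmorphM -mulrA. Qed.
Lemma dual_scale1 : left_id 1 dual_scale.
Proof. by move=> h; apply: dualP => p /=; rewrite rmorph1 mulr1. Qed.
Lemma dual_scaleDr : right_distributive dual_scale +%R.
Proof. by move=> r f g; apply: dualP => p /=; rewrite mulrDl. Qed.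
Lemma dual_scaleDl h : {morph dual_scale^~ h : r s / r + s}.
Proof. by move=> r s; apply: dualP => p /=; rewrite rmorphD mulrDr. Qed.
HB.instance Definition _ := GRing.Zmodule_isLmodule.Build R dual
  dual_scaleA dual_scale1 dual_scaleDr dual_scaleDl.

End DualModule.

Section DualMap.
Variables (P Q : lmodType R) (d : {linear P -> Q}).
Definition dual_map (h : dual tau Q) : dual tau P := dual_fun h \o d.
Lemma dual_map_linear : linear dual_map.
Proof. by move=> r f g; apply: dualP. Qed.
HB.instance Definition _ :=
  GRing.isLinear.Build R (dual tau Q) (dual tau P) *:%R dual_map
    dual_map_linear.
End DualMap.

(* Ext^i_R(M, R), with the [R]-module structure of [dual tau], computed from the
   projective resolution [P] of [M]. *)
Definition Ext (M : lmodType R) (P : resolution M) (i : nat) : lmodType R :=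
  match i with
  | 0%N => homology (\0 : {linear dual tau (P 0%N) -> dual tau (P 0%N)})
                    (dual_map (res_d P 0))
  | j.+1 => homology (dual_map (res_d P j)) (dual_map (res_d P j.+1))
  end.

End Dual.

Section Hochschild.
Variables (k : fieldType) (A : algType k).

Definition hochschild_cdim (n : nat) : Prop := proj_dim_eq (regbim A) n.

Definition homologically_smooth : Prop :=
  exists P : resolution (regbim A),
    (forall i, fin_gen (P i)) /\ exists n, res_length_le P n.

(* Ext does not depend on the resolution up to isomorphism, so it may be
   computed from any. *)
Definition twisted_CY (nu : {lrmorphism A -> A}) (d : nat) : Prop :=
  homologically_smooth /\
  forall P : resolution (regbim A),
    (forall i, i <> d -> forall u : Ext (@env_swap k A) P i, u = 0) /\
    exists h : {linear Ext (@env_swap k A) P d -> twist nu}, bijective h.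

End Hochschild.

(* Main.v *)
Require Import Defs.
From HB Require Import structures.
From mathcomp Require Import all_boot all_order all_algebra separable polyXY boolp functions ring.

Set Implicit Arguments.
Unset Strict Implicit.
Unset Printing Implicit Defensive.

Import Order.TTheory GRing.Theory Num.Theory.
Local Open Scope ring_scope.
Local Open Scope quotient_scope.

(** Let R be the enveloping algebra of A. Write x, y, z1 for the elements
    x (x) 1, y (x) 1, z (x) 1 of R and X, Y, z2 for 1 (x) x, 1 (x) y, 1 (x) z.
    The theorem comes from an explicit resolution of A by R-modules

      0 -> R^4 E -> R^3 -> R -> A -> 0.

    The kernel of the multiplication R -> A is the left ideal generated by
    z1 - z2, x - X and y - Y ([gwa_exact0]). Differentiating the four defining
    relations of A gives four relations between these generators, the rows of
    the matrix d2 ([gwa_d2]). They generate all relations ([gwa_exact1]): by the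
    universal property of A, values at x, y, z that satisfy the differentiated
    relations extend to a derivation of A ([gwa_derivation]), and the derivation
    with values in the cokernel of d2 shows that a relation vanishes there.

    The rows of d2 are dependent, and this is where the roots of phi matter.
    Write phi(z1) - phi(z2) = (z1 - z2) D. On the diagonal z1 = z2 the quotient D
    becomes phi', so if phi has no multiple root there are polynomials a and b with
    a phi(z1) + b D = 1 modulo z1 - z2 ([separable_bezout_diag]). From a and b one
    writes down a 4 x 4 matrix E with E d2 = d2 such that w d2 = 0 implies
    w E = 0. It is idempotent, so the image of d2 is the projective module
    R^4 E, and the resolution stops there ([gwa_resolution]). The implication is
    proved by factoring, through d2, the products of the columns of E with
    nonzero polynomials in z1 and z2 ([proj2_regs]); such polynomials are regular
    in R ([theta_regularr]), because R is free over k[z1, z2]. Coordinates for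
    this basis are read off from the action of A on the functions Z -> k[z] in
    which x is the shift ([env_coordinates_of_action]).

    Now dualize. Ext^0 vanishes as z1 - z2 is regular. In a 1-cocycle the value at
    z is divisible by z1 - z2 ([commutator_x], by a comparison of coordinates on
    the diagonal); once a coboundary has cleared it, regularity clears the values
    at x and y ([gwa_Ext_eq0]). For Ext^2, a factorization
    E = gen rho + d2 hmt ([proj2_factor]) shows that the class of the column gen
    generates Ext^2. Multiplying this class by c (x) 1 or by 1 (x) nu(c) gives the
    same result, as is checked for c = x, y, z ([gen_ideal]); and the functional
    a (x) b |-> b nu(a), applied to rho g, is well defined on classes of columns g
    and takes the value 1 at gen. So Ext^2 is the bimodule A^nu ([gwa_Ext2]).

    Any two projective resolutions give isomorphic Ext groups
    ([Ext_resolution_iso]), so this holds for all of them; and since A^nu is not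
    zero, no resolution is shorter than 2. *)

(** * Comparison of projective resolutions *)

Definition linmap (R : pzRingType) (U V : lmodType R) (f : U -> V)
    (fl : linear f) : {linear U -> V} :=
  HB.pack f (GRing.isLinear.Build R U V *:%R f fl).

Section Lifting.
Variable R : pzRingType.

(** Exactness at [N] says that [d] is onto the kernel of [g], through which [f]
    factors. *)
Lemma projective_lift (P M N L : lmodType R) (d : {linear M -> N})
    (g : {linear N -> L}) (f : {linear P -> N}) :
  projective P -> (forall n, g n = 0 -> exists m, d m = n) ->
  (forall m, g (d m) = 0) -> (forall p, g (f p) = 0) ->
  exists h : {linear P -> M}, forall p, d (h p) = f p.
Proof.
move=> prP exd gd gf.
pose toZ (U : lmodType R) (u : {linear U -> N}) (gu : forall p, g (u p) = 0) p :
  cycles g := Sub (u p) (introT eqP (gu p)).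
have toZ_lin U u gu : linear (@toZ U u gu).
  by move=> a p q; apply: val_inj; rewrite /= !linearP.
have [n|h hP] := prP M (cycles g) (linmap (toZ_lin M d gd)) (linmap (toZ_lin P f gf)).
  have [m dm] := exd (val n) (eqP (valP n)).
  by exists m; apply: val_inj.
by exists h => p; have /(congr1 val) := hP p.
Qed.

Lemma dependent_choice_nat (T : nat -> Type) (ok : forall i, T i -> Prop)
    (next : forall i, T i -> T i.+1 -> Prop) (t0 : T 0%N) :
  ok 0%N t0 ->
  (forall i t, ok i t -> exists2 t', next i t t' & ok i.+1 t') ->
  exists2 f : forall i, T i, f 0%N = t0 & forall i, next i (f i) (f i.+1).
Proof.
move=> ok0 step.
have ex i (t : {t | ok i t}) : {t' : {t' | ok i.+1 t'} | next i (sval t) (sval t')}.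
  case: t => t okt; apply: cid.
  by have [t' n' o'] := step i t okt; exists (exist _ t' o').
pose F := fix F i : {t | ok i t} :=
  if i is j.+1 then sval (ex j (F j)) else exist _ t0 ok0.
exists (fun i => sval (F i)) => // i.
by rewrite /=; case: (ex i (F i)).
Qed.

Variables (M : lmodType R).

Lemma chain_map_exists (P Q : resolution M) :
  exists2 f : forall i, {linear P i -> Q i},
    (forall p, res_aug Q (f 0%N p) = res_aug P p) &
    (forall i p, res_d Q i (f i.+1 p) = f i (res_d P i p)).
Proof.
have Pdd i u : res_d P i (res_d P i.+1 u) = 0.
  by apply/(@res_exact _ _ P i); exists u.
have Pd0 u : res_aug P (res_d P 0 u) = 0 by apply/(@res_exact0 _ _ P); exists u.
have Qdd i u : res_d Q i (res_d Q i.+1 u) = 0.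
  by apply/(@res_exact _ _ Q i); exists u.
have Qd0 u : res_aug Q (res_d Q 0 u) = 0 by apply/(@res_exact0 _ _ Q); exists u.
pose ok i : {linear P i -> Q i} -> Prop :=
  if i is j.+1 then fun f => forall u, res_d P j u = 0 -> res_d Q j (f u) = 0
  else fun f => forall u, res_aug P u = 0 -> res_aug Q (f u) = 0.
have [f0 f0P] := @res_proj _ _ P 0%N _ _ (res_aug Q) (res_aug P) (@res_aug_surj _ _ Q).
have [||f f0E fP] := @dependent_choice_nat (fun i => {linear P i -> Q i}) ok
  (fun i f g => forall p, res_d Q i (g p) = f (res_d P i p)) f0.
- by move=> u; rewrite f0P.
- case=> [|i] f okf.
    have [n n0|m|p|h hP] := @projective_lift (P 1%N) _ _ _ (res_d Q 0) (res_aug Q)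
      (f \o res_d P 0) (@res_proj _ _ P 1%N).
    + by apply/(@res_exact0 _ _ Q).
    + exact: Qd0.
    + by apply: okf; apply: Pd0.
    by exists h => // u u0; rewrite hP /= u0 linear0.
  have [n n0|m|p|h hP] := @projective_lift (P i.+2) _ _ _ (res_d Q i.+1)
    (res_d Q i) (f \o res_d P i.+1) (@res_proj _ _ P i.+2).
  + by apply/(@res_exact _ _ Q).
  + exact: Qdd.
  + by apply: okf; apply: Pdd.
  by exists h => // u u0; rewrite hP /= u0 linear0.
by exists f => // p; rewrite f0E.
Qed.

Lemma chain_homotopy_exists (P Q : resolution M)
    (f g : forall i, {linear P i -> Q i}) :
  (forall p, res_aug Q (f 0%N p) = res_aug Q (g 0%N p)) ->
  (forall i p, res_d Q i (f i.+1 p) = f i (res_d P i p)) ->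
  (forall i p, res_d Q i (g i.+1 p) = g i (res_d P i p)) ->
  exists s : forall i, {linear P i -> Q i.+1},
    (forall p, res_d Q 0 (s 0%N p) = f 0%N p - g 0%N p) /\
    (forall i p, res_d Q i.+1 (s i.+1 p) =
      f i.+1 p - g i.+1 p - s i (res_d P i p)).
Proof.
move=> fg0 fP gP.
have Pdd i u : res_d P i (res_d P i.+1 u) = 0.
  by apply/(@res_exact _ _ P i); exists u.
have Qdd i u : res_d Q i (res_d Q i.+1 u) = 0.
  by apply/(@res_exact _ _ Q i); exists u.
have Qd0 u : res_aug Q (res_d Q 0 u) = 0 by apply/(@res_exact0 _ _ Q); exists u.
have [n n0|m|p|s0 s0P] := @projective_lift (P 0%N) _ _ _ (res_d Q 0)
    (res_aug Q) (f 0%N \- g 0%N) (@res_proj _ _ P 0%N).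
- by apply/(@res_exact0 _ _ Q).
- exact: Qd0.
- by rewrite linearB /= fg0 subrr.
have [||s s0E sP] := @dependent_choice_nat (fun i => {linear P i -> Q i.+1})
  (fun i s => forall u, res_d Q i (f i.+1 u - g i.+1 u - s (res_d P i u)) = 0)
  (fun i s t => forall p, res_d Q i.+1 (t p) =
      f i.+1 p - g i.+1 p - s (res_d P i p)) s0.
- by move=> u; rewrite !linearB /= s0P fP gP subrr.
- move=> i s okt.
  have [n n0|m|p|t tP] := @projective_lift (P i.+1) _ _ _ (res_d Q i.+1)
    (res_d Q i) ((f i.+1 \- g i.+1) \- (s \o res_d P i)) (@res_proj _ _ P i.+1).
  + by apply/(@res_exact _ _ Q).
  + exact: Qdd.
  + exact: okt.
  exists t => // u; rewrite !linearB /= tP /= fP gP Pdd linear0 subr0.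
  by rewrite subrr.
by exists s; split => // p; rewrite s0E.
Qed.

End Lifting.

Section HomologyIso.
Variables (R : pzRingType) (V0 V1 V2 W0 W1 W2 : lmodType R).
Variables (f : {linear V0 -> V1}) (g : {linear V1 -> V2}).
Variables (f' : {linear W0 -> W1}) (g' : {linear W1 -> W2}).
Variables (u : {linear V1 -> W1}) (v : {linear W1 -> V1}).

Lemma homology_iso :
  (forall c, g c = 0 -> g' (u c) = 0) -> (forall c, g' c = 0 -> g (v c) = 0) ->
  (forall b, exists b', f' b' = u (f b)) ->
  (forall b, exists b', f b' = v (f' b)) ->
  (forall c, g c = 0 -> exists b, f b = v (u c) - c) ->
  (forall c, g' c = 0 -> exists b, f' b = u (v c) - c) ->
  exists h : {linear homology f g -> homology f' g'}, bijective h.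
Proof.
move=> uc vc ub vb vu uv.
pose U (c : cycles g) : cycles g' := Sub (u (val c)) (introT eqP (uc _ (eqP (valP c)))).
pose V (c : cycles g') : cycles g := Sub (v (val c)) (introT eqP (vc _ (eqP (valP c)))).
pose h (a : homology f g) : homology f' g' := \pi_(homology f' g') (U (repr a)).
pose h' (a : homology f' g') : homology f g := \pi_(homology f g) (V (repr a)).
have hE c : h (\pi_(homology f g) c) = \pi_(homology f' g') (U c).
  apply/homologyP; have [w wE] := repr_homology f c.
  have [b bE] := ub w; exists b; rewrite bE wE linearB /=. by [].
have h'E c : h' (\pi_(homology f' g') c) = \pi_(homology f g) (V c).
  apply/homologyP; have [w wE] := repr_homology f' c.
  have [b bE] := vb w; exists b; by rewrite bE wE linearB /=.
have hl : linear h.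
  move=> r; elim/homology_ind=> a; elim/homology_ind=> b.
  rewrite [r *: _]homology_pi_scale [_ + _]homology_pi_add !hE.
  rewrite [X in _ = X + _]homology_pi_scale [RHS]homology_pi_add; congr (\pi_(homology f' g') _).
  by apply: val_inj; rewrite /= !linearP.
exists (linmap hl); exists h'.
  elim/homology_ind=> a; rewrite /= hE h'E; apply/homologyP.
  by have [b bE] := vu _ (eqP (valP a)); exists b.
elim/homology_ind=> a; rewrite /= h'E hE; apply/homologyP.
by have [b bE] := uv _ (eqP (valP a)); exists b.
Qed.
End HomologyIso.

Section ExtInvariance.
Variables (R : pzRingType) (tau : {rmorphism R -> R^c}) (M : lmodType R).

(** The comparison maps between two resolutions of [M] are inverse to each other
    up to homotopy; dualizing turns the homotopies into the coboundaries required
    by [homology_iso]. *)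
Lemma Ext_resolution_iso (P Q : resolution M) i :
  exists h : {linear Ext tau P i -> Ext tau Q i}, bijective h.
Proof.
have [f f0 fd] := chain_map_exists Q P.
have [g g0 gd] := chain_map_exists P Q.
have htpy (S T : resolution M) (a : forall i, {linear S i -> T i})
    (b : forall i, {linear T i -> S i}) :
    (forall p, res_aug T (a 0%N p) = res_aug S p) ->
    (forall i p, res_d T i (a i.+1 p) = a i (res_d S i p)) ->
    (forall p, res_aug S (b 0%N p) = res_aug T p) ->
    (forall i p, res_d S i (b i.+1 p) = b i (res_d T i p)) ->
    exists s : forall i, {linear S i -> S i.+1},
    (forall p, res_d S 0 (s 0%N p) = b 0%N (a 0%N p) - p) /\
    (forall i p, res_d S i.+1 (s i.+1 p) =
      b i.+1 (a i.+1 p) - p - s i (res_d S i p)).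
  move=> a0 ad b0 bd.
  have [p|j p|j p|s sP] := @chain_homotopy_exists R M S S
     (fun i => b i \o a i : {linear S i -> S i}) (fun i => idfun : {linear S i -> S i}).
  - by rewrite /= b0 a0.
  - by rewrite /= bd ad.
  - by [].
  by exists s.
have [s [s0 sd]] := htpy P Q g f g0 gd f0 fd.
have [t [t0 td]] := htpy Q P f g f0 fd g0 gd.
case: i => [|i].
  refine (@homology_iso _ _ _ _ _ _ _ _ (dual_map (tau:=tau) (res_d P 0)) _
    (dual_map (tau:=tau) (res_d Q 0)) (dual_map (tau:=tau) (f 0%N)) (dual_map (tau:=tau) (g 0%N))
    _ _ _ _ _ _).
  - move=> c c0; apply: dualP => p /=.
    have /(congr1 (fun h => dual_fun h (f 1%N p))) /= := c0.
    by rewrite fd.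
  - move=> c c0; apply: dualP => p /=.
    have /(congr1 (fun h => dual_fun h (g 1%N p))) /= := c0.
    by rewrite gd.
  - by move=> b; exists 0; rewrite /= linear0.
  - by move=> b; exists 0; rewrite /= linear0.
  - move=> c c0; exists 0; apply: dualP => p /=.
    have /(congr1 (fun h => dual_fun h (s 0%N p))) /= := c0.
    by rewrite s0 linearB.
  - move=> c c0; exists 0; apply: dualP => p /=.
    have /(congr1 (fun h => dual_fun h (t 0%N p))) /= := c0.
    by rewrite t0 linearB.
refine (@homology_iso _ _ _ _ _ _ _ (dual_map (tau:=tau) (res_d P i))
  (dual_map (tau:=tau) (res_d P i.+1)) (dual_map (tau:=tau) (res_d Q i))
  (dual_map (tau:=tau) (res_d Q i.+1)) (dual_map (tau:=tau) (f i.+1)) (dual_map (tau:=tau) (g i.+1))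
  _ _ _ _ _ _).
- move=> c c0; apply: dualP => p /=.
  have /(congr1 (fun h => dual_fun h (f i.+2 p))) /= := c0.
  by rewrite fd.
- move=> c c0; apply: dualP => p /=.
  have /(congr1 (fun h => dual_fun h (g i.+2 p))) /= := c0.
  by rewrite gd.
- move=> b; exists (dual_map (tau:=tau) (f i) b); apply: dualP => p /=.
  by rewrite fd.
- move=> b; exists (dual_map (tau:=tau) (g i) b); apply: dualP => p /=.
  by rewrite gd.
- move=> c c0; exists (dual_map (tau:=tau) (s i) c); apply: dualP => p /=.
  have /(congr1 (fun h => dual_fun h (s i.+1 p))) /= := c0.
  by rewrite sd !linearB /= => /eqP; rewrite subr_eq0 => /eqP <-.
- move=> c c0; exists (dual_map (tau:=tau) (t i) c); apply: dualP => p /=.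
  have /(congr1 (fun h => dual_fun h (t i.+1 p))) /= := c0.
  by rewrite td !linearB /= => /eqP; rewrite subr_eq0 => /eqP <-.
Qed.

End ExtInvariance.

(** * Induction and representations from the universal property *)

Section Endomorphisms.
Variables (k : fieldType) (W : lmodType k) (w0 : W).

(** The nonzero vector is an argument of the type because an algebra is required
    to satisfy 1 != 0. *)
Definition endo (w0_neq0 : w0 != 0) : Type := {linear W -> W}.

Variable w0_neq0 : w0 != 0.
Local Notation E := (endo w0_neq0).

HB.instance Definition _ := gen_eqMixin E.
HB.instance Definition _ := gen_choiceMixin E.

Definition endo_fun (f : E) : {linear W -> W} := f.

Lemma endoP (f g : E) : endo_fun f =1 endo_fun g -> f = g.
Proof.
case: f g => f [[a] [b]] [g [[a'] [b']]] /= /funext eqfg.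
have {}eqfg : f = g by [].
case: _ / eqfg in a' b' *.
by rewrite (Prop_irrelevance a a') (Prop_irrelevance b b').
Qed.

Let endo_add (f g : E) : E := endo_fun f \+ endo_fun g.
Let endo_opp (f : E) : E := \- endo_fun f.
Let endo_zero : E := \0 : {linear W -> W}.
Let endo_mul (f g : E) : E := endo_fun f \o endo_fun g.
Let endo_one : E := idfun : {linear W -> W}.
Let endo_scale (c : k) (f : E) : E := c \*: endo_fun f.

Let endo_addA : associative endo_add.
Proof. by move=> f g h; apply: endoP => w /=; rewrite addrA. Qed.
Let endo_addC : commutative endo_add.
Proof. by move=> f g; apply: endoP => w /=; rewrite addrC. Qed.
Let endo_add0 : left_id endo_zero endo_add.
Proof. by move=> f; apply: endoP => w /=; rewrite add0r. Qed.
Let endo_addN : left_inverse endo_zero endo_opp endo_add.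
Proof. by move=> f; apply: endoP => w /=; rewrite addNr. Qed.
HB.instance Definition _ :=
  GRing.isZmodule.Build E endo_addA endo_addC endo_add0 endo_addN.

Let endo_mulA : associative endo_mul. Proof. by move=> f g h; apply: endoP. Qed.
Let endo_mul1l : left_id endo_one endo_mul.
Proof. by move=> f; apply: endoP. Qed.
Let endo_mul1r : right_id endo_one endo_mul.
Proof. by move=> f; apply: endoP. Qed.
Let endo_mulDl : left_distributive endo_mul endo_add.
Proof. by move=> f g h; apply: endoP. Qed.
Let endo_mulDr : right_distributive endo_mul endo_add.
Proof. by move=> f g h; apply: endoP => w /=; rewrite linearD. Qed.
Let endo_1neq0 : endo_one != endo_zero.
Proof.
apply/eqP => /(congr1 (fun f : E => endo_fun f w0)) /= w00.
by case/eqP: w0_neq0.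
Qed.
HB.instance Definition _ := GRing.Zmodule_isNzRing.Build E
  endo_mulA endo_mul1l endo_mul1r endo_mulDl endo_mulDr endo_1neq0.

Let endo_scaleA c d f : endo_scale c (endo_scale d f) = endo_scale (c * d) f.
Proof. by apply: endoP => w /=; rewrite scalerA. Qed.
Let endo_scale1 : left_id 1 endo_scale.
Proof. by move=> f; apply: endoP => w /=; rewrite scale1r. Qed.
Let endo_scaleDr : right_distributive endo_scale +%R.
Proof. by move=> c f g; apply: endoP => w /=; rewrite scalerDr. Qed.
Let endo_scaleDl f : {morph endo_scale^~ f : c d / c + d}.
Proof. by move=> c d; apply: endoP => w /=; rewrite scalerDl. Qed.
HB.instance Definition _ := GRing.Zmodule_isLmodule.Build k E
  endo_scaleA endo_scale1 endo_scaleDr endo_scaleDl.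

Let endo_scaleAl (c : k) (f g : E) : c *: (f * g) = (c *: f) * g.
Proof. exact: endoP. Qed.
HB.instance Definition _ := GRing.Lmodule_isLalgebra.Build k E endo_scaleAl.
Let endo_scaleAr (c : k) (f g : E) : c *: (f * g) = f * (c *: g).
Proof. by apply: endoP => w /=; rewrite linearZ. Qed.
HB.instance Definition _ := GRing.Lalgebra_isAlgebra.Build k E endo_scaleAr.

(** The two recursion equations determine evaluation at [f], so that a closed
    form for p(f) can be supplied without iterating [f]. *)
Lemma horner_alg_endo (f : E) (h : {poly k} -> W -> W) :
  (forall w, h 0 w = 0) ->
  (forall p c w, h (p * 'X + c%:P) w = h p (endo_fun f w) + c *: w) ->
  forall p w, endo_fun (horner_alg f p) w = h p w.
Proof.
move=> h0 hX p; elim/poly_ind: p => [|p c IHp] w; first by rewrite rmorph0 h0.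
by rewrite hX -IHp rmorphD rmorphM /= horner_algX horner_algC.
Qed.

End Endomorphisms.

Definition alg_map (k : fieldType) (A B : algType k) (f : A -> B)
    (fl : linear f) (fm : GRing.monoid_morphism f) : {lrmorphism A -> B} :=
  HB.pack f (GRing.isLinear.Build k A B *:%R f fl)
    (GRing.isMonoidMorphism.Build A B f fm).

Lemma lrmorph_horner_alg (k : fieldType) (A B : algType k)
    (f : {lrmorphism A -> B}) (a : A) (p : {poly k}) :
  f (horner_alg a p) = horner_alg (f a) p.
Proof.
elim/poly_ind: p => [|p c IHp]; first by rewrite !rmorph0.
by rewrite !rmorphD !rmorphM /= !horner_algX !horner_algC IHp rmorph_alg.
Qed.

Lemma gwa_rel_inj (k : fieldType) (lam eta : k) (phi : {poly k})
    (A B : algType k) (f : {lrmorphism A -> B}) (x y z : A) :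
  injective f -> gwa_rel lam eta phi (f x) (f y) (f z) ->
  gwa_rel lam eta phi x y z.
Proof.
move=> f_inj [r1 r2 r3 r4]; split; apply: f_inj.
- by rewrite rmorphM [RHS]rmorphM r1 rmorphD /= linearZ rmorph_alg.
- by rewrite rmorphM [RHS]rmorphM r2 /= [f (lam^-1 *: _)]linearZ /= rmorphB /= rmorph_alg.
- by rewrite rmorphM r3 lrmorph_horner_alg.
- by rewrite rmorphM r4 lrmorph_horner_alg.
Qed.

Section GwaInduction.
Variables (k : fieldType) (lam eta : k) (phi : {poly k}).
Variables (A : algType k) (x y z : A).
Hypothesis A_gwa : is_gwa lam eta phi x y z.

Section Closure.
Variable P : A -> Prop.
Hypothesis P1 : P 1.
Hypothesis PZD : forall c a b, P a -> P b -> P (c *: a + b).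
Hypothesis PM : forall a b, P a -> P b -> P (a * b).
Hypotheses (Px : P x) (Py : P y) (Pz : P z).

Definition closure_pred : {pred A} := fun a => `[< P a >].
Let S_closed : subalg_closed closure_pred.
Proof.
split=> [|c a b /asboolP Pa /asboolP Pb|a b /asboolP Pa /asboolP Pb];
  apply/asboolP => //; [exact: PZD | exact: PM].
Qed.
HB.instance Definition _ := GRing.isSubalgClosed.Build k A closure_pred S_closed.
Definition closure_sub : Type := {a | a \in closure_pred}.
HB.instance Definition _ := SubChoice.on closure_sub.
HB.instance Definition _ := [SubChoice_isSubAlgebra of closure_sub by <:].

(** The elements that satisfy [P] form a subalgebra which contains [x], [y], [z].
    The universal property maps [A] to it, and its uniqueness clause says that the
    composite with the inclusion is the identity. *)
Lemma gwa_ind a : P a.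
Proof.
pose S := closure_pred; pose T := closure_sub.
have inS b : P b -> b \in S by move=> ?; apply/asboolP.
pose i (b : A) (Pb : P b) : T := Sub b (inS b Pb).
have vl : linear (val : closure_sub -> A) by move=> c u v; rewrite linearP.
have vm : GRing.monoid_morphism (val : closure_sub -> A).
  by split=> [|u v]; rewrite ?rmorph1 ?rmorphM.
have relT : gwa_rel lam eta phi (i x Px) (i y Py) (i z Pz).
  by apply: (@gwa_rel_inj _ _ _ _ _ _ (alg_map vl vm)); [exact: val_inj | exact: A_gwa.1].
have [f [[fx fy fz] _]] := A_gwa.2 _ _ _ _ relT.
have [g [_ g_uniq]] := A_gwa.2 _ _ _ _ A_gwa.1.
have fl : linear (val \o f : A -> A) by move=> c u v; rewrite /= !linearP.
have fm : GRing.monoid_morphism (val \o f : A -> A).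
  by split=> [|u v] /=; rewrite ?rmorph1 ?rmorphM.
have := g_uniq (idfun : {lrmorphism A -> A}) (And3 erefl erefl erefl) a.
rewrite -(g_uniq (alg_map fl fm)) /=; last by rewrite fx fy fz.
by move=> ->; apply/asboolP/(valP (f a)).
Qed.

End Closure.

(** An [A]-module is given by three operators that satisfy the relations; the
    function [h p] stands for [p] evaluated at the operator of [z]. *)
Lemma gwa_representation (W : lmodType k) (w0 : W) (X Y Z : {linear W -> W})
    (h : {poly k} -> W -> W) :
  w0 != 0 ->
  (forall w, h 0 w = 0) ->
  (forall p c w, h (p * 'X + c%:P) w = h p (Z w) + c *: w) ->
  (forall w, X (Z w) = lam *: Z (X w) + eta *: X w) ->
  (forall w, Y (Z w) = lam^-1 *: (Z (Y w) - eta *: Y w)) ->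
  (forall w, Y (X w) = h phi w) ->
  (forall w, X (Y w) = h (gwa_sigma lam eta phi) w) ->
  exists act : A -> {linear W -> W},
    [/\ [/\ act x =1 X, act y =1 Y & act z =1 Z], act 1 =1 id,
        (forall a b w, act (a * b) w = act a (act b w)) &
        (forall c a b w, act (c *: a + b) w = c *: act a w + act b w)].
Proof.
move=> w0_neq0 h0 hX rxz ryz ryx rxy.
pose e (f : {linear W -> W}) : endo w0_neq0 := f.
have hE := @horner_alg_endo _ _ _ w0_neq0 (e Z) h h0 hX.
have rel : gwa_rel lam eta phi (e X) (e Y) (e Z).
  split; apply: endoP => w.
  - exact: rxz.
  - exact: ryz.
  - by rewrite hE; apply: ryx.
  - by rewrite hE; apply: rxy.
have [f [[fx fy fz] _]] := A_gwa.2 _ _ _ _ rel.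
exists (fun a => endo_fun (f a)); split.
- by rewrite fx fy fz.
- by move=> w; rewrite rmorph1.
- by move=> a b w; rewrite rmorphM.
- by move=> c a b w; rewrite linearP.
Qed.

End GwaInduction.

(** * The syzygy calculus *)

Definition entries (R : nmodType) (m n : nat) (l : seq (seq R)) : 'M[R]_(m, n) :=
  \matrix_(i, j) nth 0 (nth [::] l i) j.

(** The identities of this section are proved for abstract elements of a ring [R],
    over a commutative ring [S] of coefficients mapped to [R] by [th]. In the
    application S = k[z1, z2]; [s] and [t] replace z1 and z2 by their images under
    sigma, [s'] and [t'] are their inverses, [li] is the inverse of [lam], and
    [phi1], [phi2] are phi(z1), phi(z2). Each identity is checked by moving the
    coefficients in [S] to the left of the words in [x], [y], [X], [Y] and
    comparing them in [S]. *)
Section Calculus.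
Variables (S : comNzRingType) (R : nzRingType) (th : {rmorphism S -> R}).
Variables s t s' t' : {rmorphism S -> S}.
Variables x y X Y : R.
Variables lam li eta z1 z2 phi1 phi2 a b D e : S.

Hypotheses (sK : cancel s s') (s'K : cancel s' s).
Hypotheses (tK : cancel t t') (t'K : cancel t' t).
Hypothesis st : forall p, s (t p) = t (s p).
Hypothesis lamK : lam * li = 1.
Hypotheses (s_lam : s lam = lam) (t_lam : t lam = lam).
Hypotheses (s_eta : s eta = eta) (t_eta : t eta = eta).
Hypotheses (s_z1 : s z1 = lam * z1 + eta) (s_z2 : s z2 = z2).
Hypotheses (t_z1 : t z1 = z1) (t_z2 : t z2 = lam * z2 + eta).
Hypotheses (s_phi2 : s phi2 = phi2) (t_phi1 : t phi1 = phi1).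
Hypotheses (t_a : t a = a) (t_b : t b = b).
Hypothesis phiD : phi1 - phi2 = (z1 - z2) * D.
Hypothesis bezout : b * D + a * phi1 = 1 + (z1 - z2) * e.

Hypotheses (x_th : forall p, x * th p = th (s p) * x)
  (y_th : forall p, y * th p = th (s' p) * y)
  (X_th : forall p, X * th p = th (t' p) * X)
  (Y_th : forall p, Y * th p = th (t p) * Y).
Hypotheses (yx : y * x = th phi1) (xy : x * y = th (s phi1)).
Hypotheses (XY : X * Y = th phi2) (YX : Y * X = th (t phi2)).
Hypotheses (Xx : X * x = x * X) (Xy : X * y = y * X)
  (Yx : Y * x = x * Y) (Yy : Y * y = y * Y).

Let s_li : s li = li.
Proof.
by rewrite -[LHS]mul1r -lamK mulrAC -[in lam * s li]s_lam -rmorphM lamK rmorph1 mul1r.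
Qed.
Let t_li : t li = li.
Proof.
by rewrite -[LHS]mul1r -lamK mulrAC -[in lam * t li]t_lam -rmorphM lamK rmorph1 mul1r.
Qed.
Let s'_lam : s' lam = lam. Proof. by rewrite -{1}s_lam sK. Qed.
Let t'_lam : t' lam = lam. Proof. by rewrite -{1}t_lam tK. Qed.
Let s'_li : s' li = li. Proof. by rewrite -{1}s_li sK. Qed.
Let t'_li : t' li = li. Proof. by rewrite -{1}t_li tK. Qed.
Let s'_eta : s' eta = eta. Proof. by rewrite -{1}s_eta sK. Qed.
Let t'_eta : t' eta = eta. Proof. by rewrite -{1}t_eta tK. Qed.
Let s'_z2 : s' z2 = z2. Proof. by rewrite -{1}s_z2 sK. Qed.
Let t'_z1 : t' z1 = z1. Proof. by rewrite -{1}t_z1 tK. Qed.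
Let s'_phi2 : s' phi2 = phi2. Proof. by rewrite -{1}s_phi2 sK. Qed.
Let t'_phi1 : t' phi1 = phi1. Proof. by rewrite -{1}t_phi1 tK. Qed.
Let t'_a : t' a = a. Proof. by rewrite -{1}t_a tK. Qed.
Let t'_b : t' b = b. Proof. by rewrite -{1}t_b tK. Qed.
Let s't p : s' (t p) = t (s' p).
Proof. by rewrite -[p in LHS]s'K -st sK. Qed.
Let st' p : s (t' p) = t' (s p).
Proof. by rewrite -[p in RHS]t'K st tK. Qed.
Let s't' p : s' (t' p) = t' (s' p).
Proof. by rewrite -[p in RHS]t'K s't tK. Qed.
Let s'_z1 : s' z1 = li * (z1 - eta).
Proof.
have := congr1 (fun u => li * (s' u - eta)) s_z1.
by rewrite /= sK rmorphD rmorphM s'_lam s'_eta addrK mulrA [li * lam]mulrC lamK mul1r.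
Qed.
Let t'_z2 : t' z2 = li * (z2 - eta).
Proof.
have := congr1 (fun u => li * (t' u - eta)) t_z2.
by rewrite /= tK rmorphD rmorphM t'_lam t'_eta addrK mulrA [li * lam]mulrC lamK mul1r.
Qed.

Let ts_a : t (s a) = s a. Proof. by rewrite -st t_a. Qed.
Let ts_b : t (s b) = s b. Proof. by rewrite -st t_b. Qed.
Let t's_a : t' (s a) = s a. Proof. by rewrite -st' t'_a. Qed.
Let t's_b : t' (s b) = s b. Proof. by rewrite -st' t'_b. Qed.

Definition koszul1 : 'M[R]_(3, 1) :=
  entries 3 1 [:: [:: th (z1 - z2)]; [:: x - X]; [:: y - Y]].

(** The rows state, for a derivation with values the three basis vectors at z, x
    and y, the results of differentiating xz = sigma(z) x, yz = sigma^-1(z) y,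
    yx = phi and xy = sigma(phi). *)
Definition koszul2 : 'M[R]_(4, 3) := entries 4 3
 [:: [:: x - th lam * X;        th (z2 - s z1); 0];
     [:: y - th li * Y;         0;              th (z2 - s' z1)];
     [:: - th D;                y;              X];
     [:: - th (lam * s (t D));  Y;              x]].

(** Multiplication by this matrix from the left fixes [koszul2], and the left
    kernel of [koszul2] annihilates it ([proj2_koszul2] and [proj2_ker]). It is
    therefore idempotent, and the image of [koszul2] is projective. The polynomials
    [a], [b], [e] of the Bezout relation [bezout] supply the splitting. *)
Definition proj2 : 'M[R]_4 := entries 4 4
 [:: [:: - th ((s z1 - z2) * s e); - (th (lam * s a) * x * X);
         - (th (s b + (s z1 - z2) * s a) * x); th (s b) * X];
     [:: 0; th (1 - b * t D); th (li * b) * Y; - (th (li * b) * y)];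
     [:: th e * y; th (lam * e) * X; th (1 + (z1 - z2) * e); 0];
     [:: th (s (t e)) * Y; th (lam * (s (t e) - s (t D) * s a)) * x;
         th (s a) * x * Y; th (s (t D) * s b)]].

Let norm1 := (rmorphM, rmorphD, rmorphN, rmorph1, rmorph0).
Let fixS := (s_lam, t_lam, s'_lam, t'_lam, s_li, t_li, s'_li, t'_li,
  s_eta, t_eta, s'_eta, t'_eta, s_z1, s_z2, t_z1, t_z2, s'_z1, s'_z2, t'_z1, t'_z2,
  s_phi2, s'_phi2, t_phi1, t'_phi1, t_a, t_b, t'_a, t'_b, sK, s'K, tK, t'K,
  s't, st', s't', ts_a, ts_b, t's_a, t's_b, st).
Let r_word u : [/\ u * y * x = u * th phi1, u * x * y = u * th (s phi1),
   u * X * Y = u * th phi2 & u * Y * X = u * th (t phi2)].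
Proof. by rewrite -!mulrA yx xy XY YX. Qed.
Let pyx u : u * y * x = u * th phi1. Proof. by case: (r_word u). Qed.
Let pxy u : u * x * y = u * th (s phi1). Proof. by case: (r_word u). Qed.
Let pXY u : u * X * Y = u * th phi2. Proof. by case: (r_word u). Qed.
Let pYX u : u * Y * X = u * th (t phi2). Proof. by case: (r_word u). Qed.
Let px u p : u * x * th p = u * th (s p) * x. Proof. by rewrite -mulrA x_th mulrA. Qed.
Let py u p : u * y * th p = u * th (s' p) * y. Proof. by rewrite -mulrA y_th mulrA. Qed.
Let pX u p : u * X * th p = u * th (t' p) * X. Proof. by rewrite -mulrA X_th mulrA. Qed.
Let pY u p : u * Y * th p = u * th (t p) * Y. Proof. by rewrite -mulrA Y_th mulrA. Qed.
Let pXx u : u * X * x = u * x * X. Proof. by rewrite -mulrA Xx mulrA. Qed.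
Let pXy u : u * X * y = u * y * X. Proof. by rewrite -mulrA Xy mulrA. Qed.
Let pYx u : u * Y * x = u * x * Y. Proof. by rewrite -mulrA Yx mulrA. Qed.
Let pYy u : u * Y * y = u * y * Y. Proof. by rewrite -mulrA Yy mulrA. Qed.
Let thM u p q : u * th p * th q = u * th (p * q).
Proof. by rewrite rmorphM mulrA. Qed.
Let thM0 p q : th p * th q = th (p * q). Proof. by rewrite rmorphM. Qed.

Let moves := (x_th, y_th, X_th, Y_th, yx, xy, XY, YX, Xx, Xy, Yx, Yy,
  px, py, pX, pY, pyx, pxy, pXY, pYX, pXx, pXy, pYx, pYy, thM, thM0).

Ltac expand := rewrite ?(mulr0, mul0r, addr0, add0r, mulr1, mul1r, mulrN, mulNr,
   opprK, oppr0, mulrA, mulrDr, mulrDl).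
(* One round moves every coefficient past one letter and sorts the letters once;
   twelve rounds suffice for the longest words that occur. *)
Ltac movel := do 12! rewrite ?moves ?mulrA.
Ltac collect := rewrite -?mulNr -?rmorphN -?mulrDl -?rmorphD -?mulrDl -?rmorphD.

Let z_eq p m : p = 1 -> th p * m = m.
Proof. by move=> ->; rewrite rmorph1 mul1r. Qed.
Let th_eq1 p : p = 1 -> th p = 1.
Proof. by move=> ->; rewrite rmorph1. Qed.
Let th_eq0 p m : p = 0 -> th p * m = 0.
Proof. by move=> ->; rewrite rmorph0 mul0r. Qed.
Let th_eq00 p m n : p = 0 -> th p * m * n = 0.
Proof. by move=> ->; rewrite rmorph0 !mul0r. Qed.

(* The images of [phiD] and [bezout] under 1, [s], [t] and their composite, solved
   for the term to be eliminated from a coefficient. *)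
Let F0 : phi2 = phi1 - (z1 - z2) * D. Proof. by rewrite -phiD; ring. Qed.
Let Fs : phi2 = s phi1 - (lam * z1 + eta - z2) * s D.
Proof. by have := congr1 s F0; rewrite !norm1 !fixS. Qed.
Let Ft : t phi2 = phi1 - (z1 - (lam * z2 + eta)) * t D.
Proof. by have := congr1 t F0; rewrite !norm1 !fixS. Qed.
Let Fst : t phi2 = s phi1 - (lam * z1 + eta - (lam * z2 + eta)) * t (s D).
Proof. by have := congr1 s Ft; do 3! rewrite ?norm1 ?fixS. Qed.
Let B0 : b * D = 1 + (z1 - z2) * e - a * phi1. Proof. by rewrite -bezout; ring. Qed.
Let Bs : s b * s D = 1 + (lam * z1 + eta - z2) * s e - s a * s phi1.
Proof. by have := congr1 s B0; rewrite !norm1 !fixS. Qed.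
Let Bt : b * t D = 1 + (z1 - (lam * z2 + eta)) * t e - a * phi1.
Proof. by have := congr1 t B0; rewrite !norm1 !fixS. Qed.
Let Bst : s b * t (s D) =
  1 + (lam * z1 + eta - (lam * z2 + eta)) * t (s e) - s a * s phi1.
Proof. by have := congr1 s Bt; do 3! rewrite ?norm1 ?fixS. Qed.

(* The images of [a], [b], [D], [e] under the substitutions are independent
   variables, but for the relations above. *)
Ltac close := first [ring | ring: lamK |
  move: lamK B0 Bs Bt Bst F0 Fs Ft Fst;
  move: (t phi2) (s phi1) (s b) (s a) (t e) (s e) (t D) (s D) (t (s e)) (t (s D));
  let K := fresh in let b0 := fresh in let bs := fresh in let bt := fresh in
  let bst := fresh in let f0 := fresh in let fs := fresh in let ft := fresh in
  let fst := fresh in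
  move=> ? ? ? ? ? ? ? ? ? ? K b0 bs bt bst f0 fs ft fst;
  first [ring: K f0 | ring: K fs | ring: K ft | ring: K fst
  | ring: K b0 | ring: K bs | ring: K bt | ring: K bst
  | ring: K b0 bst | ring: K b0 f0 | ring: K bs fs | ring: K bt ft | ring: K bst fst] | idtac].
Ltac homog := first [done | apply: th_eq0 | apply: th_eq00 | apply: esym; apply: th_eq00 | apply: z_eq | apply: th_eq1
  | congr (th _ * _ * _) | congr (th _ * _)
  | congr (- (th _ * _)) | congr (th _) | idtac ].
Ltac entry := expand; movel; collect; homog; do 4! rewrite ?norm1 ?fixS; close.
Ltac mx := rewrite ?(mxE, big_ord_recl, big_ord0) /=; rewrite ?mxE /=.
Ltac rows i := case: i => -[|[|[|[|//]]]] /= ?; mx.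

Lemma proj2_koszul2_x i : (proj2 *m koszul2) i (inord 1) = koszul2 i (inord 1).
Proof. mx; rewrite !inordK //=; rows i; entry. Qed.

Lemma proj2_koszul2_y i : (proj2 *m koszul2) i (inord 2) = koszul2 i (inord 2).
Proof. mx; rewrite !inordK //=; rows i; entry. Qed.

Definition top2 : 'M[R]_(3, 4) := entries 3 4
 [:: [::];
     [:: th ((s z1 - z2) * s e); th (lam * s a) * x * X;
         th (s b + (s z1 - z2) * s a) * x; - (th (s b) * X)];
     [:: 0; - th (lam * (1 - b * t D)); - (th b * Y); th b * y]].

Definition regs : 'rV[R]_4 := entries 1 4
  [:: [:: th (s z1 - z2); th (z1 - t z2); th (z1 - z2); th (s z1 - t z2)]].

(** After multiplication by an entry of [regs], each column of [proj2] factors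
    through [koszul2]. As these entries are regular in the application, whatever
    kills [koszul2] from the left kills [proj2] too. *)
Lemma proj2_regs i j : proj2 i j * regs 0 j = (koszul2 *m top2) i j.
Proof.
mx; case: j => -[|[|[|[|//]]]] /= ?; mx; case: i => -[|[|[|[|//]]]] /= ?; entry.
Qed.

(** The class of this column generates the dual of the row module of [proj2]
    modulo the columns of [koszul2]; the row [rho2] below computes the coefficient
    of a class on it ([proj2_factor]). *)
Definition gen2 : 'M[R]_(4, 1) :=
  entries 4 1 [:: [:: X]; [:: - (th li * y)]; [:: 0]; [:: th (s (t D))]].

Definition rho2 : 'rV[R]_4 :=
  entries 1 4 [:: [:: 0; - (th (lam * s a) * x); - th (lam * b); th (s b)]].

Definition hmt2 : 'M[R]_(3, 4) := entries 3 4
  [:: [:: 0; 0; - th b; 0]; [:: th (s e); 0; th (s a) * x; 0];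
      [:: 0; th (lam * t e); 0; 0]].

Let swap_aux (u v n : R) : - u + (- (v - u) + n) = - v + n.
Proof. by rewrite opprD opprK [- v + u]addrC -addrA addKr. Qed.

Lemma proj2_factor : proj2 = gen2 *m rho2 + koszul2 *m hmt2.
Proof.
apply/matrixP => i j.
case: j => -[|[|[|[|//]]]] /= ?; rows i; entry.
- rewrite !(mulNr (th lam * th b)) swap_aux mulNr.
  by rewrite mulrDl opprD -[th z2 - _]opprB !mulNr.
- rewrite mulrA -(rmorphM th li lam) [li * lam]mulrC lamK rmorph1 mul1r opprD mulNr opprK.
  by rewrite addrA subrr add0r.
- by rewrite addrA -!rmorphM [t (s D) * lam]mulrC addNr add0r.
Qed.

Let cancel_pairs p p' q q' u v : p + p' = 0 -> q + q' = 0 ->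
  th p * u - th q * v + (th p' * u - th q' * v) = 0.
Proof.
move=> pp qq; rewrite addrACA -opprD -!mulrDl -!rmorphD pp qq rmorph0.
by rewrite !mul0r subrr.
Qed.
Ltac simplS := do 4! rewrite ?norm1 ?fixS.

Lemma koszul21 : koszul2 *m koszul1 = 0.
Proof.
apply/colP => i; rows i; expand; movel.
- by apply: cancel_pairs; simplS; close.
- by apply: cancel_pairs; simplS; close.
- by rewrite [_ + (y * X - _)]addrA subrK -rmorphB F0 subKr mulrC addNr.
- rewrite [x * Y - _ + _]addrC [_ + (x * Y - _)]addrA subrK -rmorphB -rmorphN -rmorphD.
  by rewrite -[RHS](rmorph0 th); congr (th _); simplS; close.
Qed.

(** Here and in the next two lemmas, the class of [gen2] modulo the columns of
    [koszul2] is multiplied in the same way by [x] and [lam X], by [y] and [li Y],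
    by [z1] and [z2]. These factors define the Nakayama automorphism. *)
Lemma gen2_x : gen2 *m (x - th lam * X)%:M =
  koszul2 *m entries 3 1 [:: [:: X]; [:: 0]; [:: th (t D)]].
Proof.
apply/colP => i; rows i; rewrite !mulr1n; expand; movel.
- by rewrite t'_lam.
- rewrite s'_lam [li * lam]mulrC lamK rmorph1 mul1r opprB -[RHS]addrA; congr (_ + _).
  by rewrite -!rmorphN -rmorphD; congr (th _); simplS; close.
- by rewrite tK addNr.
- by rewrite addrC [s (t D) * lam]mulrC.
Qed.
Lemma gen2_y : gen2 *m (y - th li * Y)%:M =
  koszul2 *m entries 3 1 [:: [:: - (th li * y)]; [:: - th (li * s D)]; [:: 0]].
Proof.
apply/colP => i; rows i; rewrite !mulr1n; expand; movel.
- rewrite t'_li lamK rmorph1 mul1r opprB -[RHS]addrA; congr (_ + _).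
  by rewrite -!rmorphN -rmorphD; congr (th _); simplS; close.
- by rewrite s'_li t_li.
- by rewrite (rmorphM s') s'_li sK mulrC subrr.
- by rewrite (rmorphM t) t_li -st [lam * _ * li]mulrAC lamK mul1r [li * _]mulrC.
Qed.
Lemma gen2_z : gen2 *m (th (z1 - z2))%:M =
  koszul2 *m entries 3 1 [:: [:: 0]; [:: - (th li * X)]; [:: th li * y]].
Proof. by apply/colP => i; rows i; rewrite !mulr1n; entry. Qed.

Lemma rho2_gen2 : (rho2 *m gen2) 0 0 = 1 + th ((z1 - z2) * (lam * s (t e))).
Proof.
mx; expand; movel; rewrite -[in RHS](rmorph1 th) -!rmorphD; congr (th _); simplS; close.
Qed.

Lemma rho2_koszul2_z : (rho2 *m koszul2) 0 0 =
  th ((z1 - z2) * (lam * (e - lam * s (t e)))) - th (lam * a * phi1) + th (s a) * x * Y.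
Proof.
have li_sa : lam * s a * s li = s a by rewrite s_li mulrAC lamK mul1r.
mx; expand; movel; rewrite li_sa opprB -addrA [RHS]addrC; congr (_ + _).
by rewrite -!rmorphN -!rmorphD; congr (th _); simplS; close.
Qed.
Lemma rho2_koszul2_x : (rho2 *m koszul2) 0 1 = th (s b) * Y - th (lam * b) * y.
Proof. by mx; expand; movel; rewrite addrC. Qed.
Lemma rho2_koszul2_y : (rho2 *m koszul2) 0 2%:R =
  th (s b) * x - th (lam * b) * X - th ((z2 - z1) * (lam * s a)) * x.
Proof.
mx; expand; movel; rewrite (rmorphB s) s'K s_z2 addrC [- _ + th (s b) * x]addrC.
by congr (_ - th _ * _); ring.
Qed.

Lemma proj2_ker n (w : 'M[R]_(n, 4)) :
  (forall r j, r * regs 0 j = 0 -> r = 0) ->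
  w *m koszul2 = 0 -> w *m proj2 = 0.
Proof.
move=> reg w0; apply/matrixP => i j; rewrite [RHS]mxE; apply: (reg _ j).
rewrite mxE mulr_suml.
under eq_bigr => l _ do rewrite -mulrA proj2_regs.
transitivity ((w *m koszul2 *m top2) i j); first by rewrite -mulmxA mxE.
by rewrite w0 mul0mx mxE.
Qed.

(** Only the columns of x and y are compared entry by entry. The column of z
    follows: both sides are killed by [koszul1], whose entry z1 - z2 is regular. *)
Lemma proj2_koszul2 :
  (forall r, r * th (z1 - z2) = 0 -> r = 0) -> proj2 *m koszul2 = koszul2.
Proof.
move=> reg; apply/matrixP => i j.
case: j => -[|[|[|//]]] lt_j.
- have eq_j : Ordinal lt_j = ord0 by apply: val_inj.
  rewrite eq_j; apply/eqP; rewrite -subr_eq0; apply/eqP/reg.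
  have : ((proj2 *m koszul2 - koszul2) *m koszul1) i 0 = 0.
    by rewrite mulmxBl -mulmxA koszul21 mulmx0 subrr mxE.
  rewrite mxE big_ord_recl (big_ord_recl 1) big_ord1.
  have -> : lift ord0 ord0 = inord 1 :> 'I_3 by apply: val_inj; rewrite /= inordK.
  have -> : lift ord0 (lift ord0 ord0) = inord 2 :> 'I_3.
    by apply: val_inj; rewrite /= inordK.
  have subE l : (proj2 *m koszul2 - koszul2) i l = (proj2 *m koszul2) i l - koszul2 i l.
    by rewrite [LHS]mxE [X in _ + X]mxE.
  rewrite !subE proj2_koszul2_x proj2_koszul2_y.
  by rewrite !subrr !mul0r !addr0 [koszul1 _ _]mxE.
- have -> : Ordinal lt_j = inord 1 by apply: val_inj; rewrite /= inordK.
  exact: proj2_koszul2_x.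
- have -> : Ordinal lt_j = inord 2 by apply: val_inj; rewrite /= inordK.
  exact: proj2_koszul2_y.
Qed.

End Calculus.

(** * Polynomial coordinates in the enveloping algebra *)

Section Affine.
Variables (k : fieldType) (lam eta : k).
Hypothesis lam_neq0 : lam != 0.

Definition aff : {poly k} := lam *: 'X + eta%:P.
Definition affV : {poly k} := lam^-1 *: ('X - eta%:P).

Lemma comp_aff_affV : aff \Po affV = 'X.
Proof.
by rewrite comp_polyD comp_polyZ comp_polyX comp_polyC scalerA divff // scale1r subrK.
Qed.
Lemma comp_affV_aff : affV \Po aff = 'X.
Proof.
by rewrite comp_polyZ comp_polyB comp_polyX comp_polyC addrK scalerA mulVf // scale1r.
Qed.

(** In [{poly {poly k}}] the coefficient variable ['X%:P] plays z1 and the outer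
    variable ['X] plays z2; the two maps substitute [q] for one of them. *)
Definition substl (q : {poly k}) : {rmorphism {poly {poly k}} -> {poly {poly k}}} :=
  map_poly (comp_poly q).
Definition substr (q : {poly k}) : {rmorphism {poly {poly k}} -> {poly {poly k}}} :=
  comp_poly q^:P.

Lemma substlK p q : q \Po p = 'X -> cancel (substl q) (substl p).
Proof.
move=> qp u; rewrite /= -map_poly_comp; apply: map_poly_id => c _ /=.
by rewrite -comp_polyA qp comp_polyXr.
Qed.
Lemma substrK p q : q \Po p = 'X -> cancel (substr q) (substr p).
Proof. by move=> qp u; rewrite /= -comp_polyA -map_comp_poly qp map_polyX comp_polyXr. Qed.
Lemma substlr p q u : substl p (substr q u) = substr q (substl p u).
Proof.
rewrite /= map_comp_poly -map_poly_comp; congr (_ \Po _).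
by apply: eq_map_poly => c /=; rewrite comp_polyC.
Qed.
Lemma substlC q c : substl q c%:P = (c \Po q)%:P.
Proof. exact: map_polyC. Qed.
Lemma substl_map q (c : {poly k}) : substl q c^:P = c^:P.
Proof.
by rewrite /= -map_poly_comp; apply: eq_map_poly => d /=; rewrite comp_polyC.
Qed.
Lemma substrC q c : substr q c%:P = c%:P.
Proof. exact: comp_polyC. Qed.
Lemma substr_map q (c : {poly k}) : substr q c^:P = (c \Po q)^:P.
Proof. by rewrite /= map_comp_poly. Qed.

End Affine.

Section Theta.
Variables (k : fieldType) (A : algType k).

Definition envl (a : A) : env A := tens a 1.
Definition envr (a : A) : env A := tens 1 a.

Lemma envl_linear : linear envl. Proof. exact: (tens_bilin A).1. Qed.
Lemma envr_linear : linear envr. Proof. exact: (tens_bilin A).2. Qed.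
HB.instance Definition _ := GRing.isLinear.Build k A (env A) *:%R envl envl_linear.
HB.instance Definition _ := GRing.isLinear.Build k A (env A) *:%R envr envr_linear.
Lemma envl_monoid : GRing.monoid_morphism envl.
Proof. by split=> // a b; rewrite /envl tensM mulr1. Qed.
HB.instance Definition _ := GRing.isMonoidMorphism.Build A (env A) envl envl_monoid.
Lemma envrM a b : envr (a * b) = envr b * envr a.
Proof. by rewrite /envr tensM mulr1. Qed.
Lemma envlZ c a : envl (c *: a) = c *: envl a. Proof. exact: linearZ. Qed.
Lemma envl_alg c : envl c%:A = c%:A. Proof. exact: envlZ. Qed.
Lemma envlr a b : envl a * envr b = tens a b.
Proof. by rewrite tensM mulr1 mulr1. Qed.
Lemma envrl a b : envr b * envl a = tens a b.
Proof. by rewrite tensM mul1r mul1r. Qed.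
Lemma env_comm a b : envr b * envl a = envl a * envr b.
Proof. by rewrite envlr envrl. Qed.

Lemma env_tens_ind (P : env A -> Prop) :
  P 0 -> (forall e f, P e -> P f -> P (e + f)) -> (forall a b, P (tens a b)) ->
  forall e, P e.
Proof.
by move=> P0 PD Pt e; rewrite [e]env_sum; elim/big_rec: _ => // i f _; apply: PD.
Qed.

Variable z : A.

Definition polyl : {rmorphism {poly k} -> env A} := envl \o horner_alg z.

Lemma polyl_comm : commr_rmorph polyl (envr z).
Proof. by move=> q; apply: env_comm. Qed.

(** The evaluation of polynomials in two variables at z (x) 1 and 1 (x) z. *)
Definition theta (p : {poly {poly k}}) : env A := horner_morph polyl_comm p.
HB.instance Definition _ := GRing.RMorphism.copy theta (horner_morph polyl_comm).
Arguments theta : simpl never.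

Lemma thetaB p q : theta (p - q) = theta p - theta q.
Proof. by apply/eqP; rewrite eq_sym subr_eq -rmorphD subrK. Qed.
Lemma thetaC q : theta q%:P = envl (horner_alg z q).
Proof. exact: horner_morphC. Qed.
Lemma thetaX : theta 'X = envr z. Proof. exact: horner_morphX. Qed.
Lemma theta_map q : theta q^:P = envr (horner_alg z q).
Proof.
elim/poly_ind: q => [|q c IHq]; first by rewrite !rmorph0 raddf0.
rewrite rmorphD rmorphM /= map_polyX map_polyC /= (rmorphD theta) (rmorphM theta) /=.
rewrite IHq thetaX thetaC [q * _]mulrC rmorphD rmorphM /= horner_algX !horner_algC.
by rewrite linearD /= envrM !linearZ.
Qed.

Lemma theta_conj (u : env A) (f : {rmorphism {poly {poly k}} -> {poly {poly k}}}) :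
  (forall c, u * theta c%:P = theta (f c%:P) * u) ->
  u * theta 'X = theta (f 'X) * u ->
  forall p, u * theta p = theta (f p) * u.
Proof.
move=> uC uX p; elim/poly_ind: p => [|p c IHp]; first by rewrite !rmorph0 mulr0 mul0r.
rewrite !rmorphD !rmorphM mulrDr mulrDl uC mulrA IHp -!mulrA.
by rewrite uX.
Qed.
End Theta.

Arguments substl : simpl never.
Arguments substr : simpl never.

(** * The coefficient algebra inside a generalized Weyl algebra *)

Section Relations.
Variables (k : fieldType) (lam eta : k) (phi : {poly k}).
Variables (A : algType k) (x y z : A).
Hypothesis lam_neq0 : lam != 0.
Hypothesis rel : gwa_rel lam eta phi x y z.
Local Notation sg := (aff lam eta).
Local Notation sgV := (affV lam eta).
Local Notation hz := (horner_alg z).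

Lemma horner_alg_aff : hz sg = lam *: z + eta%:A.
Proof. by rewrite /aff rmorphD /= linearZ /= mulr_algl horner_algX horner_algC. Qed.
Lemma horner_alg_affV : hz sgV = lam^-1 *: (z - eta%:A).
Proof. by rewrite /affV linearZ /= mulr_algl rmorphB /= horner_algX horner_algC. Qed.

Lemma horner_alg_conj (w : A) (l : {poly k}) : w * z = hz l * w ->
  forall q, w * hz q = hz (q \Po l) * w.
Proof.
move=> wz q; elim/poly_ind: q => [|q c IHq]; first by rewrite comp_poly0 !rmorph0 mulr0 mul0r.
rewrite comp_polyD comp_polyM comp_polyX comp_polyC !rmorphD !rmorphM /= horner_algX.
rewrite !horner_algC mulrDr mulrDl mulrA IHq -!mulrA wz; congr (_ + _).
by rewrite mulr_algl mulr_algr.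
Qed.

Lemma gwa_xM q : x * hz q = hz (q \Po sg) * x.
Proof. by apply: horner_alg_conj; rewrite horner_alg_aff; case: rel. Qed.
Lemma gwa_yM q : y * hz q = hz (q \Po sgV) * y.
Proof. by apply: horner_alg_conj; rewrite horner_alg_affV; case: rel. Qed.
Lemma gwa_Mx q : hz q * x = x * hz (q \Po sgV).
Proof. by rewrite gwa_xM -comp_polyA comp_affV_aff // comp_polyXr. Qed.
Lemma gwa_My q : hz q * y = y * hz (q \Po sg).
Proof. by rewrite gwa_yM -comp_polyA comp_aff_affV // comp_polyXr. Qed.
Lemma gwa_yx : y * x = hz phi. Proof. by case: rel. Qed.
Lemma gwa_xy : x * y = hz (phi \Po sg). Proof. by case: rel. Qed.

(** [A] is graded by the integers, with [x] of degree 1, [y] of degree -1 and [z]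
    of degree 0; this element generates the component of degree [n] over k[z]. *)
Definition gwa_basis (n : int) : A :=
  match n with Posz i => x ^+ i | Negz i => y ^+ i.+1 end.
Local Notation u := gwa_basis.

Lemma gwa_basis_xl n : exists c, x * u n = hz c * u (n + 1).
Proof.
case: n => [i|[|i]].
- by exists 1; rewrite rmorph1 mul1r -exprS -PoszD addn1.
- by exists (phi \Po sg); rewrite gwa_xy [Negz 0 + 1](_ : _ = 0) // mulr1.
exists (phi \Po sg); rewrite [Negz _ + 1](_ : _ = Negz i) /=.
  by rewrite [y ^+ i.+2]exprS mulrA gwa_xy.
by rewrite !NegzE -addn1 PoszD opprD addrNK.
Qed.
Lemma gwa_basis_yl n : exists c, y * u n = hz c * u (n - 1).
Proof.
case: n => [[|i]|i].
- by exists 1; rewrite rmorph1 mul1r mulr1.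
- by exists phi; rewrite -addn1 PoszD addrK /= addn1 exprS mulrA gwa_yx.
exists 1; rewrite rmorph1 mul1r [Negz _ - 1](_ : _ = Negz i.+1) /= ?exprS //.
by rewrite !NegzE -[i.+2]addn1 PoszD opprD.
Qed.
Lemma gwa_basis_xr n : exists c, u n * x = u (n + 1) * hz c.
Proof.
case: n => [i|[|i]].
- by exists 1; rewrite rmorph1 mulr1 -exprSr -PoszD addn1.
- by exists phi; rewrite gwa_yx [Negz 0 + 1](_ : _ = 0) // mul1r.
exists phi; rewrite [Negz _ + 1](_ : _ = Negz i) /=.
  by rewrite [y ^+ i.+2]exprSr -mulrA gwa_yx.
by rewrite !NegzE -addn1 PoszD opprD addrNK.
Qed.
Lemma gwa_basis_yr n : exists c, u n * y = u (n - 1) * hz c.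
Proof.
case: n => [[|i]|i].
- by exists 1; rewrite rmorph1 mul1r mulr1.
- by exists (phi \Po sg); rewrite -addn1 PoszD addrK /= addn1 exprSr -mulrA gwa_xy.
exists 1; rewrite rmorph1 mulr1 [Negz _ - 1](_ : _ = Negz i.+1) /= -?exprSr //.
by rewrite !NegzE -[i.+2]addn1 PoszD opprD.
Qed.
End Relations.

Section Spanning.
Variables (k : fieldType) (lam eta : k) (phi : {poly k}).
Variables (A : algType k) (x y z : A).
Hypothesis lam_neq0 : lam != 0.
Hypothesis A_gwa : is_gwa lam eta phi x y z.
Let rel : gwa_rel lam eta phi x y z := A_gwa.1.
Local Notation hz := (horner_alg z).
Local Notation u := (gwa_basis x y).

Lemma horner_algM a b : hz (a * b) = hz a * hz b. Proof. exact: rmorphM. Qed.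

(** The span contains 1 and is stable under left multiplication by [x], [y], [z],
    hence by all of [A]. *)
Lemma gwa_spanl a : exists s : seq ({poly k} * int),
  a = \sum_(q <- s) hz q.1 * u q.2.
Proof.
pose P a := exists s : seq ({poly k} * int), a = \sum_(q <- s) hz q.1 * u q.2.
have P0 : P 0 by exists [::]; rewrite big_nil.
have P1 q n : P (hz q * u n) by exists [:: (q, n)]; rewrite big_seq1.
have PD c b : P c -> P b -> P (c + b).
  by move=> [s ->] [t ->]; exists (s ++ t); rewrite big_cat.
have PZ c b : P b -> P (c *: b).
  move=> [s ->]; exists [seq (c *: q.1, q.2) | q <- s].
  by rewrite big_map scaler_sumr; apply: eq_bigr => q _; rewrite /= [hz (_ *: _)]linearZ /= mulr_algl scalerAl.
have PX w : (forall q n, P (w * (hz q * u n))) -> forall b, P b -> P (w * b).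
  move=> Pw b [s ->]; rewrite mulr_sumr; elim/big_rec: _ => // q c _; exact: PD.
suff PM : forall b, P b -> P (a * b).
  by have := PM 1; rewrite mulr1; apply; have := P1 1 0; rewrite rmorph1 mul1r.
elim/(gwa_ind A_gwa): a => [b|c a b IHa IHb d Pd|a b IHa IHb c Pc|||].
- by rewrite mul1r.
- rewrite mulrDl; apply: PD; last exact: IHb.
  by rewrite -scalerAl; apply/PZ/IHa.
- by rewrite -mulrA; apply/IHa/IHb.
- apply: PX => q n; rewrite mulrA (gwa_xM rel) -mulrA.
  by have [c ->] := gwa_basis_xl rel n; rewrite mulrA -horner_algM.
- apply: PX => q n; rewrite mulrA (gwa_yM rel) -mulrA.
  by have [c ->] := gwa_basis_yl rel n; rewrite mulrA -horner_algM.
- by apply: PX => q n; rewrite mulrA -{1}[z]horner_algX -horner_algM.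
Qed.

(** The mirror image of [gwa_spanl]: invertibility of sigma moves the coefficients
    to the right. *)
Lemma gwa_spanr a : exists s : seq ({poly k} * int),
  a = \sum_(q <- s) u q.2 * hz q.1.
Proof.
pose P a := exists s : seq ({poly k} * int), a = \sum_(q <- s) u q.2 * hz q.1.
have P0 : P 0 by exists [::]; rewrite big_nil.
have P1 q n : P (u n * hz q) by exists [:: (q, n)]; rewrite big_seq1.
have PD c b : P c -> P b -> P (c + b).
  by move=> [s ->] [t ->]; exists (s ++ t); rewrite big_cat.
have PZ c b : P b -> P (c *: b).
  move=> [s ->]; exists [seq (c *: q.1, q.2) | q <- s].
  by rewrite big_map scaler_sumr; apply: eq_bigr => q _; rewrite /= [hz (_ *: _)]linearZ /= mulr_algl scalerAr.
have PX w : (forall q n, P (u n * hz q * w)) -> forall b, P b -> P (b * w).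
  move=> Pw b [s ->]; rewrite mulr_suml; elim/big_rec: _ => // q c _; exact: PD.
suff PM : forall b, P b -> P (b * a).
  by have := PM 1; rewrite mul1r; apply; have := P1 1 0; rewrite rmorph1 mulr1.
elim/(gwa_ind A_gwa): a => [b|c a b IHa IHb d Pd|a b IHa IHb c Pc|||].
- by rewrite mulr1.
- rewrite mulrDr; apply: PD; last exact: IHb.
  by rewrite -scalerAr; apply/PZ/IHa.
- by rewrite mulrA; apply/IHb/IHa.
- apply: PX => q n; rewrite -mulrA (gwa_Mx lam_neq0 rel) mulrA.
  by have [c ->] := gwa_basis_xr rel n; rewrite -mulrA -horner_algM.
- apply: PX => q n; rewrite -mulrA (gwa_My lam_neq0 rel) mulrA.
  by have [c ->] := gwa_basis_yr rel n; rewrite -mulrA -horner_algM.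
- by apply: PX => q n; rewrite -mulrA -{2}[z]horner_algX -horner_algM.
Qed.
End Spanning.

(** * Coordinates separating the elements of the enveloping algebra *)

(** The polynomials in two variables as a vector space over [k]; on
    [{poly {poly k}}] itself the scalars are the elements of [{poly k}]. *)
Definition bipoly (k : fieldType) : Type := {poly {poly k}}.
HB.instance Definition _ (k : fieldType) :=
  GRing.Zmodule.copy (bipoly k) {poly {poly k}}.
Definition bipoly_scale (k : fieldType) (c : k) (u : bipoly k) : bipoly k :=
  (c%:P%:P * u : {poly {poly k}}).
Lemma bipoly_scaleA (k : fieldType) (c d : k) (u : bipoly k) :
  bipoly_scale c (bipoly_scale d u) = bipoly_scale (c * d) u.
Proof. by rewrite /bipoly_scale mulrA -!polyCM. Qed.
Lemma bipoly_scale1 (k : fieldType) : left_id (1 : k) (@bipoly_scale k).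
Proof. exact: mul1r. Qed.
Lemma bipoly_scaleDr (k : fieldType) : right_distributive (@bipoly_scale k) +%R.
Proof. by move=> c u v; apply: mulrDr. Qed.
Lemma bipoly_scaleDl (k : fieldType) (u : bipoly k) :
  {morph (@bipoly_scale k)^~ u : c d / c + d}.
Proof. by move=> c d; rewrite /bipoly_scale !polyCD mulrDl. Qed.
HB.instance Definition _ (k : fieldType) := GRing.Zmodule_isLmodule.Build k
  (bipoly k) (@bipoly_scaleA k) (@bipoly_scale1 k) (@bipoly_scaleDr k)
  (@bipoly_scaleDl k).

Section Coordinates.
Variables (k : fieldType) (lam eta : k) (phi : {poly k}).
Variables (A : algType k) (x y z : A).
Hypotheses (lam_neq0 : lam != 0) (phi_neq0 : phi != 0).
Hypothesis A_gwa : is_gwa lam eta phi x y z.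
Local Notation sg := (aff lam eta).
Local Notation sgV := (affV lam eta).
Local Notation W := (int -> {poly k}).

(** The image of z under the [n]-th power of sigma. *)
Definition orbit (n : int) : {poly k} :=
  match n with
  | Posz i => iter i (fun p => p \Po sg) 'X
  | Negz i => iter i.+1 (fun p => p \Po sgV) 'X
  end.

Lemma orbitS n : orbit (n + 1) = orbit n \Po sg.
Proof.
case: n => [i|[|i]]; first by rewrite -PoszD addn1.
  by rewrite NegzE addNr /= comp_polyX comp_affV_aff.
rewrite [Negz _ + 1](_ : _ = Negz i) /=; last by rewrite !NegzE -addn1 PoszD opprD addrNK.
by rewrite -comp_polyA comp_affV_aff // comp_polyXr.
Qed.

Lemma orbit_comm n : sg \Po orbit n = orbit n \Po sg.
Proof.
have commX : sg \Po 'X = 'X \Po sg by rewrite comp_polyX comp_polyXr.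
have commS p : sg \Po p = p \Po sg -> sg \Po (p \Po sg) = p \Po sg \Po sg.
  by rewrite comp_polyA => ->.
have commP p : sg \Po p = p \Po sg -> sg \Po (p \Po sgV) = p \Po sgV \Po sg.
  by rewrite comp_polyA => ->; rewrite -!comp_polyA comp_aff_affV // comp_affV_aff.
case: n => i; first by elim: i => //= i IHi; apply: commS.
by elim: i => [|i IHi] /=; apply: commP.
Qed.

Lemma comp_orbit_neq0 n : phi \Po orbit n != 0.
Proof.
have neqS q p : p \Po q != 0 -> p \Po (q \Po sg) != 0.
  move=> pq; apply: contraNneq pq => pq0.
  rewrite -[p \Po q]comp_polyXr -(@comp_aff_affV _ _ eta lam_neq0).
  by rewrite comp_polyA -[p \Po q \Po _]comp_polyA pq0 comp_poly0.
have neqP q p : p \Po q != 0 -> p \Po (q \Po sgV) != 0.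
  move=> pq; apply: contraNneq pq => pq0.
  rewrite -[p \Po q]comp_polyXr -(@comp_affV_aff _ _ eta lam_neq0).
  by rewrite comp_polyA -[p \Po q \Po _]comp_polyA pq0 comp_poly0.
case: n => i; elim: i => [|i IHi] /=; rewrite ?comp_polyXr //; try exact: neqS; try exact: neqP.
by apply: neqP; rewrite comp_polyXr.
Qed.

Lemma orbit_aff n : orbit (n + 1) = lam *: orbit n + eta%:P.
Proof.
by rewrite orbitS -orbit_comm comp_polyD comp_polyZ comp_polyX comp_polyC.
Qed.

Let shiftX (f : W) : W := fun n => f (n + 1).
Let shiftY (f : W) : W := fun n => (phi \Po orbit n) * f (n - 1).
Let multZ (f : W) : W := fun n => orbit n * f n.
Let shiftX_linear : linear shiftX. Proof. by []. Qed.
Let shiftY_linear : linear shiftY.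
Proof. by move=> c f g; apply/funext => n; rewrite /shiftY /= mulrDr -scalerAr. Qed.
Let multZ_linear : linear multZ.
Proof. by move=> c f g; apply/funext => n; rewrite /multZ /= mulrDr -scalerAr. Qed.

(** At the point [n] of Z, [z] acts as sigma^n(z) and [x] as the shift; the formula
    for [y] is then forced by yx = phi. *)
Lemma gwa_function_representation : exists act : A -> {linear W -> W},
    [/\ [/\ forall f n, act x f n = f (n + 1),
           forall f n, act y f n = (phi \Po orbit n) * f (n - 1) &
           forall f n, act z f n = orbit n * f n],
        act 1 =1 id,
        (forall a b w, act (a * b) w = act a (act b w)) &
        (forall c a b w, act (c *: a + b) w = c *: act a w + act b w)].
Proof.
have [||p c f|f|f|f|f|act [[actx acty actz] act1 actM actD]] :=
  @gwa_representation _ _ _ _ _ _ _ _ A_gwa W (fun=> 1) (linmap shiftX_linear)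
    (linmap shiftY_linear) (linmap multZ_linear)
    (fun p f n => (p \Po orbit n) * f n).
- by apply/eqP => /(congr1 (fun f : W => f 0)) /eqP; rewrite oner_eq0.
- by move=> f; apply/funext => n; rewrite comp_poly0 mul0r.
- apply/funext => n.
  transitivity ((p \Po orbit n) * (orbit n * f n) + c *: f n); last by [].
  by rewrite comp_polyD comp_polyM comp_polyX comp_polyC mulrDl mulrA mul_polyC.
- apply/funext => n.
  transitivity (lam *: (orbit n * f (n + 1)) + eta *: f (n + 1)); last by [].
  rewrite -[LHS]/(orbit (n + 1) * f (n + 1)) orbit_aff.
  by rewrite mulrDl -scalerAl mul_polyC.
- apply/funext => n; set r := phi \Po orbit n.
  transitivity (lam^-1 *: (orbit n * (r * f (n - 1)) - eta *: (r * f (n - 1))));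
    last by [].
  rewrite -[LHS]/(r * (orbit (n - 1) * f (n - 1))).
  have -> : orbit n = lam *: orbit (n - 1) + eta%:P by rewrite -orbit_aff subrK.
  rewrite mulrDl -scalerAl mul_polyC addrK.
  by rewrite scalerA mulVf // scale1r mulrCA.
- apply/funext => n; rewrite -[LHS]/((phi \Po orbit n) * f (n - 1 + 1)).
  by rewrite subrK.
- apply/funext => n.
  rewrite -[LHS]/((phi \Po orbit (n + 1)) * f (n + 1 - 1)) addrK orbit_aff.
  by rewrite -comp_polyA comp_polyD comp_polyZ comp_polyX comp_polyC.
exists act; split=> //; split=> f n; [by rewrite actx | by rewrite acty | by rewrite actz].
Qed.

Let delta (n : int) : W := fun j => (j == n)%:R.
(* Translation of the functions, together with sigma on their values, commutes
   with the action of [A] ([act_tau]); it relates the coordinates at different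
   points. *)
Let tau (f : W) : W := fun j => f (j - 1) \Po sg.

Section Action.
Variable act : A -> {linear W -> W}.
Hypotheses (actx : forall f n, act x f n = f (n + 1))
  (acty : forall f n, act y f n = (phi \Po orbit n) * f (n - 1))
  (actz : forall f n, act z f n = orbit n * f n)
  (act1 : act 1 =1 id)
  (actM : forall a b w, act (a * b) w = act a (act b w))
  (actD : forall c a b w, act (c *: a + b) w = c *: act a w + act b w).

Let act_scale (q : {poly k}) a f :
  act a (fun j => q * f j) = (fun j => q * act a f j).
Proof.
elim/(gwa_ind A_gwa): a f => [|c a b IHa IHb|a b IHa IHb|||] f.
- by rewrite !act1.
- rewrite !actD IHa IHb; apply/funext => n.
  by rewrite -[LHS]/(c *: (q * _) + q * _) mulrDr -scalerAr.
- by rewrite !actM IHb IHa.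
- by apply/funext => n; rewrite !actx.
- by apply/funext => n; rewrite !acty mulrCA.
- by apply/funext => n; rewrite !actz mulrCA.
Qed.

Let act_tau a f : act a (tau f) = tau (act a f).
Proof.
elim/(gwa_ind A_gwa): a f => [|c a b IHa IHb|a b IHa IHb|||] f.
- by rewrite !act1.
- rewrite !actD IHa IHb; apply/funext => n.
  by rewrite /tau -[RHS]/((c *: _ + _) \Po sg) comp_polyD comp_polyZ.
- by rewrite !actM IHb IHa.
- by apply/funext => n; rewrite actx /tau actx addrK subrK.
- apply/funext => n; rewrite acty /tau acty comp_polyM -comp_polyA.
  by rewrite -orbitS subrK.
- by apply/funext => n; rewrite actz /tau actz comp_polyM -orbitS subrK.
Qed.

Let tau_delta n : tau (delta n) = delta (n + 1).
Proof.
apply/funext => j; rewrite /tau /delta subr_eq; case: eqP => _ /=.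
  by rewrite comp_polyC.
by rewrite comp_poly0.
Qed.

Let coordl n a : {poly k} := act a (delta n) 0.
Let coordr m b : {poly k} := act b (delta 0) m.

Let coordl_linear n : linear (coordl n).
Proof. by move=> c a b; rewrite /coordl actD. Qed.
Let coordr_linear m : linear (coordr m).
Proof. by move=> c a b; rewrite /coordr actD. Qed.

Let coordl_z n a : coordl n (z * a) = 'X * coordl n a.
Proof. by rewrite /coordl actM actz. Qed.
Let coordr_z m b : coordr m (b * z) = 'X * coordr m b.
Proof.
rewrite /coordr actM -[RHS]/((fun j => 'X * act b (delta 0) j) m) -act_scale.
congr (act b _ m); apply/funext => j.
by rewrite actz /delta; case: eqP => [->|_]; rewrite ?mulr0.
Qed.
Let coordl_x n a : coordl n (x * a) = coordl (n - 1) a \Po sg.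
Proof. by rewrite /coordl actM actx -[n in delta n](subrK 1) -tau_delta act_tau. Qed.
Let coordr_x m b : coordr m (b * x) = coordr (m + 1) b \Po sgV.
Proof.
rewrite /coordr actM.
have -> : act x (delta 0) = delta (- 1).
  by apply/funext => j; rewrite actx /delta addr_eq0.
rewrite -[delta 0 in RHS]/(delta (- 1 + 1)) -tau_delta act_tau /tau addrK.
by rewrite -comp_polyA comp_aff_affV // comp_polyXr.
Qed.

Local Notation u := (gwa_basis x y).

Let act_basis i j : exists2 c : {poly k}, c != 0 &
  forall f, act (u i) f j = c * f (j + i).
Proof.
case: i => i; rewrite /gwa_basis.
  exists 1; first exact: oner_neq0.
  move=> f; rewrite mul1r; elim: i f => [|i IHi] f; first by rewrite act1 addr0.
  by rewrite exprSr actM IHi actx -addrA -PoszD addn1.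
rewrite NegzE; elim: i.+1 j => {i}[|i IHi] j.
  exists 1; first exact: oner_neq0.
  by move=> f; rewrite act1 mul1r oppr0 addr0.
have [c c0 cE] := IHi (j - 1); exists ((phi \Po orbit j) * c).
  by rewrite mulf_neq0 // comp_orbit_neq0.
move=> f; rewrite exprS actM acty cE mulrA; congr (_ * f _).
by rewrite -addn1 PoszD opprD addrAC addrA.
Qed.

Let coord n m a b : bipoly k :=
  ((coordl n a)%:P * (coordr m b)^:P : {poly {poly k}}).
Let coord_bilin n m : bilin (coord n m).
Proof.
split=> [b c a a' | a c b b'].
  rewrite /coord coordl_linear polyCD mulrDl -mul_polyC polyCM -mulrA; congr (_ + _).
rewrite /coord coordr_linear rmorphD mulrDr -mul_polyC rmorphM /= map_polyC /=.
by rewrite mulrCA.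
Qed.

(** On a (x) b the coordinate of index [n], [m] is the product of a polynomial in z1,
    the value at 0 of [a] applied to the delta function at [n], and one in z2, the
    value at [m] of [b] applied to the delta function at 0. It isolates the
    component of bidegree [n], [- m]. On the basis it is nonzero even on the diagonal
    z1 = z2, so that coordinates also detect divisibility by z1 - z2. *)
Lemma env_coordinates_of_action : exists C : int -> int -> env A -> {poly {poly k}},
  [/\ forall n m r r', C n m (r + r') = C n m r + C n m r',
      forall n m p r, C n m (theta z p * r) = p * C n m r,
      forall n m r, C n m (envl x * r) = substl sg (C (n - 1) m r),
      forall n m r, C n m (envr x * r) = substr sgV (C n (m + 1) r) &
      forall i j, exists2 c : {poly {poly k}}, c.['X] != 0 &
        forall n m, C n m (tens (u i) (u j)) = if (i == n) && (j == - m) then c else 0].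
Proof.
pose C n m (r : env A) : {poly {poly k}} := env_lift (coord n m) r.
have CD n m r r' : C n m (r + r') = C n m r + C n m r' by apply: env_liftD (coord_bilin n m).
have Ct n m a b : C n m (tens a b) = (coordl n a)%:P * (coordr m b)^:P.
  exact: env_lift_tens (coord_bilin n m).
have C0 n m : C n m 0 = 0 by apply: (addrI (C n m 0)); rewrite -CD !addr0.
have ext (F G : env A -> {poly {poly k}}) :
    (forall r r', F (r + r') = F r + F r') -> (forall r r', G (r + r') = G r + G r') ->
    (forall a b, F (tens a b) = G (tens a b)) -> forall r, F r = G r.
  move=> FD GD FG; apply: env_tens_ind => [|e f Fe Ff|a b]; last exact: FG.
    have F0 : F 0 = 0 by apply: (addrI (F 0)); rewrite -FD !addr0.
    have G0 : G 0 = 0 by apply: (addrI (G 0)); rewrite -GD !addr0.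
    by rewrite F0 G0.
  by rewrite FD GD Fe Ff.
have Czl n m r : C n m (envl z * r) = 'X%:P * C n m r.
  apply: (ext (fun r => C n m (envl z * r)) (fun r => 'X%:P * C n m r)) => [e f|e f|a b].
  - by rewrite mulrDr CD.
  - by rewrite CD mulrDr.
  by rewrite tensM mulr1 !Ct coordl_z polyCM mulrA.
have Czr n m r : C n m (envr z * r) = 'X * C n m r.
  apply: (ext (fun r => C n m (envr z * r)) (fun r => 'X * C n m r)) => [e f|e f|a b].
  - by rewrite mulrDr CD.
  - by rewrite CD mulrDr.
  by rewrite tensM mul1r !Ct coordr_z rmorphM /= map_polyX mulrCA.
exists C; split => // [n m p r|n m r|n m r|i j].
- have CC (c : k) r' : C n m (c *: r') = c%:P%:P * C n m r'.
    have := env_lift_linear (coord_bilin n m) c r' 0.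
    rewrite addr0 -[env_lift _ (c *: _)]/(C n m (c *: r')) => ->.
    by rewrite -[X in _ + X]/(C n m 0) C0 addr0.
  have Cl (q : {poly k}) r' : C n m (envl (horner_alg z q) * r') = q%:P * C n m r'.
    elim/poly_ind: q r' => [|q c IHq] r'; first by rewrite !rmorph0 !mul0r.
    rewrite !rmorphD !rmorphM /= horner_algX horner_algC linearZ /= rmorph1 !mulrDl.
    by rewrite CD -mulrA IHq Czl mulrA mulr_algl CC.
  elim/poly_ind: p r => [|p c IHp] r; first by rewrite rmorph0 !mul0r.
  by rewrite (rmorphD (theta z)) (rmorphM (theta z)) /= thetaX thetaC !mulrDl CD Cl -!mulrA IHp Czr.
- apply: (ext (fun r => C n m (envl x * r)) (fun r => substl sg (C (n - 1) m r))) => [e f|e f|a b].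
  - by rewrite mulrDr CD.
  - by rewrite CD rmorphD.
  by rewrite tensM mulr1 !Ct coordl_x rmorphM substlC substl_map.
- apply: (ext (fun r => C n m (envr x * r)) (fun r => substr sgV (C n (m + 1) r))) => [e f|e f|a b].
  - by rewrite mulrDr CD.
  - by rewrite CD rmorphD.
  by rewrite tensM mul1r !Ct coordr_x rmorphM substrC substr_map.
have [c c0 cE] := act_basis i 0.
pose Q m (d : {poly k}) :=
  d != 0 /\ forall f, act (u j) f m = d * f (m + j).
have Qex m : exists d, Q m d by have [d d0 dE] := act_basis j m; exists d.
pose l m := sval (cid (Qex m)); have dP m : Q m (l m) := svalP (cid (Qex m)).
exists (c%:P * (l (- j))^:P) => [|n m].
  rewrite hornerM hornerC.
  have -> (p : {poly k}) : p^:P.['X] = p by rewrite -[RHS]comp_polyXr.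
  by rewrite mulf_neq0 // (dP _).1.
rewrite Ct /coordl /coordr cE (dP m).2 /delta add0r.
case: eqP => _ /=; last by rewrite mulr0 mul0r.
rewrite mulr1 addr_eq0 -eqr_oppLR eq_sym.
case: eqP => [->|_]; first by rewrite opprK mulr1.
by rewrite mulr0 rmorph0 mulr0.
Qed.
End Action.
End Coordinates.

Section Separation.
Variables (k : fieldType) (lam eta : k) (phi : {poly k}).
Variables (A : algType k) (x y z : A).
Hypotheses (lam_neq0 : lam != 0) (phi_neq0 : phi != 0).
Hypothesis A_gwa : is_gwa lam eta phi x y z.
Local Notation sg := (aff lam eta).
Local Notation sgV := (affV lam eta).
Local Notation u := (gwa_basis x y).
Local Notation theta := (theta z).

Lemma env_span (r : env A) : exists s : seq ({poly {poly k}} * (int * int)),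
  r = \sum_(q <- s) theta q.1 * tens (u q.2.1) (u q.2.2).
Proof.
pose P (r : env A) := exists s : seq ({poly {poly k}} * (int * int)),
  r = \sum_(q <- s) theta q.1 * tens (u q.2.1) (u q.2.2).
have PD e f : P e -> P f -> P (e + f).
  by move=> [s ->] [t ->]; exists (s ++ t); rewrite big_cat.
have P0 : P 0 by exists [::]; rewrite big_nil.
have PS (I : Type) (t : seq I) (F : I -> env A) :
    (forall i, P (F i)) -> P (\sum_(i <- t) F i).
  by move=> PF; elim: t => [|i t IHt]; rewrite ?big_nil // big_cons; apply: PD.
suff Pt a b : P (tens a b) by exact: (env_tens_ind P0 PD Pt r).
have [s ->] := gwa_spanl A_gwa a; have [t ->] := gwa_spanr lam_neq0 A_gwa b.
rewrite -envlr !linear_sum mulr_suml; apply: (PS) => p.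
rewrite mulr_sumr; apply: (PS) => q.
exists [:: (p.1%:P * q.1^:P, (p.2, q.2))]; rewrite big_seq1 rmorphM /= rmorphM /= thetaC theta_map.
rewrite envrM -envlr !mulrA; congr (_ * _).
by rewrite -!mulrA; congr (_ * _); rewrite env_comm.
Qed.

(** Collecting the terms with equal indices makes [p q] the coefficient of the
    basis element of index [q], so that a coordinate isolates it. *)
Lemma env_normal_form (r : env A) :
  exists (K : seq (int * int)) (p : int * int -> {poly {poly k}}),
  uniq K /\ r = \sum_(q <- K) theta (p q) * tens (u q.1) (u q.2).
Proof.
have [s ->] := env_span r.
exists (undup (map snd s)), (fun q => \sum_(t <- s | t.2 == q) t.1).
split; first exact: undup_uniq.
under [RHS]eq_bigr => q _ do rewrite rmorph_sum mulr_suml.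
rewrite (exchange_big_dep predT) //= big_seq [RHS]big_seq.
apply: eq_bigr => t ts; rewrite big_mkcond (bigD1_seq t.2) /=; first last.
- exact: undup_uniq.
- by rewrite mem_undup map_f.
rewrite eqxx big1 ?addr0 // => q; rewrite eq_sym => /negbTE ->.
by [].
Qed.

Variable C : int -> int -> env A -> {poly {poly k}}.
Hypotheses (CD : forall n m r r', C n m (r + r') = C n m r + C n m r')
  (Ctheta : forall n m p r, C n m (theta p * r) = p * C n m r)
  (Cx : forall n m r, C n m (envl x * r) = substl sg (C (n - 1) m r))
  (CX : forall n m r, C n m (envr x * r) = substr sgV (C n (m + 1) r))
  (Cbasis : forall i j, exists2 c : {poly {poly k}}, c.['X] != 0 &
     forall n m, C n m (tens (u i) (u j)) = if (i == n) && (j == - m) then c else 0).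

Let C_sum n m (K : seq (int * int)) p :
  C n m (\sum_(q <- K) theta (p q) * tens (u q.1) (u q.2)) =
  \sum_(q <- K) p q * C n m (tens (u q.1) (u q.2)).
Proof.
elim: K => [|q K IHK]; last by rewrite !big_cons CD Ctheta IHK.
by rewrite !big_nil; apply: (addrI (C n m 0)); rewrite -CD !addr0.
Qed.

Let C_coef K p (q : int * int) : uniq K -> q \in K -> exists2 c, c.['X] != 0 &
  C q.1 (- q.2) (\sum_(q <- K) theta (p q) * tens (u q.1) (u q.2)) = p q * c.
Proof.
move=> K_uniq qK; have [c c0 cE] := Cbasis q.1 q.2; exists c => //.
rewrite C_sum (bigD1_seq q) //= cE opprK !eqxx /= big1 ?addr0 // => t tq.
have [d _ ->] := Cbasis t.1 t.2; rewrite opprK.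
case: andP => [[/eqP t1 /eqP t2]|_]; last by rewrite mulr0.
by case/eqP: tq; rewrite [t]surjective_pairing t1 t2 -surjective_pairing.
Qed.

Let C_bounded r : exists N, forall n m : int, N <= n -> C n m r = 0.
Proof.
have [K [p [_ ->]]] := env_normal_form r.
exists (\sum_(q <- K) `|q.1| + 1) => n m n_ge.
rewrite C_sum big_seq big1 // => q qK; have [d _ ->] := Cbasis q.1 q.2.
case: eqP => [qn|_] /=; last by rewrite mulr0.
suff : q.1 < n by rewrite qn ltxx.
apply: lt_le_trans n_ge; rewrite ltzD1 (big_rem q) //=.
by rewrite (le_trans (ler_norm _)) // lerDl sumr_ge0.
Qed.

(** Coordinates are linear over k[z1, z2], which is a domain, and separate the
    terms of a normal form. *)
Lemma theta_regular_of p r : p != 0 -> theta p * r = 0 -> r = 0.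
Proof.
move=> p0 pr0.
have C0 n m : C n m r = 0.
  apply/eqP; rewrite -(mulrI_eq0 _ (mulfI p0)) -Ctheta pr0.
  by apply/eqP; apply: (addrI (C n m 0)); rewrite -CD !addr0.
have [K [c [K_uniq rE]]] := env_normal_form r.
rewrite rE big_seq big1 // => q qK.
have [d d0 dE] := C_coef c K_uniq qK.
have /eqP := C0 q.1 (- q.2); rewrite {1}rE dE mulf_eq0 => /orP[/eqP->|/eqP d00].
  by rewrite rmorph0 mul0r.
by case/eqP: d0; rewrite d00 horner0.
Qed.

Lemma diagonal_factor (v : {poly {poly k}}) :
  v.['X] = 0 -> exists w, v = ('X%:P - 'X) * w.
Proof.
move/eqP/factor_theorem => [w ->]; exists (- w).
by rewrite mulrN mulrC -mulNr opprB.
Qed.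

(** Take the coordinates of both sides at z1 = z and z2 = sigma(z), where the right
    side vanishes. The result expresses the diagonal value of the coordinate of
    index [n - 1], [m] through the one of index [n], [m + 1]. The coordinates of
    large index [n] are zero, so by descending induction all diagonal values are
    zero, and every coefficient of [r] is divisible by z1 - z2. *)
Lemma commutator_x_of r r' :
  envl x * r - theta lam%:P%:P * (envr x * r) = theta (sg%:P - 'X) * r' ->
  exists r'', r = theta ('X%:P - 'X) * r''.
Proof.
move=> eq_r.
have CN n m e : C n m (- e) = - C n m e.
  by apply: (addrI (C n m e)); rewrite -CD !subrr; apply: (addrI (C n m 0)); rewrite -CD !addr0.
have step n m : (C (n - 1) m r).['X] \Po sg = lam *: (C n (m + 1) r).['X].
  have := congr1 (fun e => (C n m e).[sg]) eq_r.
  rewrite /= CD CN Cx !Ctheta CX hornerD hornerN !hornerM !hornerC.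
  rewrite [in RHS]hornerD hornerN hornerC hornerX subrr mul0r.
  have -> p : (substl sg p).[sg] = p.['X] \Po sg.
    by rewrite -[sg in X in _.[X]](comp_polyX sg) (horner_map (comp_poly sg)).
  have -> p : (substr sgV p).[sg] = p.['X].
    by rewrite /substr /= horner_comp -[sgV^:P.[sg]]/(sgV \Po sg) comp_affV_aff.
  by move/eqP; rewrite subr_eq0 mul_polyC => /eqP.
have comp0 (p : {poly k}) : p \Po sg = 0 -> p = 0.
  move=> p0; rewrite -[p]comp_polyXr -(@comp_aff_affV _ _ eta lam_neq0).
  by rewrite comp_polyA p0 comp_poly0.
have [N CN0] := C_bounded r.
have C0 i m : (C (N - i%:Z) m r).['X] = 0.
  elim: i m => [|i IHi] m; first by rewrite subr0 CN0 // horner0.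
  apply: comp0; rewrite -addn1 PoszD opprD addrA step IHi scaler0.
  by [].
have {}C0 n m : (C n m r).['X] = 0.
  have [/CN0->|/ltW n_le] := leP N n; first by rewrite horner0.
  have -> : n = N - `|N - n|%N%:Z by rewrite gez0_abs ?subr_ge0 // subKr.
  exact: C0.
have [K [c [K_uniq rE]]] := env_normal_form r.
rewrite rE big_seq; apply: (big_ind (fun e => exists r'', e = theta ('X%:P - 'X) * r'')) => [|e f [e' ->] [f' ->]|q qK].
- by exists 0; rewrite mulr0.
- by exists (e' + f'); rewrite mulrDr.
have [d d0 dE] := C_coef c K_uniq qK.
have /eqP := C0 q.1 (- q.2); rewrite rE dE hornerM mulf_eq0 (negbTE d0) orbF.
move=> /eqP/diagonal_factor[w ->]; exists (theta w * tens (u q.1) (u q.2)).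
by rewrite rmorphM mulrA.
Qed.

End Separation.

Section Regularity.
Variables (k : fieldType) (lam eta : k) (phi : {poly k}).
Variables (A : algType k) (x y z : A).
Hypotheses (lam_neq0 : lam != 0) (phi_neq0 : phi != 0).
Hypothesis A_gwa : is_gwa lam eta phi x y z.
Local Notation sg := (aff lam eta).
Local Notation theta := (theta z).

Lemma theta_regular p r : p != 0 -> theta p * r = 0 -> r = 0.
Proof.
have [act [[ax ay az] a1 aM aD]] := gwa_function_representation lam_neq0 A_gwa.
have [C [CD Ct Cx CX Cb]] :=
  env_coordinates_of_action lam_neq0 phi_neq0 A_gwa ax ay az a1 aM aD.
exact: (theta_regular_of lam_neq0 A_gwa CD Ct Cb).
Qed.

Lemma commutator_x r r' :
  envl x * r - theta lam%:P%:P * (envr x * r) = theta (sg%:P - 'X) * r' ->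
  exists r'', r = theta ('X%:P - 'X) * r''.
Proof.
have [act [[ax ay az] a1 aM aD]] := gwa_function_representation lam_neq0 A_gwa.
have [C [CD Ct Cx CX Cb]] :=
  env_coordinates_of_action lam_neq0 phi_neq0 A_gwa ax ay az a1 aM aD.
exact: (commutator_x_of lam_neq0 A_gwa CD Ct Cx CX Cb).
Qed.

Lemma env_swapD (e f : env A) : env_swap (e + f) = env_swap e + env_swap f :> env A.
Proof. exact: (env_liftD _ _ (swap_bilin A)). Qed.
Lemma env_swap0 : env_swap 0 = 0 :> env A.
Proof. by apply: (addrI (env_swap 0 : env A)); rewrite -env_swapD !addr0. Qed.
Lemma env_swapM (e f : env A) :
  env_swap (e * f) = (env_swap f : env A) * (env_swap e : env A) :> env A.
Proof. exact: (env_swap_monoid A).2. Qed.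

Lemma env_swapK (e : env A) : env_swap (env_swap e : env A) = e :> env A.
Proof.
elim/env_tens_ind: e => [|e f IHe IHf|a b]; first by rewrite !env_swap0.
  by rewrite !env_swapD IHe IHf.
by rewrite !env_swap_tens.
Qed.

Lemma env_swap_theta p : env_swap (theta p) = theta (swapXY p) :> env A.
Proof.
have t0 : theta 0 = 0 by rewrite rmorph0.
have tD p1 q : theta (p1 + q) = theta p1 + theta q by rewrite rmorphD.
have tM p1 q : theta (p1 * q) = theta p1 * theta q by rewrite rmorphM.
elim/poly_ind: p => [|p c IHp]; first by rewrite t0 env_swap0 raddf0 t0.
rewrite tD tM env_swapD env_swapM IHp thetaC thetaX !env_swap_tens.
rewrite rmorphD rmorphM tD mulrC tM /= swapXY_X swapXY_polyC thetaC theta_map.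
by rewrite horner_algX.
Qed.

Lemma theta_regularr p r : p != 0 -> r * theta p = 0 -> r = 0.
Proof.
move=> p0 rp0; rewrite -[r]env_swapK.
have -> : env_swap r = 0 :> env A; last exact: env_swap0.
apply: (@theta_regular (swapXY p)); first by rewrite swapXY_eq0.
by rewrite -env_swap_theta -env_swapM rp0 env_swap0.
Qed.
End Regularity.

(** * Finitely generated projective modules and cokernels *)

Section Modules.
Variable R : nzRingType.

Lemma projective_retract n (P : lmodType R) (i : {linear P -> 'rV[R]_n})
    (r : {linear 'rV[R]_n -> P}) : (forall p, r (i p) = p) -> projective P.
Proof.
move=> ri M N g f g_surj.
pose v j := sval (cid (g_surj (f (r (delta_mx 0 j))))).
have vE j : g (v j) = f (r (delta_mx 0 j)) :=
  svalP (cid (g_surj (f (r (delta_mx 0 j))))).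
pose h (p : P) : M := \sum_j i p 0 j *: v j.
have hl : linear h.
  move=> c p q; rewrite /h scaler_sumr -big_split; apply: eq_bigr => j _ /=.
  by rewrite linearP !mxE scalerDl scalerA.
exists (linmap hl) => p; rewrite /= /h linear_sum -[in RHS](ri p).
rewrite [i p in RHS]row_sum_delta !linear_sum; apply: eq_bigr => j _.
by rewrite !linearZ /= vE.
Qed.

Lemma fin_gen_surj n (P : lmodType R) (r : {linear 'rV[R]_n -> P}) :
  (forall p, exists v, r v = p) -> fin_gen P.
Proof.
move=> r_surj; exists n, (fun j => r (delta_mx 0 j)) => p.
have [v <-] := r_surj p; exists (v 0).
by rewrite [v in LHS]row_sum_delta linear_sum; apply: eq_bigr => j _; rewrite linearZ.
Qed.

(** The cokernel of [f] is the homology of U -> V -> V whose second map is 0. *)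
Lemma cokernel_exists (U V : lmodType R) (f : {linear U -> V}) :
  exists (M : lmodType R) (c : {linear V -> M}),
    forall v, c v = 0 <-> exists u, f u = v.
Proof.
pose g : {linear V -> V} := \0.
pose cl (v : V) : homology f g := \pi_(homology f g) (Sub v (eqxx 0) : cycles g).
have cl_lin : linear cl.
  move=> a u v; rewrite [X in _ = X + _]homology_pi_scale [RHS]homology_pi_add.
  by congr (\pi_(homology f g) _); apply: val_inj.
exists (homology f g), (linmap cl_lin) => v.
by split=> [/homologyP[u uE]|[u uE]]; [exists u | apply/homologyP; exists u];
  rewrite uE /= subr0.
Qed.

Section FixedRows.
Variables (n : nat) (E : 'M[R]_n).

(** For an idempotent [E] the rows with w E = w form the row module R^n E. *)
Definition fixed_row : {pred 'rV[R]_n} := [pred w | w *m E == w].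
Lemma fixed_row_closed : submod_closed fixed_row.
Proof.
split=> [|a u v]; rewrite !inE ?mul0mx // mulmxDl -scalemxAl.
by move=> /eqP-> /eqP->.
Qed.
HB.instance Definition _ := GRing.isSubmodClosed.Build R 'rV[R]_n fixed_row
  fixed_row_closed.
Definition fixed_rows : Type := {w : 'rV[R]_n | w \in fixed_row}.
HB.instance Definition _ := SubChoice.on fixed_rows.
HB.instance Definition _ := [SubChoice_isSubLmodule of fixed_rows by <:].

Definition fixed_val (w : fixed_rows) : 'rV[R]_n := val w.
Lemma fixed_val_linear : linear fixed_val. Proof. by move=> a u v; rewrite /fixed_val linearP. Qed.
HB.instance Definition _ := GRing.isLinear.Build R fixed_rows 'rV[R]_n *:%R
  fixed_val fixed_val_linear.

Hypothesis E_idem : E *m E = E.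
Lemma fixed_projP (v : 'rV[R]_n) : v *m E \in fixed_row.
Proof. by rewrite inE -mulmxA E_idem. Qed.
Definition fixed_proj (v : 'rV[R]_n) : fixed_rows := Sub (v *m E) (fixed_projP v).
Lemma fixed_proj_linear : linear fixed_proj.
Proof.
by move=> a u v; apply: val_inj; rewrite linearP /= mulmxDl scalemxAl.
Qed.
HB.instance Definition _ := GRing.isLinear.Build R 'rV[R]_n fixed_rows *:%R
  fixed_proj fixed_proj_linear.
Lemma fixed_projK w : fixed_proj (fixed_val w) = w.
Proof. by apply: val_inj; apply/eqP: (valP w). Qed.
End FixedRows.
End Modules.

Definition scalar_restr (k : fieldType) (B : algType k) (M : lmodType B) : Type := M.

Section Restrict.
Variables (k : fieldType) (B : algType k) (M : lmodType B).
HB.instance Definition _ := GRing.Zmodule.copy (scalar_restr M) M.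
Definition restrict_scale (c : k) (m : scalar_restr M) : scalar_restr M :=
  (c%:A : B) *: (m : M).
Lemma restrict_scaleA c d m :
  restrict_scale c (restrict_scale d m) = restrict_scale (c * d) m.
Proof. by rewrite /restrict_scale scalerA mulr_algl scalerA. Qed.
Lemma restrict_scale1 : left_id 1 restrict_scale.
Proof. by move=> m; rewrite /restrict_scale scale1r; apply: scale1r. Qed.
Lemma restrict_scaleDr : right_distributive restrict_scale +%R.
Proof. by move=> c m n; apply: scalerDr. Qed.
Lemma restrict_scaleDl m : {morph restrict_scale^~ m : c d / c + d}.
Proof. by move=> c d; rewrite /restrict_scale scalerDl; apply: scalerDl. Qed.
HB.instance Definition _ := GRing.Zmodule_isLmodule.Build k (scalar_restr M)
  restrict_scaleA restrict_scale1 restrict_scaleDr restrict_scaleDl.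
End Restrict.

(** * The resolution of a generalized Weyl algebra *)

Section Divided.
Variable k : fieldType.

Lemma divided_difference (q : {poly k}) :
  exists D : {poly {poly k}}, q%:P - q^:P = ('X%:P - 'X) * D.
Proof.
apply: diagonal_factor; rewrite hornerD hornerN hornerC -[q^:P.['X]]/(q \Po 'X).
by rewrite comp_polyXr subrr.
Qed.

Lemma divided_difference_diag (q : {poly k}) (D : {poly {poly k}}) :
  q%:P - q^:P = ('X%:P - 'X) * D -> D.['X] = q^`().
Proof.
move/(congr1 (fun u => u^`().['X])).
rewrite derivB derivC sub0r derivM derivB derivC derivX sub0r deriv_map.
rewrite hornerN -[q^`()^:P.['X]]/(q^`() \Po 'X) comp_polyXr !hornerE subrr mul0r.
by rewrite mulN1r addr0 => /eqP; rewrite eqr_opp => /eqP.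
Qed.

Lemma separable_bezout (phi : {poly k}) : separable_poly phi ->
  exists a b : {poly k}, a * phi + b * phi^`() = 1.
Proof.
rewrite separable_poly.unlock => /Bezout_coprimepP[[a b] /= /eqpP[[c d] /= /andP[c0 d0] cd]].
exists ((c / d)%:P * a), ((c / d)%:P * b).
rewrite -!mulrA -mulrDr mul_polyC mulrC -scalerA cd.
by rewrite scalerA mulVf // scale1r.
Qed.

(** [D] restricts to the derivative of [phi] on the diagonal, so the Bezout relation
    between [phi] and its derivative holds for [phi] and [D] modulo z1 - z2. *)
Lemma separable_bezout_diag (phi : {poly k}) (D : {poly {poly k}}) :
  separable_poly phi -> phi%:P - phi^:P = ('X%:P - 'X) * D ->
  exists (a b : {poly k}) (e : {poly {poly k}}),
    b%:P * D + a%:P * phi%:P = 1 + ('X%:P - 'X) * e.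
Proof.
move=> /separable_bezout[a [b ab]] /divided_difference_diag DE.
have [|e eE] := @diagonal_factor k (b%:P * D + a%:P * phi%:P - 1).
  by rewrite hornerD hornerN hornerD !hornerM !hornerC DE [b * _ + _]addrC ab subrr.
by exists a, b, e; rewrite -eE [1 + _]addrC subrK.
Qed.
End Divided.

Section Instance.
Variables (k : fieldType) (lam eta : k) (phi : {poly k}).
Variables (A : algType k) (x y z : A).
Hypotheses (lam_neq0 : lam != 0) (phi_neq0 : phi != 0).
Hypothesis A_gwa : is_gwa lam eta phi x y z.
Variables (a b : {poly k}) (D e : {poly {poly k}}).
Hypothesis phiD : phi%:P - phi^:P = ('X%:P - 'X) * D.
Hypothesis bezout : b%:P * D + a%:P * phi%:P = 1 + ('X%:P - 'X) * e.

Local Notation R := (env A).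
Local Notation th := (theta z : {rmorphism {poly {poly k}} -> env A}).
Local Notation s := (substl (aff lam eta)).
Local Notation t := (substr (aff lam eta)).
Local Notation s' := (substl (affV lam eta)).
Local Notation t' := (substr (affV lam eta)).
Local Notation c2 c := (c%:P%:P : {poly {poly k}}).
Local Notation z1 := ('X%:P : {poly {poly k}}).
Local Notation z2 := ('X : {poly {poly k}}).

Let rel := A_gwa.1.

Let sK : cancel s s'. Proof. exact: substlK (comp_aff_affV eta lam_neq0). Qed.
Let s'K : cancel s' s. Proof. exact: substlK (comp_affV_aff eta lam_neq0). Qed.
Let tK : cancel t t'. Proof. exact: substrK (comp_aff_affV eta lam_neq0). Qed.
Let t'K : cancel t' t. Proof. exact: substrK (comp_affV_aff eta lam_neq0). Qed.
Let st p : s (t p) = t (s p). Proof. exact: substlr. Qed.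
Let lamK : c2 lam * c2 lam^-1 = 1. Proof. by rewrite -!polyCM divff. Qed.
Let s_c c : s (c2 c) = c2 c. Proof. by rewrite substlC comp_polyC. Qed.
Let t_c c : t (c2 c) = c2 c. Proof. exact: substrC. Qed.
Let s_lam := s_c lam. Let t_lam := t_c lam.
Let s_eta := s_c eta. Let t_eta := t_c eta.
Let s_z1 : s z1 = c2 lam * z1 + c2 eta.
Proof. by rewrite substlC comp_polyX /aff -mul_polyC polyCD polyCM. Qed.
Let s_z2 : s z2 = z2. Proof. exact: map_polyX. Qed.
Let s'_z2 : s' z2 = z2. Proof. exact: map_polyX. Qed.
Let z2E : z2 = ('X : {poly k})^:P. Proof. by rewrite map_polyX. Qed.
Let t_z1 : t z1 = z1. Proof. exact: substrC. Qed.
Let t_z2 : t z2 = c2 lam * z2 + c2 eta.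
Proof.
by rewrite /substr /= comp_polyX /aff -mul_polyC rmorphD rmorphM /= map_polyX !map_polyC.
Qed.
Let s_phi2 : s phi^:P = phi^:P. Proof. exact: substl_map. Qed.
Let t_phi1 : t phi%:P = phi%:P. Proof. exact: substrC. Qed.
Let t_a : t a%:P = a%:P. Proof. exact: substrC. Qed.
Let t_b : t b%:P = b%:P. Proof. exact: substrC. Qed.

Let x_th p : envl x * th p = th (s p) * envl x.
Proof.
apply: theta_conj => [c|]; last by rewrite s_z2 thetaX env_comm.
by rewrite substlC !thetaC -!rmorphM /= (gwa_xM rel).
Qed.
Let y_th p : envl y * th p = th (s' p) * envl y.
Proof.
apply: theta_conj => [c|]; last by rewrite s'_z2 thetaX env_comm.
by rewrite substlC !thetaC -!rmorphM /= (gwa_yM rel).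
Qed.
Let X_th p : envr x * th p = th (t' p) * envr x.
Proof.
apply: theta_conj => [c|]; first by rewrite substrC thetaC env_comm.
rewrite z2E substr_map !theta_map -!envrM.
by rewrite (gwa_Mx lam_neq0 rel).
Qed.
Let Y_th p : envr y * th p = th (t p) * envr y.
Proof.
apply: theta_conj => [c|]; first by rewrite substrC thetaC env_comm.
rewrite z2E substr_map !theta_map -!envrM.
by rewrite (gwa_My lam_neq0 rel).
Qed.
Let yx : envl y * envl x = th phi%:P.
Proof. by rewrite /= thetaC -rmorphM /= (gwa_yx rel). Qed.
Let xy : envl x * envl y = th (s phi%:P).
Proof. by rewrite substlC /= thetaC -rmorphM /= (gwa_xy rel). Qed.
Let XY : envr x * envr y = th phi^:P.
Proof. by rewrite /= theta_map -envrM (gwa_yx rel). Qed.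
Let YX : envr y * envr x = th (t phi^:P).
Proof. by rewrite substr_map /= theta_map -envrM (gwa_xy rel). Qed.
Let Xx := env_comm x x. Let Xy := env_comm y x.
Let Yx := env_comm x y. Let Yy := env_comm y y.

Definition gwa_d1 : 'M[R]_(3, 1) := koszul1 th (envl x) (envl y) (envr x) (envr y) z1 z2.
Definition gwa_d2 : 'M[R]_(4, 3) := koszul2 th s t s' (envl x) (envl y) (envr x) (envr y)
  (c2 lam) (c2 lam^-1) z1 z2 D.
Definition gwa_proj : 'M[R]_4 := proj2 th s t (envl x) (envl y) (envr x) (envr y)
  (c2 lam) (c2 lam^-1) z1 z2 a%:P b%:P D e.
Definition gwa_gen : 'M[R]_(4, 1) := gen2 th s t (envl y) (envr x) (c2 lam^-1) D.
Definition gwa_rho : 'rV[R]_4 := rho2 th s (envl x) (c2 lam) a%:P b%:P.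
Definition gwa_hmt : 'M[R]_(3, 4) := hmt2 th s t (envl x) (c2 lam) a%:P b%:P e.

Lemma gwa_d21 : gwa_d2 *m gwa_d1 = 0.
Proof. by apply: (@koszul21 _ _ th s t s' t' (envl x) (envl y)
    (envr x) (envr y) (c2 lam) (c2 lam^-1) (c2 eta) z1 z2 phi%:P phi^:P a%:P b%:P D e); eassumption. Qed.
Lemma gwa_factor : gwa_proj = gwa_gen *m gwa_rho + gwa_d2 *m gwa_hmt.
Proof. by apply: (@proj2_factor _ _ th s t s' t' (envl x) (envl y)
    (envr x) (envr y) (c2 lam) (c2 lam^-1) (c2 eta) z1 z2 phi%:P phi^:P a%:P b%:P D e); eassumption. Qed.
Lemma gwa_gen_x : gwa_gen *m (envl x - th (c2 lam) * envr x)%:M =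
  gwa_d2 *m entries 3 1 [:: [:: envr x]; [:: 0]; [:: th (t D)]].
Proof. by apply: (@gen2_x _ _ th s t s' t' (envl x) (envl y)
    (envr x) (envr y) (c2 lam) (c2 lam^-1) (c2 eta) z1 z2 phi%:P phi^:P a%:P b%:P D e); eassumption. Qed.
Lemma gwa_gen_y : gwa_gen *m (envl y - th (c2 lam^-1) * envr y)%:M =
  gwa_d2 *m entries 3 1 [:: [:: - (th (c2 lam^-1) * envl y)];
                            [:: - th (c2 lam^-1 * s D)]; [:: 0]].
Proof. by apply: (@gen2_y _ _ th s t s' t' (envl x) (envl y)
    (envr x) (envr y) (c2 lam) (c2 lam^-1) (c2 eta) z1 z2 phi%:P phi^:P a%:P b%:P D e); eassumption. Qed.
Lemma gwa_gen_z : gwa_gen *m (th (z1 - z2))%:M =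
  gwa_d2 *m entries 3 1 [:: [:: 0]; [:: - (th (c2 lam^-1) * envr x)];
                            [:: th (c2 lam^-1) * envl y]].
Proof. by apply: (@gen2_z _ _ th s t s' t' (envl x) (envl y)
    (envr x) (envr y) (c2 lam) (c2 lam^-1) (c2 eta) z1 z2 phi%:P phi^:P a%:P b%:P D e); eassumption. Qed.

Lemma gwa_rho_gen : (gwa_rho *m gwa_gen) 0 0 =
  1 + th ((z1 - z2) * (c2 lam * s (t e))).
Proof.
by apply: (rho2_gen2 (Y := envr y) (lam := c2 lam) (li := c2 lam^-1)
    (eta := c2 eta) (phi1 := phi%:P) (phi2 := phi^:P)); eassumption.
Qed.
Lemma gwa_rho_d2_z : (gwa_rho *m gwa_d2) 0 0 =
  th ((z1 - z2) * (c2 lam * (e - c2 lam * s (t e)))) - th (c2 lam * a%:P * phi%:P)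
  + th (s a%:P) * envl x * envr y.
Proof.
by apply: (@rho2_koszul2_z _ _ th s t s' (envl x) (envl y) (envr x) (envr y)
    (c2 lam) (c2 lam^-1) (c2 eta) z1 z2 phi%:P phi^:P a%:P b%:P D e); eassumption.
Qed.
Lemma gwa_rho_d2_x : (gwa_rho *m gwa_d2) 0 1 =
  th (s b%:P) * envr y - th (c2 lam * b%:P) * envl y.
Proof.
exact: rho2_koszul2_x.
Qed.
Lemma gwa_rho_d2_y : (gwa_rho *m gwa_d2) 0 2%:R =
  th (s b%:P) * envl x - th (c2 lam * b%:P) * envr x
  - th ((z2 - z1) * (c2 lam * s a%:P)) * envl x.
Proof.
by apply: rho2_koszul2_y; eassumption.
Qed.

Let map_diff_neq0 (p q : {poly k}) : q`_1 != 0 -> p%:P - q^:P != 0.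
Proof.
move=> q1; apply/eqP => /(congr1 (fun u : {poly {poly k}} => u`_1)) /eqP.
by rewrite coefB coefC coef_map coef0 sub0r oppr_eq0 polyC_eq0 (negbTE q1).
Qed.
Let X1 : ('X : {poly k})`_1 != 0. Proof. by rewrite coefX oner_neq0. Qed.
Let aff1 : (aff lam eta)`_1 != 0.
Proof. by rewrite coefD coefZ coefX coefC mulr1 addr0. Qed.

Let regular (p q : {poly k}) r : q`_1 != 0 -> r * th (p%:P - q^:P) = 0 -> r = 0.
Proof. by move=> q1; apply: theta_regularr A_gwa _ _ _ => //; apply: map_diff_neq0. Qed.

Lemma gwa_proj_ker n (w : 'M[R]_(n, 4)) : w *m gwa_d2 = 0 -> w *m gwa_proj = 0.
Proof.
apply: (@proj2_ker _ _ th s t s' t' (envl x) (envl y) (envr x) (envr y) (c2 lam)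
  (c2 lam^-1) (c2 eta) z1 z2 phi%:P phi^:P a%:P b%:P D e); try eassumption.
move=> r j; rewrite mxE z2E substr_map substlC comp_polyX.
by case: j => -[|[|[|[|//]]]] ? /=; apply: regular.
Qed.

Lemma gwa_proj_d2 : gwa_proj *m gwa_d2 = gwa_d2.
Proof.
apply: (@proj2_koszul2 _ _ th s t s' t' (envl x) (envl y) (envr x) (envr y)
  (c2 lam) (c2 lam^-1) (c2 eta) z1 z2 phi%:P phi^:P a%:P b%:P D e); try eassumption.
by move=> r; rewrite z2E; apply: regular.
Qed.

Lemma gwa_proj_idem : gwa_proj *m gwa_proj = gwa_proj.
Proof.
apply/eqP; rewrite -subr_eq0 -[X in _ - X]mul1mx -mulmxBl; apply/eqP.
by apply: gwa_proj_ker; rewrite mulmxBl gwa_proj_d2 mul1mx subrr.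
Qed.
End Instance.

Section Exactness.
Variables (k : fieldType) (lam eta : k) (phi : {poly k}).
Variables (A : algType k) (x y z : A).
Hypotheses (lam_neq0 : lam != 0).
Hypothesis A_gwa : is_gwa lam eta phi x y z.
Variable D : {poly {poly k}}.
Hypothesis phiD : phi%:P - phi^:P = ('X%:P - 'X) * D.
Local Notation R := (env A).
Local Notation hz := (horner_alg z).
Local Notation theta := (theta z).
Local Notation d1 := (gwa_d1 x y z).
Local Notation d2 := (gwa_d2 lam eta x y z D).
Let rel := A_gwa.1.

Definition env_aug (r : R) : regbim A := r *: (1 : regbim A).

Lemma env_aug_tens a b : env_aug (tens a b) = (a * b : A).
Proof. by rewrite /env_aug [LHS]twist_scale_tens mulr1. Qed.
Lemma env_aug_linear : linear (env_aug : R^o -> regbim A).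
Proof. by move=> c r r'; rewrite /env_aug scalerDl scalerA. Qed.
HB.instance Definition _ := GRing.isLinear.Build R R^o (regbim A) *:%R
  env_aug env_aug_linear.

Let d1_z : d1 0 0 = envl z - envr z.
Proof. by rewrite mxE [LHS]thetaB thetaC thetaX horner_algX. Qed.
Let d1_x : d1 1 0 = envl x - envr x. Proof. by rewrite mxE. Qed.
Let d1_y : d1 2%:R 0 = envl y - envr y. Proof. by rewrite mxE. Qed.

Lemma mul_d1 (v : 'rV[R]_3) : (v *m d1) 0 0 =
  v 0 0 * (envl z - envr z) + v 0 1 * (envl x - envr x)
  + v 0 2%:R * (envl y - envr y).
Proof.
rewrite mxE !big_ord_recl big_ord0 addr0 addrA -d1_z -d1_x -d1_y.
by congr (_ * _ + v _ _ * d1 _ _ + v _ _ * d1 _ _); apply: val_inj.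
Qed.

Lemma gwa_d1_aug (v : 'rV[R]_3) : env_aug ((v *m d1) 0 0) = 0.
Proof.
have aug_comm r a : env_aug (r * (envl a - envr a)) = 0.
  rewrite /env_aug -scalerA scalerBl -[envl a *: _]/(env_aug _).
  by rewrite -[envr a *: _]/(env_aug _) !env_aug_tens mulr1 mul1r subrr scaler0.
by rewrite mul_d1 /env_aug !scalerDl -!/(env_aug _) !aug_comm !addr0.
Qed.

(** The kernel of the augmentation is the left ideal generated by all
    a (x) 1 - 1 (x) a; by the Leibniz rule those with a = x, y, z suffice. *)
Lemma gwa_exact0 (r : R) : env_aug r = 0 -> exists v : 'rV[R]_3, (v *m d1) 0 0 = r.
Proof.
pose I (r : R) := exists v : 'rV[R]_3, (v *m d1) 0 0 = r.
have ID e f : I e -> I f -> I (e + f).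
  by move=> [u <-] [v <-]; exists (u + v); rewrite mulmxDl mxE.
have IM e f : I f -> I (e * f).
  by move=> [v <-]; exists (e *: v); rewrite -scalemxAl mxE.
have I0 : I 0 by exists 0; rewrite mul0mx mxE.
have Idelta j : I (d1 j 0).
  by exists (delta_mx 0 j); rewrite -rowE mxE.
have Icomm a : I (envl a - envr a).
  elim/(gwa_ind A_gwa): a => [|c a b Ia Ib|a b Ia Ib|||].
  - by rewrite subrr.
  - rewrite envl_linear envr_linear opprD addrACA -scalerBr; apply: (ID) => //.
    by rewrite -mulr_algl; apply: IM.
  - rewrite rmorphM envrM /=.
    have -> : envl a * envl b - envr b * envr a =
        envl a * (envl b - envr b) + envr b * (envl a - envr a).
      by rewrite !mulrBr env_comm addrA subrK.
    by apply: (ID); apply: IM.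
  - by rewrite -d1_x.
  - by rewrite -d1_y.
  - by rewrite -d1_z.
suff Iaug : I (r - envr (env_aug r : A)) by move=> r0; rewrite r0 raddf0 subr0 in Iaug.
elim/env_tens_ind: r => [|e f Ie If|a b].
- by rewrite /env_aug scale0r raddf0 subr0.
- rewrite /env_aug scalerDl raddfD opprD addrACA; exact: ID.
by rewrite env_aug_tens envrM -envrl -mulrBr; apply: IM.
Qed.

Lemma row3_image (M : lmodType R) (c : {linear 'rV[R]_3 -> M}) (v : 'rV[R]_3) :
  c v = v 0 0 *: c (delta_mx 0 0) + v 0 1 *: c (delta_mx 0 1)
        + v 0 2%:R *: c (delta_mx 0 2%:R).
Proof.
transitivity (c (v 0 0 *: delta_mx 0 0 + v 0 1 *: delta_mx 0 1
    + v 0 2%:R *: delta_mx 0 2%:R)); last by rewrite !linearD !linearZ.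
rewrite [in LHS](row_sum_delta v) !big_ord_recl big_ord0 addr0 addrA; congr (c _).
by congr (_ *: _ + v 0 _ *: delta_mx 0 _ + v 0 _ *: delta_mx 0 _); apply: val_inj.
Qed.

Lemma d2_relations (M : lmodType R) (c : {linear 'rV[R]_3 -> M}) :
  (forall i, c (row i d2) = 0) ->
  let cz := c (delta_mx 0 0) in let cx := c (delta_mx 0 1) in
  let cy := c (delta_mx 0 2%:R) in
  [/\ (envl x - theta lam%:P%:P * envr x) *: cz +
        theta ('X - substl (aff lam eta) 'X%:P) *: cx = 0,
      (envl y - theta lam^-1%:P%:P * envr y) *: cz +
        theta ('X - substl (affV lam eta) 'X%:P) *: cy = 0,
      envl y *: cx + envr x *: cy = theta D *: cz &
      envr y *: cx + envl x *: cy =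
        theta (lam%:P%:P * substl (aff lam eta) (substr (aff lam eta) D)) *: cz].
Proof.
move=> c0 cz cx cy.
have rowE i : d2 i 0 *: cz + d2 i 1 *: cx + d2 i 2%:R *: cy = 0.
  by rewrite -(c0 i) (row3_image c (row i d2)) !mxE.
split.
- by have := rowE 0; rewrite !mxE /= scale0r addr0.
- by have := rowE 1; rewrite !mxE /= scale0r addr0.
- have := rowE 2%:R; rewrite !mxE /= scaleNr -addrA addrC => /eqP.
  by rewrite subr_eq0 => /eqP.
- have := rowE 3%:R; rewrite !mxE /= scaleNr -addrA addrC => /eqP.
  by rewrite subr_eq0 => /eqP.
Qed.

End Exactness.

Section Derivation.
Variables (k : fieldType) (lam eta : k) (phi : {poly k}).
Variables (A : algType k) (x y z : A).
Hypotheses (lam_neq0 : lam != 0).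
Hypothesis A_gwa : is_gwa lam eta phi x y z.
Variable D : {poly {poly k}}.
Hypothesis phiD : phi%:P - phi^:P = ('X%:P - 'X) * D.
Local Notation R := (env A).
Local Notation hz := (horner_alg z).
Local Notation theta := (theta z).
Local Notation sg := (aff lam eta).
Let rel := A_gwa.1.

Let z12_neq0 : 'X%:P - 'X != 0 :> {poly {poly k}}.
Proof.
apply/eqP => /(congr1 (fun u : {poly {poly k}} => u`_1)) /eqP.
by rewrite coefB coefC coefX coef0 sub0r oppr_eq0 oner_eq0.
Qed.

Let dd (p : {poly k}) : {poly {poly k}} := sval (cid (divided_difference p)).
Let ddE p : p%:P - p^:P = ('X%:P - 'X) * dd p.
Proof. exact: svalP (cid (divided_difference p)). Qed.
Let dd_uniq p q : p%:P - p^:P = ('X%:P - 'X) * q -> dd p = q.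
Proof. by rewrite ddE => /(mulfI z12_neq0). Qed.
Let dd0 : dd 0 = 0. Proof. by apply: dd_uniq; rewrite map_poly0 mulr0 subr0. Qed.
Let ddX p c : dd (p * 'X + c%:P) = p%:P + 'X * dd p.
Proof.
apply: dd_uniq; rewrite mulrDr mulrCA -ddE polyCD polyCM rmorphD rmorphM /=.
by rewrite map_polyX map_polyC /=; ring.
Qed.
Let dd_phi : dd phi = D. Proof. exact: dd_uniq. Qed.
Let dd_phi_sg : dd (phi \Po sg) = lam%:P%:P * substl sg (substr sg D).
Proof.
have := congr1 (fun p => substl sg (substr sg p)) phiD.
rewrite rmorphB substrC substr_map rmorphB substlC substl_map => e; apply: dd_uniq.
rewrite e !rmorphM mulrCA mulrA; congr (_ * _).
have : substl sg (substr sg ('X%:P - ('X : {poly k})^:P)) = sg%:P - sg^:P.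
  rewrite (rmorphB (substr sg)) substrC substr_map (rmorphB (substl sg)) substlC.
  by rewrite substl_map !comp_polyX.
rewrite map_polyX => ->; rewrite /aff -!mul_polyC polyCD polyCM rmorphD rmorphM /=.
by rewrite !map_polyC map_polyX /=; ring.
Qed.

Variable M : lmodType R.

Let W := (scalar_restr M * A)%type.
Let op (g : A) (d : M) (w : W) : W :=
  (envl g *: (w.1 : M) + envr w.2 *: d : M, g * w.2).
Let op_linear g d : linear (op g d).
Proof.
move=> c [m a] [m' a']; rewrite /op /=; congr pair; last by rewrite mulrDr -scalerAr.
transitivity (c%:A *: (envl g *: m + envr a *: d) + (envl g *: m' + envr a' *: d) : M); last by [].
transitivity (envl g *: (c%:A *: m + m') + envr (c *: a + a') *: d : M); first by [].
rewrite envr_linear /= scalerDr scalerDl !scalerDr addrACA !scalerA.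
by rewrite mulr_algl mulr_algr mulr_algl.
Qed.

Let op_inj g d d' : op g d =1 op g d' -> d = d'.
Proof.
move=> /(_ (0, 1)) /(congr1 (fun w : W => w.1 : M)) /=.
by rewrite !scaler0 !add0r -[envr 1]/(1 : R) !scale1r.
Qed.
Let op_comp g d h d' w :
  op g d (op h d' w) = op (g * h) (envl g *: d' + envr h *: d) w.
Proof.
case: w => m a; rewrite /op /= mulrA; congr pair.
rewrite !scalerDr !scalerA envrM rmorphM /= -addrA; congr (_ + (_ + _)).
by rewrite env_comm.
Qed.
Let op_add g d g' d' w : op g d w + op g' d' w = op (g + g') (d + d') w.
Proof.
case: w => m a; rewrite /op /= [LHS]/(_ + _) /=; congr pair; last by rewrite mulrDl.
by rewrite raddfD scalerDl scalerDr addrACA.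
Qed.
Let op_scale c g d w : c *: op g d w = op (c *: g) ((c%:A : R) *: d) w.
Proof.
case: w => m a; rewrite /op /= [LHS]/(_ *: _) /=; congr pair; last by rewrite scalerAl.
transitivity ((c%:A : R) *: (envl g *: (m : M) + envr a *: d) : M); first by [].
rewrite scalerDr !scalerA !mulr_algl !mulr_algr.
by rewrite envlZ.
Qed.

(** A derivation [delta] into [M] is the same as an action of [A] on M x A of the form
    g (m, a) = (g m + delta(g) a, g a), that is by [op g (delta g)]. So it is enough
    to check the defining relations for the three operators with prescribed
    off-diagonal parts. The off-diagonal part of p(z) is the divided difference of
    [p] applied to [cz]; this is why [D] and its twist occur in the hypotheses. *)
Lemma gwa_derivation (cz cx cy : M) :
  (envl x - theta lam%:P%:P * envr x) *: cz +
    theta ('X - substl sg 'X%:P) *: cx = 0 ->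
  (envl y - theta lam^-1%:P%:P * envr y) *: cz +
    theta ('X - substl (affV lam eta) 'X%:P) *: cy = 0 ->
  envl y *: cx + envr x *: cy = theta D *: cz ->
  envr y *: cx + envl x *: cy =
    theta (lam%:P%:P * substl sg (substr sg D)) *: cz ->
  exists delta : A -> M,
    [/\ forall c a b, delta (c *: a + b) = (c%:A : R) *: delta a + delta b,
        forall a b, delta (a * b) = envl a *: delta b + envr b *: delta a &
        [/\ delta x = cx, delta y = cy & delta z = cz]].
Proof.
move=> r1 r2 r3 r4.
have thC (c : k) : theta c%:P%:P = c%:A.
  by rewrite thetaC horner_algC envl_alg.
pose heval p := op (hz p) (theta (dd p) *: cz).
have heval0 w : heval 0 w = 0.
  rewrite /heval dd0 !rmorph0 scale0r; case: w => m a; rewrite /op /=.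
  by rewrite raddf0 scale0r scaler0 addr0 mul0r.
have hevalX p c w : heval (p * 'X + c%:P) w = heval p (op z cz w) + c *: w.
  have -> : c *: w = op c%:A 0 w.
    case: w => m a; rewrite /op /= scaler0 addr0 envl_alg mulr_algl.
    by [].
  rewrite /heval ddX op_comp op_add addr0 rmorphD rmorphM /= horner_algX horner_algC.
  rewrite (rmorphD theta) (rmorphM theta) /= thetaC thetaX.
  by rewrite scalerDl scalerA.
have rxz w : op x cx (op z cz w) = lam *: op z cz (op x cx w) + eta *: op x cx w.
  rewrite !op_comp !op_scale op_add; congr (op _ _ w).
    by case: rel => -> _ _ _; rewrite mulrDl mulr_algl scalerAl.
  have /eqP := r1; rewrite thC thetaB thetaX substlC comp_polyX thetaC horner_alg_aff.
  rewrite !scalerBl addrACA -opprD subr_eq0 => /eqP ->.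
  rewrite envl_linear envl_alg scalerDr !scalerA !mulr_algl.
  by rewrite scalerDl addrCA addrA.
have ryz w : op y cy (op z cz w) =
    lam^-1 *: (op z cz (op y cy w) - eta *: op y cy w).
  rewrite -scaleNr !op_comp !op_scale op_add op_scale; congr (op _ _ w).
    by case: rel => _ -> _ _; rewrite -scalerAl mulrBl mulr_algl scaleNr.
  have /eqP := r2; rewrite thC thetaB thetaX substlC comp_polyX thetaC horner_alg_affV.
  rewrite !scalerBl addrACA -opprD subr_eq0 => /eqP ->.
  rewrite envlZ raddfB /= envl_alg [(- eta)%:A]scaleNr scaleNr !scalerBr !scalerDr.
  by rewrite !scalerA !mulr_algl scalerBl scalerA addrCA addrA.
have ryx w : op y cy (op x cx w) = heval phi w.
  by rewrite op_comp (gwa_yx rel) r3 -dd_phi.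
have rxy w : op x cx (op y cy w) = heval (gwa_sigma lam eta phi) w.
  by rewrite op_comp (gwa_xy rel) addrC r4 -dd_phi_sg.
have w0 : (0, 1) != 0 :> W by apply/eqP => -[/eqP]; rewrite oner_eq0.
have [act [[actx acty actz] act1 actM actD]] :=
  @gwa_representation _ _ _ _ _ _ _ _ A_gwa W (0, 1) (linmap (op_linear x cx))
    (linmap (op_linear y cy)) (linmap (op_linear z cz)) heval w0
    heval0 hevalX rxz ryz ryx rxy.
have actE a : {d : M | forall w, act a w = op a d w}.
  apply: cid; elim/(gwa_ind A_gwa): a => [|c a b [d dE] [d' d'E]|a b [d dE] [d' d'E]|||].
  - exists 0 => -[m c]; rewrite act1 /op /= mul1r scaler0 addr0.
    by congr pair; rewrite -[envl 1]/(1 : R) scale1r.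
  - exists ((c%:A : R) *: d + d') => w.
    by rewrite actD dE d'E op_scale op_add.
  - by exists (envl a *: d' + envr b *: d) => w; rewrite actM d'E dE op_comp.
  - by exists cx.
  - by exists cy.
  - by exists cz.
pose delta a := sval (actE a).
have deltaE a w : act a w = op a (delta a) w := svalP (actE a) w.
exists delta; split=> [c a b|a b|].
- by apply: (@op_inj (c *: a + b)) => w; rewrite -deltaE actD !deltaE op_scale op_add.
- by apply: (@op_inj (a * b)) => w; rewrite -deltaE actM !deltaE op_comp.
split; [apply: (@op_inj x) | apply: (@op_inj y) | apply: (@op_inj z)] => w;
  rewrite -deltaE; [exact: actx | exact: acty | exact: actz].
Qed.
End Derivation.

Section Exact1.
Variables (k : fieldType) (lam eta : k) (phi : {poly k}).
Variables (A : algType k) (x y z : A).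
Hypotheses (lam_neq0 : lam != 0).
Hypothesis A_gwa : is_gwa lam eta phi x y z.
Variable D : {poly {poly k}}.
Hypothesis phiD : phi%:P - phi^:P = ('X%:P - 'X) * D.
Local Notation R := (env A).
Local Notation d1 := (gwa_d1 x y z).
Local Notation d2 := (gwa_d2 lam eta x y z D).

(** Let [delta] be the derivation of [A] into the cokernel of d2 whose values at z,
    x, y are the classes of the basis vectors. The map [L] sending a (x) b to
    delta(a) b sends r (g (x) 1 - 1 (x) g) to r delta(g), so it sends the value of d1
    at [v] to the class of [v]. *)
Lemma gwa_exact1 (v : 'rV[R]_3) : v *m d1 = 0 -> exists w : 'rV[R]_4, w *m d2 = v.
Proof.
move=> vd1.
have [M [c cE]] := cokernel_exists (mulmxr d2 : {linear 'rV[R]_4 -> 'rV[R]_3}).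
have c0 i : c (row i d2) = 0 by apply/cE; exists (delta_mx 0 i); rewrite /= -rowE.
have [r1 r2 r3 r4] := d2_relations c0.
have [delta [deltaP deltaM [dx dy dz]]] :=
  gwa_derivation A_gwa phiD r1 r2 r3 r4.
pose f (a b : A) : scalar_restr M := (envr b *: delta a : M).
have f_bilin : bilin f.
  split=> [b s a a' | a s b b'].
    transitivity (envr b *: ((s%:A : R) *: delta a + delta a') : M).
      by rewrite /f deltaP.
    transitivity ((s%:A : R) *: (envr b *: delta a) + envr b *: delta a' : M); last by [].
    by rewrite scalerDr !scalerA mulr_algl mulr_algr.
  transitivity ((s%:A : R) *: (envr b *: delta a) + envr b' *: delta a : M); last by [].
  by rewrite /f envr_linear scalerDl scalerA mulr_algl.
pose L (r : R) : M := env_lift f r.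
have LD r r' : L (r + r') = L r + L r' by apply: env_liftD f_bilin.
have Lt a b : L (tens a b) = envr b *: delta a by apply: env_lift_tens f_bilin.
have L0 : L 0 = 0 by apply: (addrI (L 0)); rewrite -LD !addr0.
have LB r r' : L (r - r') = L r - L r'.
  by apply: (addIr (L r')); rewrite -LD !subrK.
have Lg r g : L (r * (envl g - envr g)) = r *: delta g.
  elim/env_tens_ind: r => [|r r' IHr IHr'|a b].
  - by rewrite mul0r L0 scale0r.
  - by rewrite mulrDl LD IHr IHr' scalerDl.
  rewrite mulrBr LB !tensM mul1r mulr1 !Lt deltaM scalerDr !scalerA envrM addrK.
  by rewrite envrl.
apply/cE; rewrite (row3_image c v) -dz -dx -dy -!Lg -!LD -mul_d1 vd1 mxE.
exact: L0.
Qed.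
End Exact1.

Section Resolution.
Variables (k : fieldType) (lam eta : k) (phi : {poly k}).
Variables (A : algType k) (x y z : A).
Hypotheses (lam_neq0 : lam != 0) (phi_neq0 : phi != 0).
Hypothesis A_gwa : is_gwa lam eta phi x y z.
Variables (a b : {poly k}) (D e : {poly {poly k}}).
Hypothesis phiD : phi%:P - phi^:P = ('X%:P - 'X) * D.
Hypothesis bezout : b%:P * D + a%:P * phi%:P = 1 + ('X%:P - 'X) * e.
Local Notation R := (env A).
Local Notation d1 := (gwa_d1 x y z).
Local Notation d2 := (gwa_d2 lam eta x y z D).
Local Notation E := (gwa_proj lam eta x y z a b D e).

Let E_idem : E *m E = E := gwa_proj_idem lam_neq0 phi_neq0 A_gwa phiD bezout.
Let E_d2 : E *m d2 = d2 := gwa_proj_d2 lam_neq0 phi_neq0 A_gwa phiD bezout.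
Let E_ker n (w : 'M[R]_(n, 4)) : w *m d2 = 0 -> w *m E = 0.
Proof. by apply: (gwa_proj_ker lam_neq0 phi_neq0 A_gwa phiD bezout). Qed.

Definition gwa_term (i : nat) : lmodType R :=
  match i with
  | 0%N => R^o
  | 1%N => 'rV[R]_3
  | 2%N => fixed_rows E
  | _ => 'rV[R]_0
  end.

Definition gwa_diff0 (v : 'rV[R]_3) : R^o := (v *m d1) 0 0.
Lemma gwa_diff0_linear : linear gwa_diff0.
Proof. by move=> c u v; rewrite /gwa_diff0 mulmxDl -scalemxAl !mxE. Qed.

Definition gwa_diff1 (w : fixed_rows E) : 'rV[R]_3 := fixed_val w *m d2.
Lemma gwa_diff1_linear : linear gwa_diff1.
Proof. by move=> c u v; rewrite /gwa_diff1 linearP mulmxDl -scalemxAl. Qed.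

Definition gwa_diff (i : nat) : {linear gwa_term i.+1 -> gwa_term i} :=
  match i return {linear gwa_term i.+1 -> gwa_term i} with
  | 0%N => linmap gwa_diff0_linear
  | 1%N => linmap gwa_diff1_linear
  | i => \0
  end.

Lemma gwa_term_retract i : exists n (f : {linear gwa_term i -> 'rV[R]_n})
  (g : {linear 'rV[R]_n -> gwa_term i}), forall p, g (f p) = p.
Proof.
case: i => [|[|[|i]]].
- have fl : linear (fun r : R^o => r *: (1%:M : 'rV[R]_1)).
    by move=> c r r'; rewrite scalerDl scalerA.
  have gl : linear (fun v : 'rV[R]_1 => v 0 0 : R^o) by move=> c u v; rewrite !mxE.
  by exists 1%N, (linmap fl), (linmap gl) => p; rewrite /= !mxE mulr1.
- by exists 3%N, idfun, idfun.
- exists 4%N, (@fixed_val R 4 E : {linear fixed_rows E -> 'rV[R]_4}),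
    (fixed_proj E_idem : {linear 'rV[R]_4 -> fixed_rows E}).
  exact: fixed_projK.
by exists 0%N, idfun, idfun.
Qed.

Lemma gwa_term_projective i : projective (gwa_term i).
Proof. by have [n [f [g gf]]] := gwa_term_retract i; apply: projective_retract gf. Qed.

Lemma gwa_term_fin_gen i : fin_gen (gwa_term i).
Proof.
have [n [f [g gf]]] := gwa_term_retract i.
by apply: (fin_gen_surj (r := g)) => p; exists (f p).
Qed.

Lemma gwa_aug_surj m : exists u : R^o, env_aug u = m.
Proof. by exists (envl (m : A)); rewrite env_aug_tens mulr1. Qed.

Lemma gwa_exact_aug (u : R^o) : env_aug u = 0 <-> exists v, gwa_diff 0 v = u.
Proof.
split=> [/(gwa_exact0 A_gwa)[v vE]|[v <-]]; first by exists v.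
exact: gwa_d1_aug.
Qed.

Lemma gwa_exact i (u : gwa_term i.+1) :
  gwa_diff i u = 0 <-> exists v, gwa_diff i.+1 v = u.
Proof.
case: i u => [|[|i]] u.
- split=> [u0|[v <-]]; last first.
    by rewrite /= /gwa_diff0 /gwa_diff1 -mulmxA (gwa_d21 lam_neq0 A_gwa phiD bezout) mulmx0 mxE.
  have [|w wE] := gwa_exact1 A_gwa phiD (v := u).
    by apply/matrixP => i j; rewrite !ord1 [RHS]mxE.
  exists (fixed_proj E_idem w).
  by rewrite /= /gwa_diff1 /fixed_val /= -mulmxA E_d2.
- split=> [u0|[v <-]]; last by rewrite linear0.
  exists 0; rewrite linear0; apply: val_inj; apply: esym.
  by have /eqP <- := valP u; apply: E_ker.
split=> [_|[v <-]]; last by [].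
by exists 0; apply/matrixP => j [].
Qed.

Definition gwa_resolution : resolution (regbim A) :=
  @Resolution R (regbim A) gwa_term gwa_diff (linmap (@env_aug_linear k A))
    gwa_term_projective gwa_aug_surj gwa_exact_aug gwa_exact.

Lemma gwa_resolution_length : res_length_le gwa_resolution 2.
Proof. by case=> [|[|[|i]]] // _ u; apply/matrixP => j []. Qed.
End Resolution.

(** * The Ext groups and the Nakayama automorphism *)

Section HomologyTo.
Variables (R : pzRingType) (V0 V1 V2 N : lmodType R).
Variables (f : {linear V0 -> V1}) (g : {linear V1 -> V2}).

Lemma homology_eq0 : (forall v, g v = 0 -> exists w, f w = v) ->
  forall u : homology f g, u = 0.
Proof.
move=> ex; elim/homology_ind=> u; apply/homologyP.
by have [w wE] := ex _ (eqP (valP u)); exists w; rewrite wE subr0.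
Qed.

Lemma homology_to (mu : {linear V1 -> N}) :
  (forall w, mu (f w) = 0) ->
  (forall v, g v = 0 -> mu v = 0 -> exists w, f w = v) ->
  (forall n, exists2 v, g v = 0 & mu v = n) ->
  exists h : {linear homology f g -> N}, bijective h.
Proof.
move=> mu_f mu_inj mu_surj.
pose h (a : homology f g) : N := mu (val (repr a)).
have hE c : h (\pi_(homology f g) c) = mu (val c).
  have [w wE] := repr_homology f c; apply/eqP; rewrite -subr_eq0 /h.
  by rewrite -linearB -wE mu_f.
have hl : linear h.
  move=> r; elim/homology_ind=> a; elim/homology_ind=> b.
  have -> : r *: \pi_(homology f g) a + \pi_(homology f g) b =
      \pi_(homology f g) (r *: a + b).
    by rewrite [X in X + _]homology_pi_scale [LHS]homology_pi_add.
  by rewrite !hE -linearP.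
have inv_ex n : {c : cycles g | mu (val c) = n}.
  apply: cid; have [v gv mv] := mu_surj n.
  by exists (Sub v (introT eqP gv)).
exists (linmap hl), (fun n => \pi_(homology f g) (sval (inv_ex n))); last first.
  by move=> n; rewrite /= hE; case: (inv_ex n).
elim/homology_ind=> u; rewrite /= hE; apply/homologyP.
have gval c : g (val (c : cycles g)) = 0 by apply/eqP/(valP c).
apply: mu_inj; first by rewrite linearB !gval subrr.
by rewrite linearB (svalP (inv_ex (mu (val u)))) subrr.
Qed.
End HomologyTo.

Section Nakayama.
Variables (k : fieldType) (lam eta : k) (phi : {poly k}).
Variables (A : algType k) (x y z : A).
Hypothesis lam_neq0 : lam != 0.
Hypothesis A_gwa : is_gwa lam eta phi x y z.

(** The relations are invariant under x |-> c x, y |-> c^-1 y. *)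
Lemma gwa_rescale : exists nu : {lrmorphism A -> A},
  [/\ bijective nu, nu x = lam *: x, nu y = lam^-1 *: y & nu z = z].
Proof.
have resc c : c != 0 -> exists f : {lrmorphism A -> A},
    [/\ f x = c *: x, f y = c^-1 *: y & f z = z].
  move=> c0; have rel : gwa_rel lam eta phi (c *: x) (c^-1 *: y) z.
    case: A_gwa.1 => r1 r2 r3 r4; split.
    - by rewrite -scalerAl r1 scalerAr.
    - by rewrite -scalerAl r2 scalerAr.
    - by rewrite -scalerAl -scalerAr scalerA mulVf // scale1r.
    - by rewrite -scalerAl -scalerAr scalerA mulfV // scale1r.
  by have [f [fE _]] := A_gwa.2 _ _ _ _ rel; exists f.
have comp_id c (f g : {lrmorphism A -> A}) : c != 0 ->
    [/\ f x = c *: x, f y = c^-1 *: y & f z = z] ->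
    [/\ g x = c^-1 *: x, g y = c^-1^-1 *: y & g z = z] -> cancel f g.
  move=> c0 [fx fy fz] [gx gy gz].
  elim/(gwa_ind A_gwa) => [|d a b IHa IHb|a b IHa IHb|||].
  - by rewrite !rmorph1.
  - by rewrite linearP /= linearP /= IHa IHb.
  - by rewrite (rmorphM f) (rmorphM g) /= IHa IHb.
  - by rewrite fx linearZ /= gx scalerA divff // scale1r.
  - by rewrite fy linearZ /= gy scalerA invrK mulVf // scale1r.
  - by rewrite fz.
have [f fE] := resc _ lam_neq0; have lamV0 : lam^-1 != 0 by rewrite invr_eq0.
have [g gE] := resc _ lamV0; exists f; case: (fE) => fx fy fz; split=> //.
exists g; first exact: comp_id fE gE.
by apply: (comp_id _ _ _ lamV0 gE); rewrite !invrK.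
Qed.
End Nakayama.

Section ExtGwa.
Variables (k : fieldType) (lam eta : k) (phi : {poly k}).
Variables (A : algType k) (x y z : A).
Hypotheses (lam_neq0 : lam != 0) (phi_neq0 : phi != 0).
Hypothesis A_gwa : is_gwa lam eta phi x y z.
Variables (a b : {poly k}) (D e : {poly {poly k}}).
Hypothesis phiD : phi%:P - phi^:P = ('X%:P - 'X) * D.
Hypothesis bezout : b%:P * D + a%:P * phi%:P = 1 + ('X%:P - 'X) * e.
Variable nu : {lrmorphism A -> A}.
Hypotheses (nu_x : nu x = lam *: x) (nu_y : nu y = lam^-1 *: y) (nu_z : nu z = z).
Local Notation R := (env A).
Local Notation hz := (horner_alg z).
Local Notation theta := (theta z).
Local Notation sg := (aff lam eta).
Local Notation d1 := (gwa_d1 x y z).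
Local Notation d2 := (gwa_d2 lam eta x y z D).
Local Notation E := (gwa_proj lam eta x y z a b D e).
Local Notation gen := (gwa_gen lam eta x y z D).
Local Notation rho := (gwa_rho lam eta x z a b).
Local Notation hmt := (gwa_hmt lam eta x z a b e).
Local Notation P := (gwa_resolution lam_neq0 phi_neq0 A_gwa phiD bezout).
Local Notation tau := (@env_swap k A).

Let rel := A_gwa.1.
Let E_idem : E *m E = E := gwa_proj_idem lam_neq0 phi_neq0 A_gwa phiD bezout.

(** The map a (x) b |-> b nu(a), written through the left action of [R] on A^nu. *)
Definition trace (r : R) : twist nu := (env_swap r : R) *: (1 : twist nu).

Lemma trace_tens c d : trace (tens c d) = (d * nu c : A).
Proof. by rewrite /trace env_swap_tens [LHS]twist_scale_tens mulr1. Qed.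
Lemma traceD r r' : trace (r + r') = trace r + trace r'.
Proof. by rewrite /trace env_swapD scalerDl. Qed.
Lemma trace0 : trace 0 = 0.
Proof. by apply: (addrI (trace 0)); rewrite -traceD !addr0. Qed.
Lemma traceB r r' : trace (r - r') = trace r - trace r'.
Proof. by apply: (addIr (trace r')); rewrite -traceD !subrK. Qed.
Lemma traceM r r' : trace (r * r') = (env_swap r' : R) *: trace r.
Proof. by rewrite /trace env_swapM scalerA. Qed.
Lemma trace_ideal r r' : trace r = 0 -> trace (r * r') = 0.
Proof. by move=> r0; rewrite traceM r0 scaler0. Qed.
Lemma trace1 : trace 1 = (1 : A).
Proof. by rewrite -[1]/(tens 1 1) trace_tens rmorph1 mulr1. Qed.

Lemma trace_z12 p r : trace (theta (('X%:P - 'X) * p) * r) = 0.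
Proof.
rewrite (rmorphM theta) /= -mulrA; apply: trace_ideal.
rewrite thetaB thetaC thetaX horner_algX traceB.
by rewrite [trace (envl z)]trace_tens [trace (envr z)]trace_tens rmorph1 nu_z mulr1 mul1r subrr.
Qed.

Let nu_hz p : nu (hz p) = hz p. Proof. by rewrite lrmorph_horner_alg nu_z. Qed.

Let sgK p : p \Po sg \Po affV lam eta = p.
Proof. by rewrite -comp_polyA comp_aff_affV // comp_polyXr. Qed.

(** Hence the trace of [rho] times a column depends only on the class of the column
    modulo the columns of d2. *)
Lemma trace_rho_d2 j : trace ((rho *m d2) 0 j) = 0.
Proof.
have thc (q : {poly k}) r : theta q%:P * envr r = tens (hz q) r.
  by rewrite thetaC envlr.
case: j => -[|[|[|//]]] lt_j.
- have -> : Ordinal lt_j = 0 by apply: val_inj.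
  rewrite (gwa_rho_d2_z lam_neq0 A_gwa phiD bezout) /=.
  rewrite traceD traceB -[X in trace X - _]mulr1 trace_z12 sub0r.
  have -> : theta (substl sg a%:P) * envl x * envr y = tens (hz (a \Po sg) * x) y.
    by rewrite substlC thetaC -rmorphM envlr.
  have -> : theta (lam%:P%:P * a%:P * phi%:P) = tens (hz (lam%:P * a * phi)) 1.
    by rewrite -!polyCM thetaC.
  rewrite !trace_tens mul1r nu_hz (rmorphM nu) /= nu_hz nu_x.
  rewrite -mulrA mul_polyC [hz (lam *: _)]linearZ /= mulr_algl horner_algM.
  by rewrite -!scalerAr mulrA (gwa_yM rel) sgK -mulrA (gwa_yx rel) addNr.
- have -> : Ordinal lt_j = 1 by apply: val_inj.
  rewrite gwa_rho_d2_x substlC -polyCM traceB /= thc thetaC -rmorphM /=.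
  rewrite !trace_tens (rmorphM nu) /= mul1r !nu_hz nu_y (gwa_yM rel) sgK.
  rewrite mul_polyC [hz (lam *: _)]linearZ /= mulr_algl -scalerAl -scalerAr scalerA.
  by rewrite divff // scale1r subrr.
have -> : Ordinal lt_j = 2%:R by apply: val_inj.
rewrite (gwa_rho_d2_y lam_neq0 A_gwa a b D) /= -['X - _]opprB mulNr -mulrN.
rewrite traceB trace_z12 subr0 substlC -polyCM traceB thc thetaC -rmorphM /=.
rewrite !trace_tens (rmorphM nu) /= mul1r !nu_hz nu_x.
rewrite mul_polyC [hz (lam *: _)]linearZ /= mulr_algl -!scalerAr (gwa_xM rel).
by rewrite subrr.
Qed.

(** The value of a functional on this row is the product of [rho] with the column
    that represents the functional. *)
Definition gwa_omega : fixed_rows E := fixed_proj E_idem rho.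

Let mu (h : dual tau (fixed_rows E)) : twist nu := trace (dual_fun h gwa_omega).
Let mu_linear : linear mu.
Proof.
move=> r h h'; rewrite /mu -[dual_fun (_ + _) _]/(dual_fun h gwa_omega * (env_swap r : R) + dual_fun h' gwa_omega).
by rewrite traceD traceM env_swapK.
Qed.

Lemma row_functional n (h : dual tau 'rV[R]_n) v :
  dual_fun h v = (v *m (\col_j (dual_fun h (delta_mx 0 j) : R))) 0 0.
Proof.
rewrite [v in LHS]row_sum_delta linear_sum mxE; apply: eq_bigr => j _.
by rewrite linearZ mxE.
Qed.

Lemma col_functional_linear n (c : 'cV[R]_n) :
  linear (fun v : 'rV[R]_n => (v *m c) 0 0 : R^o).
Proof. by move=> r u v; rewrite mulmxDl -scalemxAl !mxE. Qed.
Definition col_functional n (c : 'cV[R]_n) : dual tau 'rV[R]_n :=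
  dual_mk tau (col_functional_linear c).

Let mu_boundary (h : dual tau 'rV[R]_3) :
  mu (dual_map (tau := tau) (res_d P 1) h) = 0.
Proof.
rewrite /mu -[dual_fun _ _]/(dual_fun h (fixed_val gwa_omega *m d2)).
rewrite /fixed_val /= -mulmxA (gwa_proj_d2 lam_neq0 phi_neq0 A_gwa phiD bezout).
rewrite row_functional mxE; elim/big_rec: _ => [|j r _ r0]; first exact: trace0.
by rewrite traceD r0 addr0; apply/trace_ideal/trace_rho_d2.
Qed.

(** The [r] such that [gen] times [r] is a combination of the columns of d2 form a
    right ideal. It contains c (x) 1 - 1 (x) nu(c) for c = x, y, z, hence for all c,
    and these elements generate the kernel of the trace. *)
Lemma gen_ideal r : trace r = 0 -> exists c : 'cV[R]_3, gen *m r%:M = d2 *m c.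
Proof.
pose I (r : R) := exists c : 'cV[R]_3, gen *m r%:M = d2 *m c.
have ID r1 r2 : I r1 -> I r2 -> I (r1 + r2).
  by move=> [c cE] [d dE]; exists (c + d); rewrite raddfD !mulmxDr cE dE.
have IM r1 r2 : I r1 -> I (r1 * r2).
  by move=> [c cE]; exists (c *m r2%:M); rewrite scalar_mxM !mulmxA cE.
have I0 : I 0 by exists 0; rewrite raddf0 !mulmx0.
have Inu c : I (envl c - envr (nu c)).
  elim/(gwa_ind A_gwa): c => [|s c d Ic Id|c d Ic Id|||].
  - by rewrite (rmorph1 nu) subrr.
  - rewrite (linearP nu) /= envl_linear envr_linear opprD addrACA -scalerBr; apply: (ID) => //.
    by rewrite -mulr_algr; apply: IM.
  - rewrite (rmorphM nu) /= envrM rmorphM /=.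
    have -> : envl c * envl d - envr (nu d) * envr (nu c) =
        (envl c - envr (nu c)) * envl d + (envl d - envr (nu d)) * envr (nu c).
      by rewrite !mulrBl env_comm addrA subrK.
    by apply: (ID); apply: IM.
  - rewrite nu_x; have -> : envr (lam *: x) = theta lam%:P%:P * envr x.
      by rewrite thetaC horner_algC envl_alg mulr_algl; apply: linearZ.
    by have := gwa_gen_x lam_neq0 A_gwa phiD bezout; eexists; eassumption.
  - rewrite nu_y; have -> : envr (lam^-1 *: y) = theta lam^-1%:P%:P * envr y.
      by rewrite thetaC horner_algC envl_alg mulr_algl; apply: linearZ.
    by have := gwa_gen_y lam_neq0 A_gwa phiD bezout; eexists; eassumption.
  rewrite nu_z; have -> : envl z - envr z = theta ('X%:P - 'X).
    by rewrite thetaB thetaC thetaX horner_algX.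
  by have := gwa_gen_z lam_neq0 A_gwa phiD bezout; eexists; eassumption.
suff Itr : I (r - envr (trace r : A)) by move=> r0; move: Itr; rewrite r0 raddf0 subr0.
elim/env_tens_ind: r => [|r1 r2 I1 I2|c d].
- by rewrite trace0 raddf0 subr0.
- by rewrite traceD raddfD opprD addrACA; apply: ID.
by rewrite trace_tens envrM -envlr -mulrBl; apply: IM.
Qed.

Let mu_injective (h : dual tau (fixed_rows E)) : mu h = 0 ->
  exists h' : dual tau 'rV[R]_3, dual_map (tau := tau) (res_d P 1) h' = h.
Proof.
move=> mu_h.
pose g : 'cV[R]_4 := \col_j (dual_fun h (fixed_proj E_idem (delta_mx 0 j)) : R).
have hproj v : dual_fun h (fixed_proj E_idem v) = (v *m g) 0 0.
  rewrite [v in LHS]row_sum_delta !linear_sum mxE; apply: eq_bigr => j _.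
  by rewrite !linearZ mxE.
(* The column [g] of [h] is [E g = gen (rho g) + d2 (hmt g)], and the first term is
   a combination of the columns of d2 as [rho g] has trace 0. *)
have [c cE] := gen_ideal mu_h.
have rhog : rho *m g = (dual_fun h gwa_omega : R)%:M.
  by apply/matrixP => i j; rewrite !ord1 -hproj mxE eqxx mulr1n.
exists (col_functional (c + hmt *m g)); apply: dualP => w.
rewrite -[LHS]/((fixed_val w *m d2 *m (c + hmt *m g)) 0 0).
have -> : dual_fun h w = (fixed_val w *m g) 0 0 by rewrite -hproj fixed_projK.
have wE : fixed_val w = fixed_val w *m E by apply/esym/eqP/(valP w).
have gE (v : 'rV[R]_4) : v *m E *m g = v *m d2 *m (c + hmt *m g).
  rewrite (gwa_factor lam_neq0 A_gwa phiD bezout) -!mulmxA mulmxDl -!mulmxA.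
  by rewrite rhog cE -mulmxDr.
by rewrite [in RHS]wE gE.
Qed.

Let mu_surjective (n : twist nu) : exists h, mu h = n.
Proof.
pose g0 : dual tau (fixed_rows E) :=
  dual_map (tau := tau) (@fixed_val R 4 E : {linear fixed_rows E -> 'rV[R]_4})
    (col_functional gen).
(* [rho E gen = (rho gen)^2 + rho d2 hmt gen], where [rho gen] is 1 modulo z1 - z2
   and the second term has trace 0. *)
have mu_g0 : mu g0 = (1 : A).
  rewrite /mu -[dual_fun _ _]/((rho *m E *m gen) 0 0).
  rewrite (gwa_factor lam_neq0 A_gwa phiD bezout) mulmxDr mulmxDl !mulmxA.
  rewrite -[rho *m gen *m rho *m gen]mulmxA -[_ *m hmt *m gen]mulmxA.
  rewrite mxE [X in X + _]mxE big_ord1 [X in _ + X]mxE traceD.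
  rewrite (big_morph trace traceD trace0) [X in _ + X]big1 => [|j _]; last first.
    exact/trace_ideal/trace_rho_d2.
  rewrite (gwa_rho_gen lam_neq0 A_gwa phiD bezout) addr0 mulrDl mul1r traceD.
  by rewrite trace_z12 addr0 traceD trace1 -[X in trace X]mulr1 trace_z12 addr0.
exists ((envl (n : A)) *: g0); have := mu_linear (envl (n : A)) g0 0.
rewrite addr0 => ->; rewrite [mu 0]trace0 addr0 mu_g0.
by rewrite [LHS]twist_scale_tens rmorph1 !mulr1.
Qed.

Lemma gwa_Ext2 : exists h : {linear Ext tau P 2 -> twist nu}, bijective h.
Proof.
apply: (@homology_to _ _ _ _ _ _ _ (linmap mu_linear)) => [w|v _|n].
- exact: mu_boundary.
- exact: mu_injective.
have [h hE] := mu_surjective n; exists h => //.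
by apply: dualP => p; apply: linear0.
Qed.

Lemma gwa_Ext_eq0 (i : nat) : i <> 2%N -> forall u : Ext tau P i, u = 0.
Proof.
have z12 : 'X%:P - 'X != 0 :> {poly {poly k}}.
  apply/eqP => /(congr1 (fun u : {poly {poly k}} => u`_1)) /eqP.
  by rewrite coefB coefC coefX coef0 sub0r oppr_eq0 oner_eq0.
have d1_00 : d1 0 0 = theta ('X%:P - 'X) by rewrite mxE.
case: i => [|[|[|i]]] //= _; apply: homology_eq0 => h h0.
- have hE (r : R^o) : dual_fun h r = r * (dual_fun h (1 : R^o) : R) :> R.
    transitivity (dual_fun h (r *: (1 : R^o))); last by rewrite linearZ.
    by congr (dual_fun h _); apply: esym; apply: mulr1.
  have h1 : dual_fun h (1 : R^o) = 0 :> R.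
    apply: (theta_regular lam_neq0 phi_neq0 A_gwa z12); rewrite -hE -d1_00.
    have := congr1 (fun f => dual_fun f (delta_mx 0 0 : 'rV[R]_3)) h0.
    by rewrite /= /gwa_diff0 -rowE mxE.
  exists 0; apply: dualP => r; rewrite [RHS]hE h1 mulr0.
  by [].
- pose c : 'cV[R]_3 := \col_j (dual_fun h (delta_mx 0 j) : R).
  have hE v : dual_fun h v = (v *m c) 0 0 := row_functional h v.
  have c0 : d2 *m c = 0.
    apply/colP => i; rewrite [RHS]mxE.
    have := congr1 (fun f => dual_fun f (fixed_proj E_idem (delta_mx 0 i))) h0.
    rewrite /= /gwa_diff1 /fixed_val /= -mulmxA.
    rewrite (gwa_proj_d2 lam_neq0 phi_neq0 A_gwa phiD bezout) hE.
    by rewrite -mulmxA -rowE mxE.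
  have row0 (g : 'cV[R]_3) : (d2 *m g) 0 0 = (envl x - theta lam%:P%:P * envr x) * g 0 0
      + theta ('X - substl sg 'X%:P) * g 1 0.
    rewrite mxE !big_ord_recl big_ord0 !mxE /= mul0r !addr0.
    by congr (_ * g _ _ + _ * g _ _); apply: val_inj.
  have row1 (g : 'cV[R]_3) : (d2 *m g) 1 0 = (envl y - theta lam^-1%:P%:P * envr y) * g 0 0
      + theta ('X - substl (affV lam eta) 'X%:P) * g 2%:R 0.
    rewrite mxE !big_ord_recl big_ord0 !mxE /= mul0r add0r addr0.
    by congr (_ * g _ _ + _ * g _ _); apply: val_inj.
  (* Subtracting the coboundary of [r] makes the value at z vanish; then the first
     two rows of d2 annihilate the values at x and y up to regular factors. *)
  have [r rE] : exists r, c 0 0 = theta ('X%:P - 'X) * r.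
    apply: (commutator_x lam_neq0 phi_neq0 A_gwa (r' := c 1 0)).
    have := row0 c; rewrite c0 mxE substlC comp_polyX => /esym/eqP.
    have -> : theta (sg%:P - 'X) = - theta ('X - sg%:P) by rewrite !thetaB opprB.
    by rewrite mulrBl mulrA mulNr addr_eq0 => /eqP.
  pose g := c - d1 *m r%:M.
  have g0 : d2 *m g = 0.
    by rewrite mulmxBr c0 mulmxA (gwa_d21 lam_neq0 A_gwa phiD bezout) mul0mx subrr.
  have g_z : g 0 0 = 0.
    rewrite [LHS]mxE [X in _ + X]mxE [X in _ - X]mxE big_ord1 rE d1_00.
    by rewrite [_%:M _ _]mxE eqxx mulr1n subrr.
  have reg (p : {poly k}) u : theta ('X - p%:P) * u = 0 -> u = 0.
    apply: (theta_regular lam_neq0 phi_neq0 A_gwa).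
    apply/eqP => /(congr1 (fun u : {poly {poly k}} => u`_1)) /eqP.
    by rewrite coefB coefC coefX coef0 subr0 oner_eq0.
  have g_x : g 1 0 = 0.
    have := row0 g; rewrite g0 mxE g_z mulr0 add0r substlC => /esym.
    exact: reg.
  have g_y : g 2%:R 0 = 0.
    have := row1 g; rewrite g0 mxE g_z mulr0 add0r substlC => /esym.
    exact: reg.
  have {g_z g_x g_y}gE : c = d1 *m r%:M.
    apply/eqP; rewrite -subr_eq0 -/g; apply/eqP/colP => j; rewrite [RHS]mxE.
    case: j => -[|[|[|//]]] lt_j.
    + by rewrite (_ : Ordinal lt_j = 0) //; apply: val_inj.
    + by rewrite (_ : Ordinal lt_j = 1) //; apply: val_inj.
    by rewrite (_ : Ordinal lt_j = 2%:R) //; apply: val_inj.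
  have fl : linear (fun s : R^o => s * r : R^o).
    by move=> s u v; rewrite mulrDl; congr (_ + _); apply: esym; apply: mulrA.
  exists (dual_mk tau fl : dual tau R^o); apply: dualP => v.
  rewrite [RHS]hE gE mulmxA [RHS]mxE big_ord1 [_%:M _ _]mxE eqxx mulr1n.
  by [].
exists 0; rewrite linear0; apply: dualP => p.
have -> : p = 0 by apply/matrixP => j [].
by rewrite !linear0.
Qed.
End ExtGwa.

Theorem theorem1p1 (k : fieldType) (lam eta : k) (phi : {poly k})
    (A : algType k) (x y z : A)
    (lam_neq0 : lam != 0) (phi_neq0 : phi != 0)
    (A_gwa : is_gwa lam eta phi x y z)
    (phi_sep : separable_poly phi) :
  [/\ hochschild_cdim A 2, homologically_smooth A
    & exists nu : {lrmorphism A -> A},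
        [/\ bijective nu, nu x = lam *: x, nu y = lam^-1 *: y, nu z = z
          & twisted_CY nu 2]].
Proof.
have [D phiD] := divided_difference phi.
have [a [b [e bezout]]] := separable_bezout_diag phi_sep phiD.
pose P := gwa_resolution lam_neq0 phi_neq0 A_gwa phiD bezout.
have P_length : res_length_le P 2 by apply: gwa_resolution_length.
have smooth : homologically_smooth A.
  exists P; split; last by exists 2.
  exact: (gwa_term_fin_gen lam_neq0 phi_neq0 A_gwa phiD bezout).
have [nu [nu_bij nu_x nu_y nu_z]] := gwa_rescale lam_neq0 A_gwa.
have CY : twisted_CY nu 2.
  split=> // P'; split=> [i i_neq2 u|].
    have [h /bij_inj h_inj] := Ext_resolution_iso (@env_swap k A) P' P i.
    apply: h_inj; rewrite linear0.
    exact: gwa_Ext_eq0.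
  have [h h_bij] := Ext_resolution_iso (@env_swap k A) P' P 2.
  have [g g_bij] := gwa_Ext2 lam_neq0 phi_neq0 A_gwa phiD bezout nu_x nu_y nu_z.
  by exists (g \o h); apply: bij_comp.
split=> //; last by exists nu.
split=> [|m [P' P'_length]]; first by exists P.
rewrite leqNgt; apply/negP => m_lt2.
have [h [g _ hK]] := (CY.2 P').2.
(* A shorter resolution would make Ext^2 vanish. *)
have Ext0 u : u = 0 :> Ext (@env_swap k A) P' 2.
  apply: homology_eq0 => f _; exists 0; apply: dualP => p.
  by rewrite (P'_length 2 m_lt2 p) !linear0.
have : (1 : A) = 0 by rewrite -[LHS](hK (1 : A)) (Ext0 (g _)) linear0.
by move/eqP; rewrite oner_eq0.
Qed.
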